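(* Let $G$ be a moderately computable graph. If $G$ satisfies $\mathcal{E}_1$, then it is algorithmically decidable, given a finite path $t\colon\llbracket 0,b\rrbracket\to G$, whether $t$ can be extended to a one-way infinite Eulerian path on $G$. If $G$ satisfies $\mathcal{E}_2$, then it is algorithmically decidable, given a finite path $t\colon\llbracket a,b\rrbracket\to G$, whether $t$ can be extended to a two-way infinite Eulerian path on $G$.
   Context: Graphs are undirected, finite or infinite; loops and multiple edges are allowed. Each edge joins a pair of (possibly equal) vertices and is incident to them. The degree $\deg_G(v)\in\mathbb{N}\cup\{\infty\}$ is the number of edges incident to $v$, loops counted twice; ''even degree'' or ''odd degree'' means finite and even, resp. finite and odd. A graph is finite if its edge set is finite, and infinite otherwise. $0\in\mathbb{N}$. A graph homomorphism sends vertices to vertices and edges to edges, compatibly with incidence. $\llbracket a,b\rrbracket$ (integers $a\le b$) is the graph with vertex set $\{a,\dots,b\}$ and an edge $\{c,c+1\}$ joining $c$ to $c+1$ for each $a\le c<b$; $\llbracket\mathbb{N}\rrbracket$ and $\llbracket\mathbb{Z}\rrbracket$ are defined similarly. A path, also called finite path (resp. one-way infinite path, two-way infinite path), on $G$ is a graph homomorphism from some $\llbracket a,b\rrbracket$ (resp. from $\llbracket\mathbb{N}\rrbracket$, from $\llbracket\mathbb{Z}\rrbracket$) to $G$ that does not repeat edges (vertices may repeat). It is Eulerian if it visits every edge of $G$ exactly once. A finite or infinite path extends the finite path $t$ if its restriction to the domain of $t$ equals $t$. $G$ is connected if every pair of vertices is joined by a path. For a set of edges $E\subset E(G)$, $G[E]$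 is the subgraph with edge set $E$ and vertex set the vertices incident to some edge in $E$; $G-E$ is $G[E(G)\setminus E]$ (remove the edges in $E$, then all vertices left without incident edges). A connected component is a maximal connected subgraph. The number of ends of $G$ is the supremum, over finite sets $E$ of edges, of the number of infinite connected components of $G-E$. $G$ satisfies $\mathcal{E}_1$ if: $E(G)$ is countable and infinite; $G$ is connected; either $G$ has exactly one vertex with odd degree, or $G$ has at least one vertex with infinite degree and no vertices with odd degree; $G$ has one end. $G$ satisfies $\mathcal{E}_2$ if: $E(G)$ is countable and infinite; $G$ is connected; the degree of each vertex is infinite or even; $G$ has one or two ends, and moreover, whenever $E$ is a finite set of edges such that all vertices of $G[E]$ have even degree in $G[E]$, the graph $G-E$ has one infinite connected component. A graph is computable when its vertex and edge sets are indexed by decidable sets of natural numbers in such a manner that the adjacency relation $\{(u,v)\in V(G)^2\mid u,v\text{ adjacent}\}$ and the incidence relation $\{(e,u,v)\in E(G)\times V(G)^2\mid e\text{ joins }u\text{ to }v\}$ are decidable. A moderately computable graph is a computable graph for which the vertex degree function $\deg_G\colon V(G)\to\mathbb{N}\cup\{\infty\}$ is computable. Finite paths are given to algorithms as finite objects (endpoints of the domain and lists of indices of vertices and edges), coded by natural numbers in a canonical way. The algorithm may depend on $G$. *)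

(* Defs.v *)
From mathcomp Require Import all_boot all_order all_algebra.
From mathcomp Require Import mathcomp_extra boolp classical_sets functions cardinality.

Set Implicit Arguments.
Unset Strict Implicit.
Unset Printing Implicit Defensive.

Import Order.TTheory GRing.Theory Num.Theory.

Local Open Scope classical_set_scope.
Local Open Scope card_scope.

(* Algorithms are programs for Kleene's partial (mu-)recursive functions. *)
Inductive recfun : nat -> Type :=
| Zero n : recfun n
| Succ : recfun 1
| Proj n (i : 'I_n) : recfun n
| Comp n k (f : recfun k) (g : 'I_k -> recfun n) : recfun n
| PrimRec n (f : recfun n) (g : recfun n.+2) : recfun n.+1
| Mu n (f : recfun n.+1) : recfun n.

(* [eval f xs y]: the computation of [f] on input [xs] halts with output [y].
   The recursion variable of [PrimRec] and the search variable of [Mu] come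
   first; the step function of [PrimRec] gets the recursion variable, the
   previous value, then the parameters. *)
Inductive eval : forall n, recfun n -> n.-tuple nat -> nat -> Prop :=
| eval_zero n (xs : n.-tuple nat) : eval (Zero n) xs 0
| eval_succ (x : nat) : eval Succ [tuple x] x.+1
| eval_proj n (i : 'I_n) (xs : n.-tuple nat) : eval (Proj i) xs (tnth xs i)
| eval_comp n k (f : recfun k) (g : 'I_k -> recfun n)
    (xs : n.-tuple nat) (ys : k.-tuple nat) (z : nat) :
    (forall i, eval (g i) xs (tnth ys i)) -> eval f ys z ->
    eval (Comp f g) xs z
| eval_rec0 n (f : recfun n) (g : recfun n.+2) (xs : n.-tuple nat) (y : nat) :
    eval f xs y -> eval (PrimRec f g) [tuple of 0 :: xs] y
| eval_recS n (f : recfun n) (g : recfun n.+2) (xs : n.-tuple nat)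
    (m y z : nat) :
    eval (PrimRec f g) [tuple of m :: xs] y ->
    eval g [tuple of m :: y :: xs] z ->
    eval (PrimRec f g) [tuple of m.+1 :: xs] z
| eval_mu n (f : recfun n.+1) (xs : n.-tuple nat) (m : nat) (ys : nat -> nat) :
    (forall k, k < m -> eval f [tuple of k :: xs] (ys k).+1) ->
    eval f [tuple of m :: xs] 0 ->
    eval (Mu f) xs m.

Definition decidable_rel n (A : set (n.-tuple nat)) : Prop :=
  exists p : recfun n, forall xs, eval p xs `[< A xs >].

(* The decision problem "given [x] in [D], does [Q x] hold?", where the
   instances [x] are presented to the algorithm through [code]. *)
Definition algorithmically_decidable T (D : set T) (code : T -> nat)
    (Q : set T) : Prop :=
  exists p : recfun 1, forall x, D x -> eval p [tuple code x] `[< Q x >].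

(* Vertices and edges are taken from ambient types [V] and [E], so that a
   subgraph of [G] is again a [graph V E].  [joins e u v] says that [e] is an
   edge of the graph whose (unordered) pair of ends is [{u, v}]; a loop has
   [u = v]. *)
Record graph (V E : Type) := Graph {
  vset : set V ;
  joins : E -> V -> V -> Prop ;
  joins_sym : forall e u v, joins e u v -> joins e v u ;
  joins_pair : forall e u v u' v', joins e u v -> joins e u' v' ->
    (u' = u /\ v' = v) \/ (u' = v /\ v' = u) ;
  joins_vset : forall e u v, joins e u v -> vset u }.

Section GraphTheory.
Variables V E : Type.
Implicit Types G H K : graph V E.

Definition eset G : set E := [set e | exists u v, joins G e u v].

Definition incident G (e : E) (v : V) : Prop := exists u, joins G e v u.

Definition adjacent G (u v : V) : Prop := exists e, joins G e u v.

(* Only meaningful on finite sets. *)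
Definition ncard T (A : set T) : nat := xget 0 [set n | A #= `I_n].

(* [None] stands for the infinite degree; loops are counted twice. *)
Definition degree G (v : V) : option nat :=
  if `[< finite_set [set e | incident G e v] >] then
    Some (ncard [set e | incident G e v] + ncard [set e | joins G e v v])
  else None.

Definition odd_degree G v : Prop := exists2 n, degree G v = Some n & odd n.
Definition even_degree G v : Prop := exists2 n, degree G v = Some n & ~~ odd n.
Definition infinite_degree G v : Prop := degree G v = None.

Definition subgraph H G : Prop :=
  vset H `<=` vset G /\ (forall e u v, joins H e u v -> joins G e u v).

Lemma edge_induced_sym G (F : set E) e u v :
  F e /\ joins G e u v -> F e /\ joins G e v u.
Proof. by case=> Fe h; split=> //; apply: joins_sym h. Qed.

Lemma edge_induced_pair G (F : set E) e u v u' v' :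
  F e /\ joins G e u v -> F e /\ joins G e u' v' ->
  (u' = u /\ v' = v) \/ (u' = v /\ v' = u).
Proof. by move=> [_ h] [_]; apply: joins_pair h. Qed.

Lemma edge_induced_vset G (F : set E) e u v :
  F e /\ joins G e u v -> exists2 e', F e' & incident G e' u.
Proof. by case=> Fe h; exists e => //; exists v. Qed.

(* The graph written G[F]. *)
Definition edge_induced G (F : set E) : graph V E :=
  Graph (@edge_induced_sym G F) (@edge_induced_pair G F)
        (@edge_induced_vset G F).

(* The graph written G - F. *)
Definition remove_edges G (F : set E) : graph V E :=
  edge_induced G (eset G `\` F).

End GraphTheory.

Definition homomorphism V E V' E' (G : graph V E) (H : graph V' E')
    (fV : V -> V') (fE : E -> E') : Prop :=
  (forall v, vset G v -> vset H (fV v)) /\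
  (forall e u v, joins G e u v -> joins H (fE e) (fV u) (fV v)).

Section Line.
Variable I : set int.
Local Open Scope ring_scope.

Definition line_joins (c u v : int) : Prop :=
  (I c /\ I (c + 1)) /\ ((u = c /\ v = c + 1) \/ (u = c + 1 /\ v = c)).

Lemma line_joins_sym c u v : line_joins c u v -> line_joins c v u.
Proof. by case=> Ic [[-> ->]|[-> ->]]; split => //; [right|left]. Qed.

Lemma line_joins_pair c u v u' v' : line_joins c u v -> line_joins c u' v' ->
  (u' = u /\ v' = v) \/ (u' = v /\ v' = u).
Proof.
by case=> _ [[-> ->]|[-> ->]] [_ [[-> ->]|[-> ->]]]; by [left|right].
Qed.

Lemma line_joins_vset c u v : line_joins c u v -> I u.
Proof. by case=> -[Ic Ic1] [[-> _]|[-> _]]. Qed.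

(* For an interval [I] of integers: the edge [{c, c + 1}] is named [c]. *)
Definition line : graph int int :=
  Graph line_joins_sym line_joins_pair line_joins_vset.

End Line.

Definition int_interval (a b : int) : set int := [set c | (a <= c <= b)%R].
Definition naturals : set int := [set c | (0 <= c)%R].
Definition integers : set int := setT.

(* The vertex and edge maps of a path; their values outside of the domain
   [line I] of the path are irrelevant.  (Total maps exist as soon as [E] is
   inhabited, in particular for subgraphs of a graph that has an edge.) *)
Record pathmap (V E : Type) := Pathmap { pv : int -> V ; pe : int -> E }.

Section Paths.
Variables V E : Type.
Implicit Types (G : graph V E) (s t : pathmap V E) (I : set int).

Definition is_path G I t : Prop :=
  homomorphism (line I) G (pv t) (pe t) /\
  (forall c d, eset (line I) c -> eset (line I) d -> pe t c = pe t d -> c = d).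

Definition finite_path G (a b : int) t : Prop :=
  (a <= b)%R /\ is_path G (int_interval a b) t.

Definition eulerian G I s : Prop :=
  is_path G I s /\
  (forall e, eset G e -> exists! c, eset (line I) c /\ pe s c = e).

(* The path [s] on [line J] restricts to the path [t] on [line I]. *)
Definition extends J s I t : Prop :=
  [/\ I `<=` J,
      forall c, vset (line I) c -> pv s c = pv t c &
      forall c, eset (line I) c -> pe s c = pe t c].

Definition extendable_one_way G (a b : int) t : Prop :=
  exists s, eulerian G naturals s /\ extends naturals s (int_interval a b) t.

Definition extendable_two_way G (a b : int) t : Prop :=
  exists s, eulerian G integers s /\ extends integers s (int_interval a b) t.

Definition connected G : Prop :=
  forall u v, vset G u -> vset G v ->
    exists a b t, [/\ finite_path G a b t, pv t a = u & pv t b = v].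

Definition connected_component (H G : graph V E) : Prop :=
  [/\ subgraph H G, connected H &
      forall K, subgraph K G -> connected K -> subgraph H K -> K = H].

Definition infinite_components G : set (graph V E) :=
  [set H | connected_component H G /\ infinite_set (eset H)].

(* The supremum defining the number of ends is the natural number [k]. *)
Definition number_of_ends G (k : nat) : Prop :=
  let bound m := forall F : set E, F `<=` eset G -> finite_set F ->
    infinite_components (remove_edges G F) #<= `I_m in
  bound k /\ forall m, bound m -> (k <= m)%N.

Definition condition_E1 G : Prop :=
  [/\ countable (eset G) /\ infinite_set (eset G),
      connected G,
      (exists! v, vset G v /\ odd_degree G v) \/
      ((exists2 v, vset G v & infinite_degree G v) /\
       (forall v, vset G v -> ~ odd_degree G v)) &
      number_of_ends G 1].

Definition condition_E2 G : Prop :=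
  [/\ countable (eset G) /\ infinite_set (eset G),
      connected G,
      forall v, vset G v -> infinite_degree G v \/ even_degree G v,
      number_of_ends G 1 \/ number_of_ends G 2 &
      forall F : set E, F `<=` eset G -> finite_set F ->
        (forall v, vset (edge_induced G F) v ->
           even_degree (edge_induced G F) v) ->
        infinite_components (remove_edges G F) #= `I_1].

Variables (iV : V -> nat) (iE : E -> nat).

Definition computable_graph G : Prop :=
  [/\ {in vset G &, injective iV} /\ {in eset G &, injective iE},
      decidable_rel [set x : 1.-tuple nat |
        exists2 v, vset G v & x = [tuple iV v]],
      decidable_rel [set x : 1.-tuple nat |
        exists2 e, eset G e & x = [tuple iE e]],
      decidable_rel [set x : 2.-tuple nat |
        exists u v, adjacent G u v /\ x = [tuple iV u; iV v]] &
      decidable_rel [set x : 3.-tuple nat |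
        exists e u v, joins G e u v /\ x = [tuple iE e; iV u; iV v]]].

Definition code_degree (d : option nat) : nat := if d is Some n then n.+1 else 0.

Definition moderately_computable_graph G : Prop :=
  computable_graph G /\
  (exists p : recfun 1, forall v, vset G v ->
     eval p [tuple iV v] (code_degree (degree G v))).

Definition code_int (z : int) : nat :=
  match z with Posz n => n.*2 | Negz n => n.*2.+1 end.

(* The ends of the domain, the indices of the [b - a + 1] vertices and the
   indices of the [b - a] edges of the path [t] on [line (int_interval a b)]. *)
Definition code_path (a b : int) t : nat :=
  CodeSeq.code [:: code_int a; code_int b;
    CodeSeq.code [seq iV (pv t (a + i%:Z)%R) | i <- iota 0 `|(b - a)%R|%N.+1];
    CodeSeq.code [seq iE (pe t (a + i%:Z)%R) | i <- iota 0 `|(b - a)%R|%N]].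

End Paths.

(* Main.v *)
Require Import Defs.
From mathcomp Require Import all_boot all_order all_algebra.
From mathcomp Require Import mathcomp_extra boolp classical_sets functions cardinality.
From mathcomp Require Import zify.

(** Write [G - U] for the graph left after removing the edges [U] of the given
    finite path [t], which goes from [u] to [w].  Extendability turns out to be
    a local condition at the ends of [t] together with a global one, that
    [G - U] has no nonempty finite set of edges closed under adjacency
    ([no_finite_part]).

    - In the one-way case ([one_way_criterion]) the local condition is that
      [u] has odd or infinite degree in [G] and every other vertex has even or
      infinite degree.
    - In the two-way case ([two_way_criterion]) it is that both [u] and [w]
      still meet an edge of [G - U].

    Necessity is easy: an infinite trail that enters a finite closed set never
    leaves it.  For sufficiency the path is extended step by step so that
    [no_finite_part] is preserved.  A trail [P] that reaches the desired edge
    may cut off finitely many finite pieces; a parity count shows that these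
    pieces have even degrees, so that [P] and the pieces together can be
    traversed by one trail with the ends of [P] ([absorb_and_traverse], which
    rests on Euler's theorem for finite graphs, [euler_finite]).  The end
    conditions ensure that every edge can be reached: with one end, [G - U] is
    connected.  On the two-way side there are two regimes.  Either the two ends
    of the path lie in different components of [G - U], and the two sides grow
    independently; or the path can be closed up into a circuit, the remaining
    graph is then connected by the last clause of [condition_E2], and the
    circuit is opened again at a vertex that still has unused edges
    ([extend_left_core]).

    It remains to decide [no_finite_part].  A finite closed set is a finite
    certificate of its failure; that the set is closed is checked by comparing
    degrees ([refutes]).  There is also a finite certificate that it holds
    ([confirms]).  Fix a finite [S], depending on [G] only, such that [G - S]
    has [k] infinite components, [k] being the number of ends.  For a finite
    [K] containing [S], if [G - K] has at most [k] components then all of them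
    are infinite, and having at most [k] components is witnessed by finitely many
    adjacent edges.  Adding edges to [U] one at a time, each with an end that
    still meets an unused edge, leads from [U] to such a [K] exactly when
    [no_finite_part] holds for [U] ([chain_sound], [chain_exists]).  Searching
    for a certificate of either kind terminates, hence decides.

    The combinatorics is carried out for graphs given by two end maps
    [s], [d : E -> V].  The graph [G] is transported to natural numbers, where
    the end maps and the degree are total recursive functions. *)

Set Implicit Arguments.
Unset Strict Implicit.
Unset Printing Implicit Defensive.

Import Order.TTheory GRing.Theory Num.Theory.

(** * Sequences built step by step *)

Lemma dependent_choice_seq (S : Type) (Inv : S -> Prop) (R : nat -> S -> S -> Prop) s0 :
  Inv s0 -> (forall n s, Inv s -> exists s', Inv s' /\ R n s s') ->
  exists f : nat -> S, f 0 = s0 /\ forall n, Inv (f n) /\ R n (f n) (f n.+1).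
Proof.
move=> i0 step.
have [g hg] : {g : nat * {s | Inv s} -> S &
    forall a, Inv (g a) /\ R a.1 (sval a.2) (g a)}.
  apply: (@choice _ _ (fun (a : nat * {s | Inv s}) s' => Inv s' /\ R a.1 (sval a.2) s')).
  by case=> n [s i]; exact: step.
pose f := fix f n : {s | Inv s} :=
  if n is m.+1 then exist _ (g (m, f m)) (hg (m, f m)).1 else exist _ s0 i0.
by exists (fun n => sval (f n)); split => // n; split;
  [exact: svalP (f n)|exact: (hg (n, f n)).2].
Qed.

Lemma limit_seq (T : eqType) (f : nat -> seq T) :
  (forall n, exists2 m, m != [::] & f n.+1 = f n ++ m) ->
  exists r, forall n, mkseq r (size (f n)) = f n /\ n <= size (f n).
Proof.
move=> hf.
have szf n : n <= size (f n).
  elim: n => // n IH; have [m m0 ->] := hf n; rewrite size_cat.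
  by move: m0 IH; rewrite -size_eq0; lia.
have [x0 _] : exists x0 : T, True.
  by have [[//|x m] _ _] := hf 0; exists x.
have pre n k : exists m, f (k + n) = f n ++ m.
  elim: k => [|k [m e]]; first by exists [::]; rewrite cats0.
  by have [m' _] := hf (k + n); rewrite e => e'; exists (m ++ m'); rewrite catA.
have prefix_nth n k i : i < size (f n) -> n <= k -> nth x0 (f k) i = nth x0 (f n) i.
  move=> lt /subnK<-; have [m ->] := pre n (k - n); by rewrite nth_cat lt.
exists (fun i => nth x0 (f i.+1) i) => n; split => //.
apply: (@eq_from_nth _ x0); rewrite size_mkseq // => i lt; rewrite nth_mkseq //.
case: (leqP n i.+1) => h; first by rewrite (prefix_nth n).
by rewrite (prefix_nth i.+1 n) // ltnW.
Qed.

(** * Multigraphs given by their end maps *)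

Section Multigraph.
Variables (V E : eqType) (Ed : pred E) (s d : E -> V).
Implicit Types (U P B F l q : seq E) (e f g : E) (u v w x y : V)
  (vs : seq V).

Definition inc e v := (s e == v) || (d e == v).
(** A loop has both of its ends at the same vertex and counts twice. *)
Definition mult e v : nat := (s e == v) + (d e == v).
Definition touch e f := inc f (s e) || inc f (d e).
Definition deg_in l v : nat := \sum_(e <- l) mult e v.
Definition outside U e := Ed e && (e \notin U).
Definition unsaturated U v : Prop := exists2 e, outside U e & inc e v.
(** A union of components of [G - U], seen as a set of edges; [A] is only used
    with edges outside [U]. *)
Definition closed U (A : E -> Prop) : Prop :=
  forall e f, A e -> outside U f -> touch e f -> A f.
(** The global condition of the criteria: every component of [G - U] that has
    an edge is infinite.  Stating it with finite closed sets rather than with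
    components makes its failure visible in finitely many edges. *)
Definition no_finite_part U : Prop :=
  forall F, F != [::] -> all (outside U) F -> ~ closed U (fun e => e \in F).

(** Connectivity is a relation between edges, so that vertices left without
    edges never matter.  When [e] is outside [U], so is every [f] with
    [conn U e f]. *)
Inductive conn U e : E -> Prop :=
| conn_refl : conn U e e
| conn_step f g : conn U e f -> outside U g -> touch f g -> conn U e g.

Lemma touchP e f : reflect (exists v, inc e v && inc f v) (touch e f).
Proof.
apply: (iffP orP) => [[h|h]|[v /andP[/orP[]/eqP <- h]]]; last by right.
- by exists (s e); rewrite h /inc eqxx.
- by exists (d e); rewrite h /inc eqxx orbT.
- by left.
Qed.

Lemma touchC e f : touch e f = touch f e.
Proof.
by apply/touchP/touchP => -[v]; rewrite andbC => h; exists v.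
Qed.

Lemma touch_inc e f v : inc e v -> inc f v -> touch e f.
Proof. by move=> h1 h2; apply/touchP; exists v; rewrite h1. Qed.

Lemma mult_eq0 e v : ~~ inc e v -> mult e v = 0.
Proof. by rewrite /mult /inc; case: eqP; case: eqP. Qed.

Lemma mult_gt0 e v : (0 < mult e v) = inc e v.
Proof. by rewrite /mult /inc; case: eqP; case: eqP. Qed.

Lemma deg_in_cat l1 l2 v : deg_in (l1 ++ l2) v = deg_in l1 v + deg_in l2 v.
Proof. by rewrite /deg_in big_cat. Qed.

Lemma deg_in_cons e l v : deg_in (e :: l) v = mult e v + deg_in l v.
Proof. by rewrite /deg_in big_cons. Qed.

Lemma deg_in_perm l1 l2 v : perm_eq l1 l2 -> deg_in l1 v = deg_in l2 v.
Proof. by move=> h; rewrite /deg_in (perm_big _ h). Qed.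

Lemma deg_in_filter l v : deg_in [seq e <- l | inc e v] v = deg_in l v.
Proof.
elim: l => //= e l IH; case: ifP => h; rewrite !deg_in_cons IH //.
by rewrite mult_eq0 // h.
Qed.

Lemma deg_in_gt0 l v : 0 < deg_in l v -> exists2 e, e \in l & inc e v.
Proof.
elim: l => [|e l IH]; first by rewrite /deg_in big_nil.
rewrite deg_in_cons addn_gt0 mult_gt0; case/orP=> [h|/IH[f fl h]].
  by exists e => //; rewrite inE eqxx.
by exists f => //; rewrite inE fl orbT.
Qed.

Lemma deg_in_eq0 l v : (forall e, e \in l -> ~~ inc e v) -> deg_in l v = 0.
Proof.
move=> h; apply/eqP; rewrite -leqn0 leqNgt; apply/negP => /deg_in_gt0[e /h /negP] //.
Qed.

Lemma outside_cat U P e : outside (U ++ P) e = outside U e && (e \notin P).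
Proof. by rewrite /outside mem_cat negb_or andbA. Qed.

Lemma outside_catl U P e : outside (U ++ P) e -> outside U e.
Proof. by rewrite outside_cat => /andP[]. Qed.

Lemma eq_outside U U' : U =i U' -> outside U =1 outside U'.
Proof. by move=> h e; rewrite /outside h. Qed.

Lemma eq_closed U U' A : U =i U' -> closed U A -> closed U' A.
Proof. by move=> h c e f Ae o; apply: c => //; rewrite (eq_outside h). Qed.

Lemma eq_no_finite_part U U' : U =i U' -> no_finite_part U -> no_finite_part U'.
Proof.
move=> h n F F0 /allP o c; apply: (n F F0).
  by apply/allP => e /o; rewrite (eq_outside h).
by apply: eq_closed c => e; rewrite h.
Qed.

Lemma conn_trans U e f g : conn U e f -> conn U f g -> conn U e g.
Proof. by move=> ef; elim=> // a b _ ea ob ab; apply: conn_step ab. Qed.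

Lemma conn_outside U e f : outside U e -> conn U e f -> outside U f.
Proof. by move=> oe; elim. Qed.

Lemma conn_sym U e f : outside U e -> conn U e f -> conn U f e.
Proof.
move=> oe; elim=> [|a b ea aE ob ab]; first exact: conn_refl.
apply: conn_trans aE; apply: conn_step (conn_refl _ _) _ _.
  exact: conn_outside ea.
by rewrite touchC.
Qed.

Lemma closed_conn U A e f : closed U A -> A e -> conn U e f -> A f.
Proof. by move=> c Ae; elim=> // a b _ Aa ob ab; apply: c ab. Qed.

(** * Walks *)

(** The far end of [e] as seen from its end [v]; for a loop it is [v]. *)
Definition other e v := if s e == v then d e else s e.

(** A walk is its list of edges together with its starting vertex; the other
    vertices are recovered by crossing the edges in turn. *)
Fixpoint walk u l : bool :=
  if l is e :: l' then inc e u && walk (other e u) l' else true.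
Fixpoint walk_end u l : V := if l is e :: l' then walk_end (other e u) l' else u.

Lemma inc_other e v : inc e v -> inc e (other e v).
Proof.
by rewrite /inc /other; case: (s e =P v) => [_|_] _; rewrite eqxx ?orbT.
Qed.

Lemma otherK e v : inc e v -> other e (other e v) = v.
Proof.
rewrite /inc /other; case: (s e =P v) => [<-|n] /=; first by case: eqP.
by move=> /eqP->; rewrite eqxx.
Qed.

Lemma inc_cases e v x : inc e v -> inc e x -> x = v \/ x = other e v.
Proof.
rewrite /inc /other; case: (s e =P v) => [->|n] /=.
  by move=> _ /orP[/eqP->|/eqP->]; [left|right].
by move=> /eqP-> /orP[/eqP->|/eqP->]; [right|left].
Qed.

Lemma walk_cat u l1 l2 : walk u (l1 ++ l2) = walk u l1 && walk (walk_end u l1) l2.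
Proof. by elim: l1 u => //= e l1 IH u; rewrite IH andbA. Qed.

Lemma walk_end_cat u l1 l2 : walk_end u (l1 ++ l2) = walk_end (walk_end u l1) l2.
Proof. by elim: l1 u => //=. Qed.

Lemma walk_rev u l : walk u l ->
  walk (walk_end u l) (rev l) /\ walk_end (walk_end u l) (rev l) = u.
Proof.
elim: l u => //= e l IH u /andP[eu /IH[h1 h2]].
rewrite rev_cons -cats1 walk_cat walk_end_cat h1 h2 /= inc_other //.
by rewrite otherK.
Qed.

Lemma odd_mult e u v : inc e u ->
  odd (mult e v) = (u == v) (+) (other e u == v).
Proof.
rewrite /inc /mult /other oddD !oddb; case: (s e =P u) => [->|n] //=.
by move=> /eqP->; rewrite addbC.
Qed.

(** Every visit to an inner vertex uses two edge ends, so only the two ends of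
    the walk can have odd degree, and they cancel when they coincide. *)
Lemma odd_deg_in_walk u l v : walk u l ->
  odd (deg_in l v) = (u == v) (+) (walk_end u l == v).
Proof.
elim: l u => [|e l IH] u /=; first by rewrite /deg_in big_nil addbb.
case/andP=> eu /IH h; rewrite deg_in_cons oddD h (odd_mult _ eu).
by rewrite -addbA [X in _ (+) X]addbA addbb.
Qed.

Lemma walk_visits u l e v : walk u l -> e \in l -> inc e v ->
  exists l1 l2, l = l1 ++ l2 /\ walk_end u l1 = v.
Proof.
move=> wl el ev; case/splitPr: el wl => l1 l2.
rewrite walk_cat /= => /and3P[_ h _].
have [->|->] := inc_cases h ev.
  by exists l1, (e :: l2).
by exists (l1 ++ [:: e]), l2; rewrite -catA walk_end_cat.
Qed.

(** The degrees sum to twice the number of edges, so a single vertex cannot be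
    the only one of odd degree. *)
Lemma handshake B x :
  (forall v, v != x -> ~~ odd (deg_in B v)) -> ~~ odd (deg_in B x).
Proof.
move=> h; pose vs := undup (x :: [seq s e | e <- B] ++ [seq d e | e <- B]).
have tot : \sum_(v <- vs) deg_in B v = (size B).*2.
  rewrite /deg_in exchange_big /= -addnn -sum1_size -big_split /= big_seq [RHS]big_seq.
  apply: eq_bigr => e eB; rewrite /mult big_split /=.
  have one y : y \in vs -> \sum_(v <- vs) (y == v : nat) = 1.
    move=> yv; rewrite (bigD1_seq y) ?undup_uniq //= eqxx big1 ?addn0 // => i.
    by rewrite eq_sym => /negbTE->.
  by rewrite !one // mem_undup inE mem_cat map_f ?orbT.
have : odd (\sum_(v <- vs) deg_in B v) = odd (deg_in B x).
  rewrite (bigD1_seq x) ?undup_uniq ?mem_undup ?mem_head //= oddD.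
  rewrite [X in _ (+) X](_ : _ = false) ?addbF //.
  apply: (big_ind (fun n => odd n = false)) => // [a b|i /h /negbTE //].
  by rewrite oddD => -> ->.
by rewrite tot odd_double => <-.
Qed.

(** * Eulerian trails in finite graphs *)

(** Walk greedily until the current vertex has no unused edge of [B]. *)
Lemma maximal_trail B u : exists l R,
  [/\ perm_eq B (l ++ R), walk u l,
      forall e, e \in R -> ~~ inc e (walk_end u l) &
      has (fun e => inc e u) B -> l != [::]].
Proof.
elim: {B}_.+1 {-2}B u (ltnSn (size B)) => // n IH B u szB.
case: (boolP (has (fun e => inc e u) B)) => [/hasP[e eB eu]|nB]; last first.
  exists [::], B; split => // e eB; apply: contra nB => h.
  by apply/hasP; exists e.
have pB := perm_to_rem eB.
have [|l [R [pR wl hR _]]] := IH (rem e B) (other e u).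
  by rewrite size_rem //; case: (B) szB eB.
exists (e :: l), R; split => //=; last by rewrite eu.
by apply: perm_trans pB _; rewrite perm_cons.
Qed.

(** Connectivity of the finite edge set [B], seen from [u], in the form in which
    it is used: a component of [B] that avoids [u] is empty. *)
Definition spanned_from B u : Prop :=
  forall F, F != [::] -> {subset F <= B} ->
    (forall e f, e \in F -> f \in B -> touch e f -> f \in F) ->
    exists2 e, e \in F & inc e u.

(** As long as edges [R] are left, connectivity provides one that meets the trail
    at some vertex; a greedy trail from there comes back to this vertex because
    the degrees in [R] are even, and it is inserted as a detour. *)
Lemma hierholzer B u l R : spanned_from B u -> perm_eq B (l ++ R) -> walk u l ->
  (forall v, ~~ odd (deg_in R v)) ->
  exists l', [/\ perm_eq B l', walk u l' & walk_end u l' = walk_end u l].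
Proof.
move=> sB; elim: {R}_.+1 {-2}R l (ltnSn (size R)) => // n IH R l szR pB wl ev.
have memB e : (e \in B) = (e \in l) || (e \in R).
  by rewrite (perm_mem pB) mem_cat.
have [R0|R0] := eqVneq R [::].
  by exists l; split => //; rewrite R0 cats0 in pB.
have [e eR [l1 [l2 [def_l ey]]]] : exists2 e, e \in R &
    exists l1 l2, l = l1 ++ l2 /\ inc e (walk_end u l1).
  apply: contrapT => no.
  have [|e f eR|e eR eu] := sB R R0; last by apply: no; exists e => //; exists [::], l.
    by move=> e eR; rewrite memB eR orbT.
  rewrite memB => /orP[fl|//] /touchP[v /andP[ev' fv]].
  have [l1 [l2 [dl e1]]] := walk_visits wl fl fv.
  by case: no; exists e => //; exists l1, l2; rewrite e1.
have [m [R' [pR wm hR' m0]]] := maximal_trail R (walk_end u l1).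
have evm v : odd (deg_in m v) = odd (deg_in R' v).
  by have := ev v; rewrite (deg_in_perm v pR) deg_in_cat oddD -[RHS]addbF => /negbTE<-;
     rewrite [X in _ = _ (+) X]addbC addbA addbb.
have closed_m : walk_end (walk_end u l1) m = walk_end u l1.
  have := odd_deg_in_walk (walk_end (walk_end u l1) m) wm.
  rewrite evm (deg_in_eq0 hR') eqxx addbT /=.
  by move/esym/negbFE/eqP.
have [] := IH R' (l1 ++ m ++ l2).
- have : size R = size m + size R' by rewrite (perm_size pR) size_cat.
  have : 0 < size m by rewrite lt0n size_eq0 m0 //; apply/hasP; exists e.
  by move: szR; lia.
- apply: perm_trans pB _; rewrite def_l -!catA perm_cat2l.
  apply: perm_trans (_ : perm_eq (l2 ++ m ++ R') _).
    by rewrite perm_cat2l.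
  by rewrite perm_catCA.
- by move: wl; rewrite def_l !walk_cat closed_m wm.
- move=> v; rewrite -evm.
  by rewrite (odd_deg_in_walk v wm) closed_m addbb.
move=> l' [p' w' e']; exists l'; split => //.
by rewrite e' def_l !walk_end_cat closed_m.
Qed.

(** A greedy trail from [u] can only get stuck at [x], by parity, and what it
    leaves has even degrees, so that Hierholzer's construction applies. *)
Theorem euler_finite B u x : spanned_from B u ->
  (forall v, odd (deg_in B v) = (u == v) (+) (x == v)) ->
  exists l, [/\ perm_eq B l, walk u l & walk_end u l = x].
Proof.
move=> sB odB; have [l [R [pB wl hR _]]] := maximal_trail B u.
have oR v : odd (deg_in R v) = (x == v) (+) (walk_end u l == v).
  have := odB v; rewrite (deg_in_perm v pB) deg_in_cat oddD (odd_deg_in_walk v wl) -addbA.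
  by move/addbI => h; rewrite -h addbC addbA addbb.
have ex : walk_end u l = x.
  have := oR (walk_end u l); rewrite (deg_in_eq0 hR) eqxx addbT /=.
  by move/esym/negbFE/eqP.
have [|l' [? ? e']] := hierholzer sB pB wl; last by exists l'; rewrite e'.
by move=> v; rewrite oR ex addbb.
Qed.

(** * Trails avoiding a finite set of edges *)

Definition trail U u l := [&& uniq l, all (outside U) l & walk u l].
Definition linked U u v : Prop := exists2 l, trail U u l & walk_end u l = v.

Lemma trail_cat U u l1 l2 : trail U u (l1 ++ l2) =
  trail U u l1 && trail (U ++ l1) (walk_end u l1) l2.
Proof.
rewrite /trail cat_uniq all_cat walk_cat.
have -> : all (outside (U ++ l1)) l2 = all (outside U) l2 && ~~ has (mem l1) l2.
  elim: l2 => //= e l2 ->; rewrite negb_or outside_cat.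
  by rewrite andbACA.
by case: (uniq l1); case: (has _ _); case: (uniq l2); case: (all _ l1);
  case: (all _ l2); case: (walk _ l1); case: (walk _ l2).
Qed.

Lemma linked_refl U u : linked U u u.
Proof. by exists [::]. Qed.

(** If the new edge is already used by the trail, the trail is cut at that edge,
    before or after it according to the end that is wanted. *)
Lemma linked_step U u e v : linked U u v -> outside U e -> inc e v ->
  linked U u (other e v).
Proof.
move=> [l tl ev] oe ie; have [el|el] := boolP (e \in l); last first.
  exists (l ++ [:: e]); last by rewrite walk_end_cat ev.
  by rewrite trail_cat tl /= /trail /= ev ie outside_cat oe el.
case/splitPr: el tl => l1 l2.
rewrite -cat_rcons trail_cat => /andP[t1 _].
have t1' := t1; move: t1; rewrite -cats1 trail_cat => /andP[t1 /and3P[_ _ /andP[ie1 _]]].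
have : inc e (other e v) by exact: inc_other.
case/(inc_cases ie1) => ->; first by exists l1.
by exists (rcons l1 e) => //; rewrite -cats1 walk_end_cat.
Qed.

Lemma linked_inc U u e v x : linked U u v -> outside U e -> inc e v -> inc e x ->
  linked U u x.
Proof.
by move=> h oe ev /(inc_cases ev)[->//|->]; apply: linked_step.
Qed.

Lemma linked_sym U u v : linked U u v -> linked U v u.
Proof.
move=> [l /and3P[ul ol wl] <-]; have [h1 h2] := walk_rev wl.
by exists (rev l) => //; rewrite /trail rev_uniq ul all_rev ol.
Qed.

Lemma linked_sub U U' u v : {subset U <= U'} -> linked U' u v -> linked U u v.
Proof.
move=> sU [l /and3P[ul /allP ol wl] <-]; exists l => //; apply/and3P; split => //.
by apply/allP => e /ol/andP[Ee eU]; rewrite /outside Ee; apply: contra eU; apply: sU.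
Qed.

Lemma linked_conn U u e f x : inc e u -> outside U e -> conn U e f ->
  inc f x -> linked U u x.
Proof.
move=> eu oe ef; elim: ef x => [|a b ea IH ob /touchP[y /andP[ay by_]]] x fx.
  by apply: linked_inc (linked_refl _ _) oe eu fx.
exact: linked_inc (IH _ ay) ob by_ fx.
Qed.

Lemma linked_conn_edges U u e f v : linked U u v -> outside U e -> inc e u ->
  outside U f -> inc f v -> conn U e f.
Proof.
move=> [l]; elim: l u e => [|g l IH] u e /=.
  move=> _ <- oe eu of_ fv; apply: conn_step (conn_refl _ _) of_ _.
  exact: touch_inc eu fv.
case/and3P => /= /andP[_ ul] /andP[og ol] /andP[gu wl] ev oe eu of_ fv.
apply: (conn_trans (f := g)).
  by apply: conn_step (conn_refl _ _) og _; apply: touch_inc eu gu.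
apply: (IH (other g u)) => //; first by rewrite /trail ul ol.
exact: inc_other.
Qed.

Lemma trail_through U u f e : inc f u -> outside U f -> conn U f e -> outside U e ->
  exists2 l, trail U u l & e \in l.
Proof.
move=> fu of_ fe oe.
have se : inc e (s e) by rewrite /inc eqxx.
have [l tl el] := linked_conn fu of_ fe se.
have [h|h] := boolP (e \in l); first by exists l.
exists (l ++ [:: e]); last by rewrite mem_cat mem_head orbT.
by rewrite trail_cat tl /trail /= el outside_cat oe h se.
Qed.

(** One finite closed set is collected for every vertex of [vs] that meets one;
    any other finite closed set through this vertex shares an edge with it. *)
Lemma absorb_at U vs : exists B, [/\ uniq B, all (outside U) B,
    closed U (fun e => e \in B) &
    forall F, all (outside U) F -> closed U (fun e => e \in F) ->
    forall v e, v \in vs -> e \in F -> inc e v -> e \in B].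
Proof.
elim: vs => [|v vs [B [uB oB cB hB]]].
  by exists [::]; split => // [e f|F _ _ v e]; rewrite in_nil.
have [[F [oF cF [e0 e0F e0v]]]|no] :=
  pselect (exists F, [/\ all (outside U) F, closed U (fun e => e \in F) &
                      exists2 e, e \in F & inc e v]); last first.
  exists B; split => // F oF cF x e; rewrite inE => /orP[/eqP->|xs] eF ex.
    by case: no; exists F; split => //; exists e.
  exact: (hB F oF cF x).
exists (undup (B ++ F)); split.
- exact: undup_uniq.
- by apply/allP => e; rewrite mem_undup mem_cat => /orP[]; apply/allP.
- move=> e f; rewrite !mem_undup !mem_cat => /orP[h|h] of_ ef.
    by rewrite (cB e f).
  by rewrite (cF e f) // orbT.
- move=> F' oF' cF' x e; rewrite inE mem_undup mem_cat => /orP[/eqP->|xs] eF ex.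
    rewrite (cF e0 e) ?orbT //; first exact: (allP oF').
    exact: touch_inc e0v ex.
  by rewrite (hB F' _ _ x).
Qed.

(** Removing [P] from [G - U] cuts off only finitely many finite pieces, since
    each of them must meet an end of an edge of [P], as [G - U] has no finite
    piece itself; once they are removed too, no finite piece is left. *)
Lemma absorb U P : no_finite_part U -> exists B,
  [/\ uniq B, all (outside (U ++ P)) B, closed (U ++ P) (fun e => e \in B) &
      no_finite_part (U ++ P ++ B)].
Proof.
move=> nU; have [B [uB oB cB hB]] :=
  absorb_at (U ++ P) ([seq s e | e <- P] ++ [seq d e | e <- P]).
exists B; split => // F F0 /allP oF cF.
have oF' e : e \in F -> [/\ outside U e, outside (U ++ P) e & e \notin B].
  by move=> /oF; rewrite catA outside_cat => /andP[h ->]; rewrite h (outside_catl h).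
apply: (nU F F0); first by apply/allP => e /oF'[].
move=> e f eF of_ ef; have [oe oe' eB] := oF' e eF.
have [fP|fP] := boolP (f \in P); last first.
  have of' : outside (U ++ P) f by rewrite outside_cat of_.
  have [fB|fB] := boolP (f \in B).
    by case/negP: eB; apply: (cB f) => //; rewrite touchC.
  by apply: (cF e) => //; rewrite catA outside_cat of'.
(* [F] touches an end of [P], hence [F ++ B] is a finite closed set that
   has already been collected at that end *)
have cFB : closed (U ++ P) (fun e => e \in F ++ B).
  move=> a b; rewrite !mem_cat => /orP[h|h] ob ab; last by rewrite (cB a b) ?orbT.
  have [|bB] := boolP (b \in B); first by rewrite orbT.
  by rewrite (cF a b) // catA outside_cat ob.
have oFB : all (outside (U ++ P)) (F ++ B).
  by rewrite all_cat oB andbT; apply/allP => a /oF'[].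
have [v /andP[ev fv]] := touchP _ _ ef.
case/negP: eB; apply: (hB _ oFB cFB v) => //; last by rewrite mem_cat eF.
by move: fv; rewrite mem_cat /inc => /orP[]/eqP<-; rewrite map_f ?orbT.
Qed.

(** * Parity of the remaining degrees *)

(** The degree of [v] in [G - U], if finite, has the parity [b].  The list [l] is
    an enumeration of the edges at [v], so that no degree function is needed;
    at a vertex of infinite degree the condition is void. *)
Definition residual_parity U v b : Prop :=
  forall l, uniq l -> (forall e, (e \in l) = outside U e && inc e v) ->
  odd (deg_in l v) = b.

Lemma residual_parity_cat U P v b : uniq P -> all (outside U) P ->
  residual_parity U v b ->
  residual_parity (U ++ P) v (b (+) odd (deg_in P v)).
Proof.
move=> uP /allP oP h l ul hl.
rewrite -(h (l ++ [seq e <- P | inc e v])).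
- by rewrite deg_in_cat deg_in_filter oddD -addbA addbb addbF.
- rewrite cat_uniq ul filter_uniq // andbT /=.
  apply/hasPn => e; rewrite mem_filter => /andP[_ eP] /=.
  by rewrite hl outside_cat eP andbF.
- move=> e; rewrite mem_cat hl mem_filter outside_cat.
  have [eP|eP] := boolP (e \in P); last by rewrite andbF orbF andbT.
  by rewrite (oP e eP) !andbF andbT.
Qed.

(** A remaining degree that is odd or infinite is not zero. *)
Lemma odd_unsaturated U v : residual_parity U v true -> unsaturated U v.
Proof.
move=> h; apply: contrapT => no.
suff : odd (deg_in [::] v) = true by rewrite /deg_in big_nil.
apply: h => // e; rewrite in_nil; apply/esym/negbTE/negP => /andP[oe ev].
by apply: no; exists e.
Qed.

(** A finite closed set contains all remaining edges at each vertex it meets. *)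
Lemma residual_parity_closed U v b C : uniq C -> all (outside U) C ->
  closed U (fun e => e \in C) -> residual_parity U v b ->
  odd (deg_in C v) -> b.
Proof.
move=> uC /allP oC cC h oddC; have [|f fC fv] := @deg_in_gt0 C v.
  by case: (deg_in C v) oddC.
rewrite -(h [seq e <- C | inc e v]) ?filter_uniq ?deg_in_filter // => e.
rewrite mem_filter andbC; have [ev|ev] := boolP (inc e v); rewrite ?andbF // !andbT.
by apply/idP/idP => [/oC//|oe]; apply: (cC f) => //; apply: touch_inc fv ev.
Qed.

(** Walking back from [e] to [u], all edges stay in [A]. *)
Lemma walk_reaches (A : E -> Prop) u l e :
  (forall f g, A f -> g \in l -> touch f g -> A g) ->
  walk u l -> e \in l -> A e -> exists2 f, A f & inc f u.
Proof.
elim: l u => [|a l IH] u cA //= /andP[au wl]; rewrite inE => /orP[/eqP->|el] Ae.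
  by exists a.
have [|f Af fo] := IH _ _ wl el Ae.
  by move=> f g Af gl; apply: cA => //; rewrite inE gl orbT.
exists a => //; apply: (cA f) => //; first exact: mem_head.
exact: touch_inc fo (inc_other au).
Qed.

(** The step on which all extensions rest.  The finite pieces that [P] cuts off
    are attached to [P], so if they have even degrees then [P] and the pieces
    form a connected finite graph with the degree parities of [P], to which
    Euler's theorem applies. *)
Lemma absorb_and_traverse U P u x : no_finite_part U -> trail U u P -> walk_end u P = x ->
  (forall C, uniq C -> all (outside (U ++ P)) C ->
     closed (U ++ P) (fun e => e \in C) -> forall v, ~~ odd (deg_in C v)) ->
  exists l, [/\ trail U u l, walk_end u l = x, {subset P <= l} & no_finite_part (U ++ l)].
Proof.
move=> nU /and3P[uP /allP oP wP] eP hC.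
have [B [uB oB cB nB]] := absorb P nU.
have odB v : odd (deg_in (P ++ B) v) = (u == v) (+) (x == v).
  by rewrite deg_in_cat oddD (odd_deg_in_walk v wP) eP (negbTE (hC B uB oB cB v)) addbF.
have oB' e : e \in B -> outside U e /\ e \notin P.
  by move=> /(allP oB); rewrite outside_cat => /andP[].
have sp : spanned_from (P ++ B) u.
  move=> F F0 sF cF; apply: contrapT => no.
  have noP e : e \in P -> e \notin F.
    move=> eP'; apply/negP => eF; apply: no.
    apply: walk_reaches wP eP' eF => f g fF gP; apply: cF => //.
    by rewrite mem_cat gP.
  have FB e : e \in F -> e \in B.
    move=> eF; have := sF e eF; rewrite mem_cat => /orP[/noP|//].
    by rewrite eF.
  apply: (nU F F0); first by apply/allP => e /FB/oB'[].
  move=> e f eF of_ ef; apply: (cF e) => //; rewrite mem_cat.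
  have [//|fP] := boolP (f \in P).
  by rewrite (cB e f) //; [exact: FB|rewrite outside_cat of_].
have [l [pl wl el]] := euler_finite sp odB.
have ml := perm_mem pl.
exists l; split => //.
- rewrite /trail wl andbT -(perm_uniq pl) cat_uniq uP uB andbT /=.
  apply/andP; split; first by apply/hasPn => e /oB'[].
  by apply/allP => e; rewrite -ml mem_cat => /orP[/oP|/oB'[]].
- by move=> e eP'; rewrite -ml mem_cat eP'.
- by apply: eq_no_finite_part nB => e; rewrite !mem_cat -ml mem_cat.
Qed.

(** * Ends and connectivity *)

Definition in_infinite_part U e : Prop := ~ exists l, forall f, conn U e f -> f \in l.
Fixpoint apart U q : Prop :=
  if q is e :: q' then (forall f, f \in q' -> ~ conn U e f) /\ apart U q' else True.
(** [G - U] has at most [k] infinite components, each being represented by one of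
    its edges. *)
Definition ends_at_most U k : Prop := forall q, all (outside U) q -> apart U q ->
  (forall e, e \in q -> in_infinite_part U e) -> size q <= k.

Lemma no_finite_part_infinite U e : no_finite_part U -> outside U e ->
  in_infinite_part U e.
Proof.
move=> nU oe [l hl]; pose F := [seq f <- l | `[< conn U e f >]].
have FE f : (f \in F) = `[< conn U e f >].
  by rewrite mem_filter; apply: andb_idr => /asboolP/hl.
apply: (nU F).
- have : e \in F by rewrite FE; apply/asboolP; apply: conn_refl.
  by case: (F).
- by apply/allP => f; rewrite FE => /asboolP; apply: conn_outside.
- by move=> f g; rewrite !FE => /asboolP h og fg; apply/asboolP; apply: conn_step fg.
Qed.

Lemma one_end_conn U e f : no_finite_part U -> ends_at_most U 1 -> outside U e ->
  outside U f ->
  conn U e f.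
Proof.
move=> nU h oe of_; apply: contrapT => n.
suff: size [:: e; f] <= 1 by [].
apply: h => /=; first by rewrite oe of_.
  by split => // g; rewrite inE => /eqP->.
by move=> g; rewrite !inE => /orP[]/eqP->; apply: no_finite_part_infinite.
Qed.

Lemma two_ends_conn U e f g : no_finite_part U -> ends_at_most U 2 ->
  outside U e -> outside U f -> outside U g -> ~ conn U e f -> conn U e g \/ conn U f g.
Proof.
move=> nU h oe of_ og n; apply: contrapT => /not_orP[n1 n2].
suff: size [:: e; f; g] <= 2 by [].
apply: h => /=; first by rewrite oe of_ og.
  split; first by move=> a; rewrite !inE => /orP[]/eqP->.
  by split => // a; rewrite inE => /eqP->.
by move=> a; rewrite !inE => /or3P[]/eqP->; apply: no_finite_part_infinite.
Qed.

(** * Extending a trail without cutting off finite parts *)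

Lemma residual_parity_trail U u P v b : trail U u P -> residual_parity U v b ->
  residual_parity (U ++ P) v (b (+) ((u == v) (+) (walk_end u P == v))).
Proof. by case/and3P=> uP oP wP /(residual_parity_cat uP oP);
  rewrite (odd_deg_in_walk v wP). Qed.

(** At the end [x] of a trail from [u] to [e], and only there, the remaining
    degree may be odd.  A finite piece cut off by the trail therefore has even
    degrees, at [x] too by the handshake lemma. *)
Lemma one_way_step U u e : no_finite_part U -> (forall v, residual_parity U v (u == v)) ->
  ends_at_most U 1 -> outside U e ->
  exists l, [/\ trail U u l, e \in l, no_finite_part (U ++ l) &
             forall v, residual_parity (U ++ l) v (walk_end u l == v)].
Proof.
move=> nU pU h oe; have [|f of_ fu] := @odd_unsaturated U u.
  by rewrite -(eqxx u); apply: pU.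
have [P tP eP] := trail_through fu of_ (one_end_conn nU h of_ oe) oe.
have pP v : residual_parity (U ++ P) v (walk_end u P == v).
  by have := residual_parity_trail tP (pU v); rewrite addbA addbb.
have [|l [tl el sl nl]] := absorb_and_traverse nU tP erefl.
  move=> C uC oC cC.
  have ev v : v != walk_end u P -> ~~ odd (deg_in C v).
    move=> vx; apply/negP => /(residual_parity_closed uC oC cC (pP v)).
    by rewrite eq_sym (negbTE vx).
  move=> v; have [->|] := eqVneq v (walk_end u P); last exact: ev.
  exact: handshake.
exists l; split => //; first exact: sl.
by move=> v; have := residual_parity_trail tl (pU v); rewrite addbA addbb.
Qed.

(** With two odd vertices, the new end [x] and the fixed end [w], a finite piece
    could have odd degree at both; it does not if they cannot be joined in what
    is left: the part of the piece that is reachable from [x] avoids [w], so the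
    handshake lemma applies first to it and then to the whole piece. *)
Lemma split_step U u w P : no_finite_part U ->
  (forall v, residual_parity U v ((u == v) (+) (w == v))) ->
  trail U u P -> ~ linked (U ++ P) (walk_end u P) w ->
  exists l, [/\ trail U u l, {subset P <= l}, no_finite_part (U ++ l) &
    ~ linked (U ++ l) (walk_end u l) w].
Proof.
move=> nU pU tP nl; set x := walk_end u P in nl *.
have pP v : residual_parity (U ++ P) v ((x == v) (+) (w == v)).
  have := residual_parity_trail tP (pU v); rewrite -/x.
  by case: (u == v); case: (w == v); case: (x == v).
have [|l [tl el sl nl']] := absorb_and_traverse nU tP erefl.
  move=> C uC oC cC.
  have ev D v : uniq D -> all (outside (U ++ P)) D ->
      closed (U ++ P) (fun e => e \in D) -> v != x -> v != w -> ~~ odd (deg_in D v).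
    move=> uD oD cD vx vw; apply/negP => /(residual_parity_closed uD oD cD (pP v)).
    by rewrite ![_ == v]eq_sym (negbTE vx) (negbTE vw).
  (* the part of the piece that is reachable from [x] *)
  pose D := [seq e <- C | `[< linked (U ++ P) x (s e) >]].
  have DE e y : inc e y -> (e \in D) = (e \in C) && `[< linked (U ++ P) x y >].
    move=> ey; rewrite mem_filter andbC; apply: andb_id2l => eC.
    have oe := allP oC e eC; have se : inc e (s e) by rewrite /inc eqxx.
    by apply/asboolP/asboolP => h; apply: linked_inc h oe _ _.
  have cD : closed (U ++ P) (fun e => e \in D).
    move=> e f eD of_ /touchP[y /andP[ey fy]]; move: eD.
    rewrite (DE e y) // (DE f y) // => /andP[eC ->]; rewrite (cC e f) //.
    exact: touch_inc ey fy.
  have oD : all (outside (U ++ P)) D.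
    by apply/allP => e; rewrite mem_filter => /andP[_ /(allP oC)].
  have evx : ~~ odd (deg_in C x).
    suff : ~~ odd (deg_in D x).
      rewrite -(deg_in_filter D) -(deg_in_filter C) /D -filter_predI.
      congr (~~ odd (deg_in _ _)); apply: eq_in_filter => e eC /=.
      apply: andb_idr => ex; move: (DE e x ex); rewrite mem_filter eC andbT /= => ->.
      by apply/asboolP; apply: linked_refl.
    apply: handshake => v vx; have [->|vw] := eqVneq v w; last first.
      by apply: ev => //; apply: filter_uniq.
    rewrite deg_in_eq0 // => e eD; apply/negP => ew; move: eD.
    by rewrite (DE e w) // => /andP[_ /asboolP].
  move=> v; have [->//|vx] := eqVneq v x.
  have [->|vw] := eqVneq v w; last exact: ev.
  apply: handshake => y yw; have [->//|yx] := eqVneq y x.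
  exact: ev.
exists l; split => //; rewrite el -/x => h; apply: nl; apply: linked_sub h.
by move=> e; rewrite !mem_cat => /orP[->//|/sl->]; rewrite orbT.
Qed.

(** If the trail [P] leads from one end [u] of the given path to the other end
    [w], all finite remaining degrees are even and the finite pieces can be
    absorbed.
    The resulting trail meets an unused edge at some vertex [walk_end u l1],
    as otherwise its edges would be a finite part of [G - U]; this is where the
    closed-up path can be opened again. *)
Lemma close_step U u w P : no_finite_part U ->
  (forall v, residual_parity U v ((u == v) (+) (w == v))) ->
  trail U u P -> walk_end u P = w -> P != [::] ->
  exists l1 l2, [/\ trail U u (l1 ++ l2), walk_end u (l1 ++ l2) = w,
    {subset P <= l1 ++ l2}, no_finite_part (U ++ l1 ++ l2) &
    unsaturated (U ++ l1 ++ l2) (walk_end u l1)].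
Proof.
move=> nU pU tP eP P0.
have pP v : residual_parity (U ++ P) v false.
  have := residual_parity_trail tP (pU v); rewrite eP.
  by rewrite addbb.
have [|l [tl el sl nl]] := absorb_and_traverse nU tP eP.
  by move=> C uC oC cC v; apply/negP => /(residual_parity_closed uC oC cC (pP v)).
have /and3P[ul ol wl] := tl.
have l0 : l != [::].
  by case: (P) P0 sl => // e P' _ /(_ e (mem_head _ _)); case: (l).
apply: contrapT => no; apply: (nU l l0 ol) => e f el' of_ /touchP[y /andP[ey fy]].
apply: contrapT => /negP fl; have [l1 [l2 [dl e1]]] := walk_visits wl el' ey.
apply: no; exists l1, l2; rewrite -dl; split => //.
by exists f; rewrite ?e1 // outside_cat of_.
Qed.

(** * Extending a trail at both of its ends *)

(** Extensions of a path in [G - U] at both ends, with common edges forbidden: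
    [l] continues it beyond its start [u], read backwards, and [m] beyond its
    end [w]. *)
Definition double_trail U u w l m : bool :=
  [&& uniq (l ++ m), all (outside U) (l ++ m), walk u l & walk w m].
(** [U] is the set of edges of the path constructed so far, with ends [u], [w]. *)
Definition two_way_core U u w : Prop :=
  [/\ no_finite_part U, uniq U, all Ed U & forall v,
    odd (deg_in U v) = (u == v) (+) (w == v)].
(** The last condition distinguishes the two regimes: the path is closed, or its
    ends lie in different components of the remaining graph. *)
Definition two_way_state U u w : Prop :=
  [/\ two_way_core U u w, unsaturated U u, unsaturated U w & u = w \/ ~ linked U u w].

Lemma eq_unsaturated U U' v : U =i U' -> unsaturated U v -> unsaturated U' v.
Proof. by move=> h [e oe ev]; exists e => //; rewrite -(eq_outside h). Qed.

Lemma eq_double_trail U U' u w l m : U =i U' ->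
  double_trail U u w l m = double_trail U' u w l m.
Proof. by move=> h; rewrite /double_trail (eq_all (eq_outside h)). Qed.

Lemma two_way_state_perm U U' u w : perm_eq U U' -> two_way_state U u w ->
  two_way_state U' u w.
Proof.
move=> h [[nU uU EU pU] un wn lk]; have m := perm_mem h.
split; [split|exact: eq_unsaturated un|exact: eq_unsaturated wn|].
- exact: eq_no_finite_part nU.
- by rewrite -(perm_uniq h).
- by rewrite -(eq_all_r m).
- by move=> v; rewrite -(deg_in_perm v h).
- case: lk => [|lk]; [by left|right => k]; apply: lk; apply: linked_sub k.
  by move=> e; rewrite m.
Qed.

Lemma two_way_state_swap U u w : two_way_state U u w -> two_way_state U w u.
Proof.
move=> [[nU uU EU pU] un wn lk]; split => //.
  by split => // v; rewrite pU addbC.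
by case: lk => [|lk]; [left|right => /linked_sym].
Qed.

Lemma double_trail_swap U u w l m : double_trail U u w l m = double_trail U w u m l.
Proof.
rewrite /double_trail uniq_catC andbA [X in _ && X]andbC [RHS]andbA; congr (_ && _ && _).
by apply: perm_all; rewrite perm_catC.
Qed.

Lemma double_trail_cat U u w l m l' m' : double_trail U u w l m ->
  double_trail (U ++ l ++ m) (walk_end u l) (walk_end w m) l' m' ->
  double_trail U u w (l ++ l') (m ++ m').
Proof.
case/and4P=> u1 o1 a1 b1 /and4P[u2 /allP o2 a2 b2].
have p : perm_eq ((l ++ l') ++ (m ++ m')) ((l ++ m) ++ (l' ++ m')).
  by rewrite -!catA perm_cat2l perm_catCA.
apply/and4P; split.
- rewrite (perm_uniq p) cat_uniq u1 u2 andbT; apply/hasPn => e /o2.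
  by rewrite outside_cat => /andP[].
- rewrite (perm_all _ p) all_cat o1; apply/allP => e /o2/outside_catl //.
- by rewrite walk_cat a1.
- by rewrite walk_cat b1.
Qed.

Lemma two_way_core_extend U u w l m : two_way_core U u w -> double_trail U u w l m ->
  no_finite_part (U ++ l ++ m) ->
  two_way_core (U ++ l ++ m) (walk_end u l) (walk_end w m).
Proof.
move=> [nU uU EU pU] /and4P[ulm /allP olm wl wm] n; split => //.
- by rewrite cat_uniq uU ulm andbT; apply/hasPn => e /olm/andP[].
- by rewrite all_cat EU; apply/allP => e /olm/andP[].
- move=> v; rewrite !deg_in_cat !oddD pU (odd_deg_in_walk v wl) (odd_deg_in_walk v wm).
  by case: (u == v); case: (w == v); case: (_ == v); case: (_ == v).
Qed.

Section TwoWay.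
Hypothesis even_graph : forall v, residual_parity [::] v false.
Hypothesis ends2 : forall U, ends_at_most U 2.
Hypothesis ends_even : forall U, uniq U -> all Ed U ->
  (forall v, ~~ odd (deg_in U v)) -> ends_at_most U 1.

Lemma two_way_core_parity U u w : two_way_core U u w ->
  forall v, residual_parity U v ((u == v) (+) (w == v)).
Proof.
move=> [_ uU EU pU] v; rewrite -pU; have := @residual_parity_cat [::] U v false uU.
by rewrite /=; apply => //; rewrite (eq_all (a2 := Ed)) // => e; rewrite /outside andbT.
Qed.

(** Follow a trail [P] from [u] to [e].  If its end can still be joined to [w],
    close up the path, absorb the finite pieces, and open the resulting circuit
    at a vertex that has unused edges; the part after this vertex, reversed,
    goes to the other side.  Otherwise the two ends have been separated. *)
Lemma extend_left_core U u w f e : two_way_core U u w -> outside U f -> inc f u ->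
  conn U f e ->
  exists l m, [/\ double_trail U u w l m, e \in l ++ m,
    two_way_state (U ++ l ++ m) (walk_end u l) (walk_end w m) &
    u = w \/ ~ linked U u w -> l != [::]].
Proof.
move=> cU of_ fu fe; have oe := conn_outside of_ fe.
have pU := two_way_core_parity cU; have [nU _ _ _] := cU.
have [P tP eP] := trail_through fu of_ fe oe.
have [[Q tQ eQ]|nl] := pselect (linked (U ++ P) (walk_end u P) w).
  have tPQ : trail U u (P ++ Q) by rewrite trail_cat tP.
  have ePQ : walk_end u (P ++ Q) = w by rewrite walk_end_cat.
  have [|l1 [l2 [tl el sl nl un]]] := close_step nU pU tPQ ePQ.
    by case: (P) eP.
  have {}el' : e \in l1 ++ l2 by apply: sl; rewrite mem_cat eP.
  (* a circuit that reopens at its base point is given to the left side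
     entirely, so that this side makes progress *)
  have [[l10 uw]|h] := pselect (l1 = [::] /\ u = w).
    move: tl el el' nl un; rewrite l10 /= => tl el el' nl un.
    exists l2, [::]; rewrite cats0.
    have ex : double_trail U u w l2 [::] by rewrite /double_trail cats0 andbT.
    have := two_way_core_extend cU ex; rewrite cats0 => /(_ nl) cc.
    split => //=; last by case: (l2) el'.
    rewrite el in cc *; rewrite -uw in cc *.
    by split => //; left.
  have [wr er] : walk w (rev l2) /\ walk_end w (rev l2) = walk_end u l1.
    move/and3P: tl => [_ _]; rewrite walk_cat => /andP[_ /walk_rev].
    by rewrite -walk_end_cat el.
  have pr : perm_eq (l1 ++ rev l2) (l1 ++ l2) by rewrite perm_cat2l perm_rev.
  have ex : double_trail U u w l1 (rev l2).
    move/and3P: tl => [ul ol]; rewrite walk_cat => /andP[wl _].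
    by rewrite /double_trail (perm_uniq pr) (perm_all _ pr) ul ol wl wr.
  exists l1, (rev l2); split => //.
  - by rewrite (perm_mem pr).
  - have mr : U ++ l1 ++ l2 =i U ++ l1 ++ rev l2.
      by move=> g; rewrite mem_cat -(perm_mem pr) -mem_cat.
    split; [|exact: eq_unsaturated un|by rewrite er; apply: eq_unsaturated un|by left;
      rewrite er].
    by apply: two_way_core_extend => //; apply: eq_no_finite_part nl.
  - move=> h'; have [l10|//] := eqVneq l1 [::]; case: h.
    by split => //; case: h' => // []; case; exists (l1 ++ l2).
have [l [tl sl nl' nlk]] := split_step nU pU tP nl.
have el := sl _ eP.
have ex : double_trail U u w l [::] by move/and3P: tl => [h1 h2 h3];
    rewrite /double_trail cats0 h1 h2 h3.
exists l, [::]; rewrite cats0; split => //=; last by case: (l) el.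
have cU' : two_way_core (U ++ l) (walk_end u l) w.
  by have := two_way_core_extend cU ex; rewrite cats0; apply.
have xw : walk_end u l != w by apply/eqP => xw; apply: nlk; rewrite xw;
    apply: linked_refl.
have pU' := two_way_core_parity cU'; split => //; last by right.
- by apply: odd_unsaturated; have := pU' (walk_end u l);
    rewrite eqxx [w == _]eq_sym (negbTE xw).
- by apply: odd_unsaturated; have := pU' w; rewrite eqxx (negbTE xw).
Qed.

Lemma extend_left U u w : two_way_state U u w -> exists l m, [/\ double_trail U u w l m,
    two_way_state (U ++ l ++ m) (walk_end u l) (walk_end w m) & l != [::]].
Proof.
move=> [cU [f of_ fu] wn lk].
have [l [m [h1 h2 h3 h4]]] := extend_left_core cU of_ fu (conn_refl _ _).
by exists l, m; split => //; apply: h4.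
Qed.

Lemma extend_right U u w : two_way_state U u w -> exists l m, [/\ double_trail U u w l m,
    two_way_state (U ++ l ++ m) (walk_end u l) (walk_end w m) & m != [::]].
Proof.
move=> /two_way_state_swap/extend_left[l [m [h1 h2 h3]]]; exists m, l; split => //.
  by rewrite double_trail_swap.
by apply/two_way_state_swap/(two_way_state_perm _ h2); rewrite perm_cat2l perm_catC.
Qed.

(** If the path is closed then its edges have even degrees, and the remaining
    graph is connected; otherwise it has at most two components, one at each end
    of the path. *)
Lemma extend_to_edge U u w e : two_way_state U u w -> outside U e ->
  exists l m, [/\ double_trail U u w l m, e \in l ++ m &
    two_way_state (U ++ l ++ m) (walk_end u l) (walk_end w m)].
Proof.
move=> iU oe; have [cU [f of_ fu] [g og gw] lk] := iU.
have [nU uU EU pU] := cU.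
have [fe|ge] : conn U f e \/ conn U g e.
- case: lk => [uw|nl].
    left; apply: one_end_conn => //; apply: ends_even => // v.
    by rewrite pU uw addbb.
  apply: (two_ends_conn nU (@ends2 U) of_ og oe) => fg; apply: nl.
  exact: linked_conn fu of_ fg gw.
- have [l [m [h1 h2 h3 _]]] := extend_left_core cU of_ fu fe.
  by exists l, m.
- have [cU' _ _ _] := two_way_state_swap iU.
  have [l [m [h1 h2 h3 _]]] := extend_left_core cU' og gw ge.
  exists m, l; split; first by rewrite double_trail_swap.
    by rewrite mem_cat orbC -mem_cat.
  by apply/two_way_state_swap/(two_way_state_perm _ h3); rewrite perm_cat2l perm_catC.
Qed.

Lemma two_way_state_cat U u w l m l' m' :
  two_way_state ((U ++ l ++ m) ++ l' ++ m') (walk_end (walk_end u l) l') (walk_end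
    (walk_end w m) m') ->
  two_way_state (U ++ (l ++ l') ++ (m ++ m')) (walk_end u (l ++ l')) (walk_end w (m ++
    m')).
Proof.
rewrite !walk_end_cat; apply: two_way_state_perm.
by rewrite -!catA !perm_cat2l perm_catCA.
Qed.

(** Extending both sides at every step is what makes both sides of the limit
    infinite. *)
Lemma extend_both U u w e : two_way_state U u w ->
  exists l m, [/\ double_trail U u w l m, outside U e -> e \in l ++ m,
    two_way_state (U ++ l ++ m) (walk_end u l) (walk_end w m), l != [::] & m != [::]].
Proof.
move=> i0; have [l0 [m0 [x0 e0 {}i0]]] : exists l m, [/\ double_trail U u w l m,
    outside U e -> e \in l ++ m & two_way_state (U ++ l ++ m) (walk_end u l) (walk_end
      w m)].
  have [oe|oe] := boolP (outside U e).
    by have [l [m [? ? ?]]] := extend_to_edge i0 oe; exists l, m.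
  by exists [::], [::]; rewrite !cats0.
have [l1 [m1 [x1 i1 n1]]] := extend_left i0.
have [l2 [m2 [x2 i2 n2]]] := extend_right i1.
have x02 := double_trail_cat x0 x1; have i02 := two_way_state_cat i1.
have i2' : two_way_state ((U ++ (l0 ++ l1) ++ (m0 ++ m1)) ++ l2 ++ m2)
    (walk_end (walk_end u (l0 ++ l1)) l2) (walk_end (walk_end w (m0 ++ m1)) m2).
  rewrite !walk_end_cat; apply: two_way_state_perm i2.
  by rewrite -!catA !perm_cat2l perm_catCA.
exists ((l0 ++ l1) ++ l2), ((m0 ++ m1) ++ m2); split.
- apply: double_trail_cat x02 _; rewrite !walk_end_cat;
    rewrite (@eq_double_trail _ ((U ++ l0 ++ m0) ++ l1 ++ m1)) //.
  by apply: perm_mem; rewrite -!catA !perm_cat2l perm_catCA.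
- by move=> /e0; rewrite !mem_cat => /orP[]->; rewrite ?orbT.
- exact: two_way_state_cat i2'.
- by case: (l1) n1; case: (l0) => //= a l; case: (l).
- by case: (m2) n2; case: (m0 ++ m1).
Qed.

End TwoWay.

(** * Infinite Eulerian trails *)

Lemma trail_catl U u l1 l2 : trail U u (l1 ++ l2) -> trail U u l1.
Proof. by rewrite trail_cat => /andP[]. Qed.

Lemma double_trail_catl U u w l1 l2 m1 m2 : double_trail U u w (l1 ++ l2) (m1 ++ m2) ->
  double_trail U u w l1 m1.
Proof.
case/and4P; rewrite !walk_cat -!catA catA.
have p : perm_eq ((l1 ++ l2) ++ (m1 ++ m2)) ((l1 ++ m1) ++ (l2 ++ m2)).
  by rewrite -!catA perm_cat2l perm_catCA.
rewrite (perm_uniq p) (perm_all _ p) cat_uniq all_cat /double_trail.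
by case/and3P=> -> _ _ /andP[-> _] /andP[-> _] /andP[-> _].
Qed.

Lemma take_mkseq (T : Type) (r : nat -> T) n k : n <= k -> take n (mkseq r k) = mkseq r n.
Proof. by move=> h; rewrite /mkseq -map_take take_iota (minn_idPl h). Qed.

Section Limits.
Variable en : nat -> E.
Hypothesis enE : forall e, Ed e -> exists n, en n = e.

(** The trail is extended through the first edges of the enumeration [en] in
    turn, or through any edge when the next one is already used. *)
Theorem one_way_ray U w : no_finite_part U -> (forall v, residual_parity U v (w == v)) ->
  (forall U', ends_at_most U' 1) -> (exists e, outside U e) ->
  exists r : nat -> E, (forall n, trail U w (mkseq r n)) /\
    (forall e, outside U e -> exists i, r i = e).
Proof.
move=> nU pU h [e0 oe0].
pose Inv l := [/\ trail U w l, no_finite_part (U ++ l) &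
                  forall v, residual_parity (U ++ l) v (walk_end w l == v)].
pose R n l l' := (exists2 m, m != [::] & l' = l ++ m) /\
                 (outside U (en n) -> en n \in l').
have [|n l [tl nl pl]|f [f0 hf]] := @dependent_choice_seq _ Inv R [::].
- by split => //; rewrite cats0.
- have [e oe he] : exists2 e, outside (U ++ l) e &
      (outside U (en n) -> en n \notin l -> e = en n).
    have [/andP[o k]|k] := boolP (outside U (en n) && (en n \notin l)).
      by exists (en n); rewrite ?outside_cat ?o.
    have [|e oe _] := @odd_unsaturated (U ++ l) (walk_end w l).
      by rewrite -(eqxx (walk_end w l)); apply: pl.
    by exists e => // o k'; rewrite o k' in k.
  have [m [tm em nm pm]] := one_way_step nl pl (h _) oe.
  exists (l ++ m); split; [split|split].
  - by rewrite trail_cat tl.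
  - by rewrite catA.
  - by move=> v; rewrite catA walk_end_cat.
  - by exists m => //; case: (m) em.
  - move=> o; rewrite mem_cat; have [//|k] := boolP (en n \in l).
    by rewrite -(he o k).
have [r hr] := limit_seq (fun n => (hf n).2.1).
exists r; split.
  move=> n; have [e sz] := hr n; rewrite -(take_mkseq r sz) e.
  have [[tl _ _] _] := hf n; apply: trail_catl (drop n (f n)) _.
  by rewrite cat_take_drop.
move=> e oe; have [n en_n] : exists n, en n = e by apply: enE; case/andP: oe.
have := (hf n).2.2; rewrite en_n => /(_ oe); have [<- _] := hr n.+1.
by move=> /mapP[i _ ->]; exists i.
Qed.

Theorem two_way_rays_exist U u w :
  (forall v, residual_parity [::] v false) -> (forall U', ends_at_most U' 2) ->
  (forall U', uniq U' -> all Ed U' -> (forall v, ~~ odd (deg_in U' v)) ->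
     ends_at_most U' 1) ->
  two_way_core U u w -> unsaturated U u -> unsaturated U w ->
  exists r1 r2 : nat -> E, (forall n, double_trail U u w (mkseq r1 n) (mkseq r2 n)) /\
    (forall e, outside U e -> (exists i, r1 i = e) \/ (exists i, r2 i = e)).
Proof.
move=> ev h2 he cU un wn.
pose Inv (p : seq E * seq E) := double_trail U u w p.1 p.2 /\
  two_way_state (U ++ p.1 ++ p.2) (walk_end u p.1) (walk_end w p.2).
pose R n (p p' : seq E * seq E) :=
  [/\ exists2 m, m != [::] & p'.1 = p.1 ++ m,
      exists2 m, m != [::] & p'.2 = p.2 ++ m &
      (outside U (en n) -> en n \in p'.1 ++ p'.2)].
have [p0 ip0] : exists p0, Inv p0.
  have [lk|nlk] := pselect (u = w \/ ~ linked U u w).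
    by exists ([::], [::]); split => //=; rewrite cats0.
  have [f of_ fu] := un.
  have [l [m [x _ i _]]] := extend_left_core ev cU of_ fu (conn_refl _ _).
  by exists (l, m).
have [//|n [l m] [/= xlm ilm]|f [f0 hf]] := @dependent_choice_seq _ Inv R p0.
  have [l' [m' [x' e' i' l0 m0]]] := extend_both ev h2 he (en n) ilm.
  exists (l ++ l', m ++ m'); split; [split|split] => /=.
  - exact: double_trail_cat x'.
  - exact: two_way_state_cat.
  - by exists l'.
  - by exists m'.
  - move=> oe; have p : perm_eq ((l ++ l') ++ (m ++ m')) ((l ++ m) ++ (l' ++ m')).
      by rewrite -!catA perm_cat2l perm_catCA.
    rewrite (perm_mem p) mem_cat; have [//|k] := boolP (en n \in l ++ m).
    by apply: e'; rewrite outside_cat oe.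
have [|r1 hr1] := @limit_seq _ (fun n => (f n).1).
  by move=> n; have [_ []] := hf n.
have [|r2 hr2] := @limit_seq _ (fun n => (f n).2).
  by move=> n; have [_ []] := hf n.
exists r1, r2; split.
  move=> n; have [e1 sz1] := hr1 n; have [e2 sz2] := hr2 n.
  rewrite -(take_mkseq r1 sz1) -(take_mkseq r2 sz2) e1 e2.
  have [[x _] _] := hf n; apply: double_trail_catl (drop n (f n).1) _ (drop n (f n).2) _.
  by rewrite !cat_take_drop.
move=> e oe; have [n en_n] : exists n, en n = e by apply: enE; case/andP: oe.
have [_ [_ _]] := hf n; rewrite en_n => /(_ oe).
have [<- _] := hr1 n.+1; have [<- _] := hr2 n.+1.
by rewrite mem_cat => /orP[]/mapP[i _ ->]; [left|right]; exists i.
Qed.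

End Limits.

(** * The criteria for extendability *)

Lemma ray_touch u r : (forall n, walk u (mkseq r n)) -> forall i, touch (r i) (r i.+1).
Proof.
move=> h i; have := h i.+2; rewrite /mkseq -addn2 iotaD map_cat walk_cat /=.
case/and4P=> _ a b _; apply: touch_inc b; exact: inc_other.
Qed.

(** Once on an edge of the closed set [F], the ray would stay in [F], and its
    edges are pairwise distinct. *)
Lemma ray_avoids U u r F : (forall n, trail U u (mkseq r n)) ->
  closed U (fun e => e \in F) -> forall i, r i \notin F.
Proof.
move=> h cF i; apply/negP => iF.
have tc : forall i, touch (r i) (r i.+1).
  by apply: (@ray_touch u) => n; have /and3P[] := h n.
have oR j : outside U (r j).
  by have /and3P[_ /allP o _] := h j.+1; apply: o; rewrite map_f // mem_iota /=; lia.
have inF j : r (i + j) \in F.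
  by elim: j => [|j IH]; rewrite ?addn0 // addnS; apply: (cF _ _ IH).
have /and3P[u1 _ _] := h (i + (size F).+1).
have : size (drop i (mkseq r (i + (size F).+1))) <= size F.
  apply: uniq_leq_size; first exact: drop_uniq.
  move=> e; rewrite /mkseq -map_drop drop_iota => /mapP[j]; rewrite mem_iota => hj ->.
  by rewrite -(subnKC (_ : i <= j)) //; move: hj; lia.
by rewrite size_drop size_mkseq; lia.
Qed.

Definition euler_ray u r := (forall n, trail [::] u (mkseq r n)) /\
  (forall e, Ed e -> exists i, r i = e).
(** A two-way infinite path is cut at [u] into two rays with disjoint edge sets. *)
Definition euler_line u r1 r2 :=
  (forall n, double_trail [::] u u (mkseq r1 n) (mkseq r2 n)) /\
  (forall e, Ed e -> (exists i, r1 i = e) \/ (exists i, r2 i = e)).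

Definition shift (r : nat -> E) k i := r (k + i).

Lemma mkseq_shift r k n : mkseq r (k + n) = mkseq r k ++ mkseq (shift r k) n.
Proof.
rewrite /mkseq iotaD map_cat add0n; congr (_ ++ _).
by rewrite -{1}(addn0 k) iotaDl -map_comp.
Qed.

(** The default value [r 0] of [nth] is never reached. *)
Definition prepend U (r : nat -> E) i :=
  if i < size U then nth (r 0) U i else r (i - size U).

Lemma mkseq_prepend U r n : mkseq (prepend U r) (size U + n) = U ++ mkseq r n.
Proof.
rewrite mkseq_shift; congr (_ ++ _); last first.
  by apply: eq_map => i; rewrite /shift /prepend ltnNge leq_addr /= addKn.
rewrite -[RHS](mkseq_nth (r 0)); apply/eq_in_map => i; rewrite mem_iota /prepend add0n.
by move=> /= ->.
Qed.

(** Take an initial segment that contains all edges at [v] and look at its degree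
    at [v]; the segment does not end at [v], since the next edge would then be
    another edge at [v]. *)
Lemma euler_ray_parity u r : euler_ray u r -> forall v, residual_parity [::] v (u == v).
Proof.
move=> [tr cov] v l ul hl.
have [n0 hn0] : exists n0, forall e, e \in l -> e \in mkseq r n0.
  have {hl} : all Ed l by apply/allP => e; rewrite hl => /andP[/andP[]].
  elim: l {ul} => [|e l IH] /=; first by exists 0.
  case/andP=> /cov[i ei] /IH[n hn]; exists (maxn i.+1 n) => f.
  rewrite inE => /orP[/eqP->|/hn].
    by rewrite -ei map_f // mem_iota /= leq_max ltnSn.
  case/mapP=> j; rewrite mem_iota => hj ->.
  by rewrite map_f // mem_iota /= leq_max; move: hj => /= ->; rewrite orbT.
have [un /allP on wn] := and3P (tr n0.+1).
have mk : mkseq r n0.+1 = mkseq r n0 ++ [:: r n0].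
  by rewrite mkseqS -cats1.
have p : perm_eq l [seq e <- mkseq r n0 | inc e v].
  apply: uniq_perm => //; first by rewrite filter_uniq //; have /and3P[] := tr n0.
  move=> e; rewrite mem_filter; apply/idP/andP => [el|[ev en]].
    by split; [move: el; rewrite hl => /andP[]|exact: hn0].
  by rewrite hl ev andbT; apply: on; rewrite mk mem_cat en.
rewrite (deg_in_perm v p) deg_in_filter; have /and3P[_ _ wn0] := tr n0.
rewrite (odd_deg_in_walk v wn0) -[RHS]addbF; congr (_ (+) _).
apply/negP => /eqP ev; move: wn un; rewrite mk walk_cat ev cat_uniq /= orbF.
case/and3P=> _ rv _ /and3P[_ /negP + _]; apply; apply: hn0.
by rewrite hl rv on // mk mem_cat mem_head orbT.
Qed.

Lemma trail_whole u l : trail [::] u l = [&& uniq l, all Ed l & walk u l].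
Proof. by rewrite /trail (eq_all (a2 := Ed)) // => e; rewrite /outside andbT. Qed.

Lemma euler_ray_no_finite_part u r U : euler_ray u r -> mkseq r (size U) = U ->
  no_finite_part U.
Proof.
move=> [tr cov] eU F F0 oF cF.
have tr' n : trail U (walk_end u U) (mkseq (shift r (size U)) n).
  by have := tr (size U + n); rewrite mkseq_shift eU trail_cat => /andP[].
case: F F0 oF cF => // e F _ /andP[/andP[Ee eU'] _] cF.
have [i ri] := cov e Ee.
have [lt|ge] := ltnP i (size U).
  by case/negP: eU'; rewrite -eU -ri map_f // mem_iota.
have := ray_avoids tr' cF (i - size U); rewrite /shift subnKC //.
by rewrite ri mem_head.
Qed.

Section Char.
Variable en : nat -> E.
Hypothesis enE : forall e, Ed e -> exists n, en n = e.
Hypothesis infE : forall l, exists2 e, Ed e & e \notin l.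

Theorem one_way_criterion u U : (forall U', ends_at_most U' 1) -> trail [::] u U ->
  (exists2 r, euler_ray u r & mkseq r (size U) = U) <->
  (forall v, residual_parity [::] v (u == v)) /\ no_finite_part U.
Proof.
move=> h tU; split => [[r er eU]|[pU nU]].
  by split; [exact: euler_ray_parity er|exact: euler_ray_no_finite_part er eU].
have [||r [tr cov]] := @one_way_ray en enE U (walk_end u U) nU _ h.
- by move=> v; have := residual_parity_trail tU (pU v); rewrite addbA addbb.
- by have [e Ee eU] := infE U; exists e; rewrite /outside Ee.
exists (prepend U r).
  split=> [n|e Ee].
    apply: trail_catl (mkseq (shift (prepend U r) n) (size U)) _.
    by rewrite -mkseq_shift addnC mkseq_prepend trail_cat tU tr.
  have [eU|eU] := boolP (e \in U); last first.
    have [|i <-] := cov e; first by rewrite /outside Ee.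
    by exists (size U + i); rewrite /prepend ltnNge leq_addr addKn.
  exists (index e U); rewrite /prepend index_mem eU.
  by rewrite nth_index.
by have := mkseq_prepend U r 0; rewrite /= cats0 addn0.
Qed.

Theorem two_way_criterion u U :
  (forall v, residual_parity [::] v false) -> (forall U', ends_at_most U' 2) ->
  (forall U', uniq U' -> all Ed U' -> (forall v, ~~ odd (deg_in U' v)) ->
     ends_at_most U' 1) ->
  trail [::] u U ->
  (exists r1 r2, euler_line u r1 r2 /\ mkseq r2 (size U) = U) <->
  [/\ unsaturated U u, unsaturated U (walk_end u U) & no_finite_part U].
Proof.
move=> ev h2 he tU; have [uU oU wU] := and3P tU.
split=> [[r1 [r2 [[ex cov] eU]]]|[un wn nU]].
  have ex' n : double_trail U u (walk_end u U) (mkseq r1 n) (mkseq (shift r2 (size U)) n).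
    have := ex (n + size U); rewrite mkseq_shift -[mkseq r2 _]cats0 => /double_trail_catl.
    rewrite addnC mkseq_shift eU double_trail_swap => exn.
    rewrite /double_trail -catA cat_uniq !all_cat walk_cat in exn.
    case/and4P: exn => /and3P[_ hU u1] /andP[_ o1] /andP[_ w2] w1.
    have p : perm_eq (mkseq r1 n ++ mkseq (shift r2 (size U)) n)
                     (mkseq (shift r2 (size U)) n ++ mkseq r1 n).
      by rewrite perm_catC.
    rewrite /double_trail (perm_uniq p) (perm_all _ p) u1 w1 w2 /= andbT.
    apply/allP => e em; rewrite /outside (hasPn hU) // andbT.
    by move: o1; rewrite -all_cat => /allP/(_ e em)/andP[].
  have t1 n : trail U u (mkseq r1 n).
    have := ex' n; rewrite /double_trail cat_uniq all_cat =>
        /and4P[/and3P[a _ _] /andP[b _] c _].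
    by rewrite /trail a b.
  have t2 n : trail U (walk_end u U) (mkseq (shift r2 (size U)) n).
    have := ex' n; rewrite /double_trail cat_uniq all_cat =>
        /and4P[/and3P[_ _ a] /andP[_ b] _ c].
    by rewrite /trail a b.
  have [_ /= /andP[o1 _] /andP[i1 _]] := and3P (t1 1).
  have [_ /= /andP[o2 _] /andP[i2 _]] := and3P (t2 1).
  split; [by exists (r1 0)|by exists (shift r2 (size U) 0)|].
  move=> F F0 oF cF; case: F F0 oF cF => // e F _ /andP[/andP[Ee eU'] _] cF.
  have [[i ri]|[i ri]] := cov e Ee.
    by have := ray_avoids t1 cF i; rewrite ri mem_head.
  have [lt|ge] := ltnP i (size U).
    by case/negP: eU'; rewrite -eU -ri map_f // mem_iota.
  have := ray_avoids t2 cF (i - size U); rewrite /shift subnKC //.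
  by rewrite ri mem_head.
have cU : two_way_core U u (walk_end u U).
  split => //; first by move: tU; rewrite trail_whole => /and3P[].
  by move=> v; rewrite (odd_deg_in_walk v wU).
have [r1 [r2 [ex cov]]] := two_way_rays_exist enE ev h2 he cU un wn.
have exU n : double_trail [::] u u (mkseq r1 n) (U ++ mkseq r2 n).
  have /and4P[u1 /allP o1 w1 w2] := ex n.
  have p : perm_eq (mkseq r1 n ++ U ++ mkseq r2 n) (U ++ mkseq r1 n ++ mkseq r2 n).
    by rewrite perm_catCA.
  rewrite /double_trail (perm_uniq p) (perm_all _ p) w1 walk_cat wU w2 all_cat oU
      cat_uniq uU u1 /=.
  rewrite !andbT; apply/andP; split.
    by apply/hasPn => e /o1/andP[].
  by apply/allP => e /o1/andP[h _]; rewrite /outside h.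
exists r1, (prepend U r2); split; last first.
  by have := mkseq_prepend U r2 0; rewrite /= cats0 addn0.
split=> [n|e Ee].
  have exn := exU n.
  rewrite -mkseq_prepend addnC mkseq_shift -[mkseq r1 _]cats0 in exn.
  exact: double_trail_catl exn.
have [eU|eU] := boolP (e \in U).
  right; exists (index e U); rewrite /prepend index_mem eU.
  by rewrite nth_index.
have [|[i <-]|[i <-]] := cov e; first by rewrite /outside Ee.
  by left; exists i.
by right; exists (size U + i); rewrite /prepend ltnNge leq_addr addKn.
Qed.

End Char.

(** * Finite certificates *)

Section Certificates.
Variable degc : V -> nat.
(** The test for [v] having no edge outside [U].  The function [degc] gives the
    successor of a finite degree, and [0] for an infinite one. *)
Definition saturated U v := degc v == (deg_in U v).+1.
Hypothesis satP : forall U e v, uniq U -> all Ed U -> Ed e -> inc e v ->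
  reflect (~ unsaturated U v) (saturated U v).

(** A finite certificate against [no_finite_part U]: [F] is closed because the
    ends of its edges have all of their edges in [U ++ F]. *)
Definition refutes U F :=
  [&& F != [::], uniq (U ++ F), all Ed F &
      all (fun e => saturated (U ++ F) (s e) && saturated (U ++ F) (d e)) F].

Lemma inc_s e : inc e (s e). Proof. by rewrite /inc eqxx. Qed.
Lemma inc_d e : inc e (d e). Proof. by rewrite /inc eqxx orbT. Qed.

Lemma refutes_correct U : all Ed U -> uniq U ->
  (exists F, refutes U F) <-> ~ no_finite_part U.
Proof.
move=> EU uU; split=> [[F /and4P[F0 uUF EF /allP satF]] nU|nU].
  have uF : uniq F by move: uUF; rewrite cat_uniq => /and3P[].
  have dF : ~~ has (mem U) F by move: uUF; rewrite cat_uniq => /and3P[].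
  have EUF : all Ed (U ++ F) by rewrite all_cat EU.
  apply: (nU F F0).
    by apply/allP => e eF; rewrite /outside (allP EF) // (hasPn dF).
  move=> e f eF of_ /touchP[v /andP[ev fv]].
  have Ee := allP EF e eF; have /andP[ss sd] := satF e eF.
  have : saturated (U ++ F) v by move: ev; rewrite /inc => /orP[]/eqP<-.
  move/(satP uUF EUF Ee ev) => no; apply: contrapT => /negP fF; apply: no.
  by exists f => //; rewrite outside_cat of_.
have [F [F0 oF cF]] : exists F, [/\ F != [::], all (outside U) F & closed U (fun e =>
    e \in F)].
  apply: contrapT => no; apply: nU => F F0 oF cF; apply: no.
  by exists F.
have mF := mem_undup F.
have uUF : uniq (U ++ undup F).
  rewrite cat_uniq uU undup_uniq andbT; apply/hasPn => e; rewrite mF.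
  by move=> /(allP oF)/andP[].
have EF : all Ed (undup F) by apply/allP => e; rewrite mF => /(allP oF)/andP[].
have EUF : all Ed (U ++ undup F) by rewrite all_cat EU.
exists (undup F); rewrite /refutes uUF EF /=.
apply/andP; split.
  by case: F {oF cF uUF EF EUF} F0 mF => // e F _ /(_ e); rewrite mem_head; case: undup.
have h e v : e \in F -> inc e v -> saturated (U ++ undup F) v.
  move=> eF ev; apply/(satP uUF EUF (_ : Ed e)) => //.
    by have /andP[] := allP oF e eF.
  case=> f; rewrite outside_cat mF => /andP[of_ fF] fv; case/negP: fF.
  by apply: (cF e) => //; apply: touch_inc ev fv.
apply/allP => e; rewrite mF => eF.
by rewrite !(h e) ?inc_s ?inc_d.
Qed.

(** The edges of [L] are added to [U] one at a time, the head of [L] being the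
    last.  Each of them, once added, has an end that still meets an unused
    edge. *)
Fixpoint chain U L := if L is e :: L' then
  [&& chain U L', Ed e, e \notin L' ++ U &
      ~~ (saturated (L ++ U) (s e) && saturated (L ++ U) (d e))] else true.

Lemma chain_uniq U L : uniq U -> all Ed U -> chain U L ->
  uniq (L ++ U) && all Ed (L ++ U).
Proof.
move=> uU EU; elim: L => [|e L IH] /=; first by rewrite uU.
by case/and4P=> /IH/andP[-> ->] -> -> _.
Qed.

(** Without [e], a finite part of [G - U] would be one of [G - (e :: U)]; so it
    is [e] alone, but some other edge outside [U] touches [e]. *)
Lemma chain_sound U L : uniq U -> all Ed U -> chain U L -> no_finite_part (L ++ U) ->
  no_finite_part U.
Proof.
move=> uU EU; elim: L => //= e L IH /and4P[cL Ee eL us] n; apply: IH => //.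
have /andP[uX EX] := chain_uniq uU EU cL.
set X := L ++ U in eL us n uX EX *.
have ueX : uniq (e :: X) by rewrite /= eL.
have EeX : all Ed (e :: X) by rewrite /= Ee.
have [f of_ ef] : exists2 f, outside (e :: X) f & touch e f.
  apply: contrapT => no; case/negP: us; apply/andP; split.
    apply/(satP ueX EeX Ee (inc_s e)) => -[f of_ fs]; apply: no; exists f => //.
    exact: touch_inc (inc_s e) fs.
  apply/(satP ueX EeX Ee (inc_d e)) => -[f of_ fs]; apply: no; exists f => //.
  exact: touch_inc (inc_d e) fs.
move=> F F0 oF cF.
have oX a : outside (e :: X) a -> outside X a /\ a != e.
  by rewrite /outside inE negb_or => /and3P[-> -> ->].
have cF' : closed (e :: X) (fun a => a \in [seq a <- F | a != e]).
  move=> a b; rewrite !mem_filter => /andP[ae aF] /oX[ob ->] ab /=.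
  exact: cF ab.
have : [seq a <- F | a != e] = [::].
  apply/eqP/negPn/negP => h; apply: (n _ h _ cF').
  apply/allP => a; rewrite mem_filter /outside inE negb_or =>
      /andP[-> /(allP oF)/andP[-> ->]] //.
move=> F'0.
have inF a : a \in F -> a = e.
  move=> aF; apply/eqP/negPn/negP => ae.
  have : a \in [seq a <- F | a != e] by rewrite mem_filter ae.
  by rewrite F'0.
have eF : e \in F.
  by case: F F0 inF {oF cF cF' F'0} => // a F _ /(_ a (mem_head _ _)) ->;
      rewrite mem_head.
have [of' fe] := oX f of_.
by move: fe; rewrite (inF f) ?eqxx //; apply: cF eF of' ef.
Qed.

(** The chain is constructed from its end: as [K] is not closed in [G - U], some
    [e] in [K] touches an edge outside [U] and [K], and can be added last. *)
Lemma chain_exists U K : no_finite_part U -> uniq U -> all Ed U -> uniq K ->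
  all (outside U) K -> exists2 L, perm_eq L K & chain U L.
Proof.
move=> nU uU EU; elim: {K}_.+1 {-2}K (ltnSn (size K)) => // n IH K szK uK oK.
have [->|K0] := eqVneq K [::]; first by exists [::].
have [e [f [eK of_ ef fK]]] : exists e f, [/\ e \in K, outside U f,
    touch e f & f \notin K].
  apply: contrapT => no; apply: (nU K K0 oK) => e f eK of_ ef.
  by apply: contrapT => /negP fK; apply: no; exists e, f.
have pK := perm_to_rem eK.
have [|||L pL cL] := IH (rem e K).
- by rewrite size_rem //; case: (K) szK K0.
- exact: rem_uniq.
- by apply/allP => a /mem_rem/(allP oK).
have peL : perm_eq (e :: L) K by rewrite perm_sym (perm_trans pK) // perm_cons perm_sym.
exists (e :: L) => //=.
have /andP[Ee eU] := allP oK e eK.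
have eL : e \notin L by rewrite (perm_mem pL) mem_rem_uniq // inE eqxx.
have ueL : uniq (e :: L ++ U).
  have /andP[u1 _] := chain_uniq uU EU cL.
  by rewrite /= u1 mem_cat negb_or eL eU.
have EeL : all Ed (e :: L ++ U).
  by have /andP[_ h] := chain_uniq uU EU cL; rewrite /= Ee.
rewrite cL Ee mem_cat negb_or eL eU /=.
have [v /andP[ev fv]] := touchP _ _ ef.
have us : ~~ saturated (e :: L ++ U) v.
  apply/negP => /(satP ueL EeL Ee ev); apply; exists f => //.
  have : f \notin e :: L by rewrite (perm_mem peL).
  case/andP: of_ => Ef fU h; apply/andP; split => //.
  by rewrite -cat_cons mem_cat negb_or h.
by move: ev; rewrite /inc => /orP[]/eqP ev; rewrite negb_and ev us ?orbT.
Qed.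

(** An upper bound for the number of components met by [M]: the number of edges
    of [M] that touch none of the edges that were listed before, that is, to
    their right. *)
Fixpoint pieces M : nat :=
  if M is e :: M' then ~~ has (touch e) M' + pieces M' else 0.

Lemma apart_filter K q (p : pred E) : apart K q -> apart K (filter p q).
Proof.
elim: q => //= e q IH [h /IH a]; case: ifP => // _; split => // f.
by rewrite mem_filter => /andP[_ /h].
Qed.

(** Of the edges of [q], at most one is connected to the head of [M] but to no
    other edge of [M]; if there is one, the head starts a new piece. *)
Lemma apart_pieces K M q : all (outside K) M -> all (outside K) q -> apart K q ->
  (forall e, e \in q -> exists2 m, m \in M & conn K e m) -> size q <= pieces M.
Proof.
elim: M q => [|e M IH] q /=.
  by case: q => // a q _ _ _ /(_ a (mem_head _ _)) [].
case/andP=> oe oM oq aq hq.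
pose p a := `[< exists2 m, m \in M & conn K a m >].
have sz1 : size (filter p q) <= pieces M.
  apply: IH => //; first by apply/allP => a; rewrite mem_filter => /andP[_ /(allP oq)].
    exact: apart_filter.
  by move=> a; rewrite mem_filter /p => /andP[/asboolP].
have ce a : a \in q -> ~~ p a -> conn K a e.
  rewrite /p => aq' /asboolP na; have [m] := hq a aq'.
  by rewrite inE => /orP[/eqP->//|mM am]; case: na; exists m.
have sz2 : size (filter (predC p) q) <= ~~ has (touch e) M.
  case: hasP => [[m mM em]|_].
    rewrite size_filter /= leqNgt -has_count; apply/hasPn => a aq' /=.
    rewrite negbK; apply/negPn/negP => na; move: (na); rewrite /p => /asboolP; apply.
    exists m => //.
    by apply: conn_step (ce _ aq' na) _ em; apply: (allP oM).
  have := @apart_filter K q (predC p) aq.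
  have mf a : a \in filter (predC p) q -> conn K a e /\ outside K a.
    by rewrite mem_filter => /andP[/= np aq']; split; [apply: ce|apply: (allP oq)].
  case: (filter _ q) mf => [|a [|b q']] // mf [/(_ b)]; rewrite !inE eqxx => /(_ isT) nab.
  have [ae _] := mf a (mem_head _ _).
  have [be ob] : conn K b e /\ outside K b by apply: mf; rewrite !inE eqxx orbT.
  by case: nab; apply: conn_trans ae (conn_sym ob be).
by rewrite -(count_predC p q) -!size_filter addnC leq_add.
Qed.

Lemma grow_pieces K M m e : m \in M -> conn K m e -> all (outside K) M ->
  exists N, [/\ all (outside K) (N ++ M), e \in N ++ M & pieces (N ++ M) = pieces M].
Proof.
move=> mM me oM; elim: me => [|f g _ [N [oN fN jN]] og fg]; first by exists [::].
exists (g :: N); rewrite /= og oN mem_head; split => //.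
by have -> : has (touch g) (N ++ M) by apply/hasP; exists f; rewrite // touchC.
Qed.

(** An edge of [Q] in a component already met is joined to [M] by a path, which
    starts no new piece.  So the edges that start a piece lie in different
    components, all of which are infinite. *)
Lemma cover_by_pieces K k Q : no_finite_part K -> ends_at_most K k -> all (outside K) Q ->
  exists M, [/\ all (outside K) M, {subset Q <= M} & pieces M <= k].
Proof.
move=> nK ek oQ.
have [M [oM sM [J [sJ aJ szJ]]]] : exists M, [/\ all (outside K) M, {subset Q <= M} &
    exists J, [/\ {subset J <= M}, apart K J & size J = pieces M]].
  elim: Q oQ => [|e Q IH] /=; first by exists [::]; split => //; exists [::].
  case/andP=> oe /IH [M [oM sM [J [sJ aJ szJ]]]].
  have [[m mM me]|no] := pselect (exists2 m, m \in M & conn K m e).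
    have [N [oN eN jN]] := grow_pieces mM me oM.
    exists (N ++ M); split => //.
      move=> a; rewrite inE => /orP[/eqP->//|/sM aM].
      by rewrite mem_cat aM orbT.
    exists J; split; rewrite ?jN // => a /sJ aM.
    by rewrite mem_cat aM orbT.
  have nt : ~~ has (touch e) M.
    apply/hasPn => m mM; apply/negP => em; apply: no; exists m => //.
    by apply: conn_step (conn_refl _ _) oe _; rewrite touchC.
  exists (e :: M); rewrite /= oe oM nt; split => //.
    by move=> a; rewrite !inE => /orP[->//|/sM->]; rewrite orbT.
  exists (e :: J); split.
  - by move=> a; rewrite !inE => /orP[->//|/sJ->]; rewrite orbT.
  - split => // f /sJ fM ef; apply: no; exists f => //; exact: conn_sym ef.
  - by rewrite /= szJ.
exists M; split => //; rewrite -szJ; apply: ek => //.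
  by apply/allP => a /sJ/(allP oM).
by move=> a /sJ/(allP oM); apply: no_finite_part_infinite.
Qed.

(** A finite certificate for [no_finite_part U].  With [K := L ++ U], the last
    clause forces every component of [G - K] to meet [M], so that [G - K] has at
    most [k] components; when [K] is empty, it is [M != [::]] that makes [M]
    meet the single component of [G]. *)
Definition confirms k S U L M :=
  [&& chain U L, all (mem (L ++ U)) S, M != [::], all (outside (L ++ U)) M,
      pieces M <= k &
      all (fun e => all (fun v => saturated (L ++ U) v || has (fun m => inc m v) M)
                        [:: s e; d e]) (L ++ U)].

(** A finite part [F] of [G - K] would be a component besides the [k] infinite
    ones that [G - K] inherits from [G - S]: more components than pieces of [M].
    So [G - K] has no finite part, and [chain_sound] brings this down to
    [U]. *)
Lemma confirms_sound k S U L M q :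
  (forall e f, Ed e -> Ed f -> conn [::] e f) ->
  size q = k -> all (outside S) q -> apart S q -> (forall e, e \in q ->
    in_infinite_part S e) ->
  uniq U -> all Ed U -> confirms k S U L M -> no_finite_part U.
Proof.
move=> cG szq oq aq iq uU EU /and5P[cL sS M0 oM /andP[jM cov]].
apply: (chain_sound uU EU cL).
have /andP[uK EK] := chain_uniq uU EU cL.
set K := L ++ U in sS oM cov uK EK *.
(* follow a path of [G] from [e] to an edge of [K]: just before it first uses
   an edge of [K], it is at a vertex that [M] covers *)
have covK e : outside K e -> exists2 m, m \in M & conn K e m.
  move=> oe; have [K0|[k0 k0K]] : K = [::] \/ exists k0, k0 \in K.
  - by case: (K) => [|k0 K']; [left|right; exists k0; rewrite mem_head].
  - case: (M) M0 oM => // m M' _ /= /andP[om _]; exists m; first exact: mem_head.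
    by rewrite K0; apply: cG; [case/andP: oe|case/andP: om].
  have Ee : Ed e by case/andP: oe.
  have Ek0 := allP EK _ k0K.
  suff : (exists2 m, m \in M & conn K e m) \/ (outside K k0 /\ conn K e k0).
    by case=> // -[/andP[_ /negP]].
  elim: (cG e k0 Ee Ek0) => [|f g _ [h|[of_ ef]] og fg].
  - by right; split => //; apply: conn_refl.
  - by left.
  have [gK|gK] := boolP (g \in K); last first.
    have og' : outside K g by move: og; rewrite /outside => /andP[-> _].
    by right; split => //; apply: conn_step ef og' fg.
  left; have [v /andP[fv gv]] := touchP _ _ fg.
  have Eg := allP EK _ gK.
  have : saturated K v || has (fun m => inc m v) M.
    have := allP cov g gK; rewrite /= andbT => /andP[h1 h2].
    by move: gv; rewrite /inc => /orP[]/eqP<-.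
  case/orP=> [/(satP uK EK Eg gv) []|/hasP[m mM mv]]; first by exists f.
  exists m => //; apply: conn_step ef (allP oM m mM) _.
  exact: touch_inc fv mv.
move=> F F0 oF cF.
have subK e f : conn K e f -> conn S e f.
  elim=> [|a b _ ea ob ab]; first exact: conn_refl.
  apply: conn_step ea _ ab; move: ob; rewrite /outside => /andP[-> bK] /=.
  by apply: contra bK => /(allP sS).
(* representatives, avoiding [K] and [F], of the infinite components *)
have [q' [szq' oq' aq' nq']] : exists q', [/\ size q' = size q, all (outside K) q',
    (forall f, f \in q' -> exists2 e, e \in q & conn S e f) /\ apart K q' &
    forall f, f \in q' -> f \notin F].
  elim: q oq aq iq {szq} => [|e q IH] /=; first by exists [::].
  case/andP=> oe oq [ae aq] iq.
  have [|q' [szq' oq' [hq' aq'] nq']] := IH oq aq.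
    by move=> f fq; apply: iq; rewrite inE fq orbT.
  have [f ef fKF] : exists2 f, conn S e f & f \notin K ++ F.
    apply: contrapT => no; apply: (iq e (mem_head _ _)); exists (K ++ F) => f ef.
    by apply: contrapT => /negP h; apply: no; exists f.
  move: fKF; rewrite mem_cat negb_or => /andP[fK fF].
  have oSf := conn_outside oe ef.
  exists (f :: q'); rewrite /= szq' oq' andbT; split => //.
  - by move: oSf; rewrite /outside fK => /andP[->].
  - split; [|split] => //.
      move=> g; rewrite inE => /orP[/eqP->|/hq'[a aq'' ag]].
        by exists e => //; rewrite mem_head.
      by exists a => //; rewrite inE aq'' orbT.
    move=> g gq' /subK fg; have [a aq'' ag] := hq' g gq'.
    apply: (ae a aq''); apply: conn_trans ef _; apply: conn_trans fg _.
    by apply: conn_sym ag; apply: (allP oq).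
  - by move=> g; rewrite inE => /orP[/eqP->//|/nq'].
case: F F0 oF cF nq' => // f F _ /= /andP[of_ _] cF nq'.
have : size (f :: q') <= pieces M.
  apply: apart_pieces oM _ _ _.
  - by rewrite /= of_.
  - split; last by case: aq'.
    move=> g gq' fg; have := nq' g gq'.
    by rewrite (closed_conn cF (mem_head _ _) fg).
  - move=> e; rewrite inE => /orP[/eqP->|eq]; apply: covK => //.
    exact: (allP oq').
by rewrite /= szq' szq; move: jM; lia.
Qed.

(** [K] is [U] together with [S] and the finite pieces that [S] cuts off; [M]
    joins chosen edges, one at every vertex of [K] that is not exhausted. *)
Lemma confirms_complete k S U : (forall l, exists2 e, Ed e & e \notin l) ->
  (forall U', ends_at_most U' k) -> all Ed S ->
  uniq U -> all Ed U -> no_finite_part U -> exists L M, confirms k S U L M.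
Proof.
move=> infE ek ES uU EU nU.
have [B [uB oB cB nB]] := absorb S nU.
pose K' := undup ([seq e <- S | e \notin U] ++ B).
have oK' : all (outside U) K'.
  apply/allP => e; rewrite mem_undup mem_cat mem_filter => /orP[/andP[eU eS]|].
    by rewrite /outside eU (allP ES).
  by move=> /(allP oB)/outside_catl.
have [L pL cL] := chain_exists nU uU EU (undup_uniq _) oK'.
have /andP[uK EK] := chain_uniq uU EU cL.
have mK : U ++ S ++ B =i L ++ U.
  move=> e; rewrite !mem_cat (perm_mem pL) mem_undup mem_cat mem_filter.
  by case: (e \in U); case: (e \in S); case: (e \in B).
have nK := eq_no_finite_part mK nB.
set K := L ++ U in uK EK mK nK *.
pose vs := [seq s e | e <- K] ++ [seq d e | e <- K].
have [Q oQ hQ] : exists2 Q, all (outside K) Q &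
    forall v, v \in vs -> unsaturated K v -> has (fun m => inc m v) Q.
  elim: vs => [|v vs [Q oQ hQ]]; first by exists [::].
  have [[f of_ fv]|no] := pselect (unsaturated K v).
    exists (f :: Q); first by rewrite /= of_.
    move=> w; rewrite inE => /orP[/eqP->|wvs] ns /=; first by rewrite fv.
    by rewrite hQ ?orbT.
  by exists Q => // w; rewrite inE => /orP[/eqP ->|]; last exact: hQ.
have [e0 Ee0 e0K] := infE K.
have [|M [oM sM jM]] := @cover_by_pieces K k (e0 :: Q) nK (ek K).
  by rewrite /= oQ /outside Ee0 e0K.
exists L, M; rewrite /confirms cL oM jM /= -/K; apply/and3P; split.
- by apply/allP => e eS; rewrite /= -mK !mem_cat eS orbT.
- by have := sM e0 (mem_head _ _); case: (M).
apply/allP => e eK.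
have h v : inc e v -> saturated K v || has (fun m => inc m v) M.
  move=> ev; have Ee := allP EK e eK.
  case: (satP uK EK Ee ev) => //= /contrapT us.
  have /hasP[m mQ mv] : has (fun m => inc m v) Q.
    apply: hQ us; rewrite mem_cat; move: ev; rewrite /inc.
    by case/orP=> /eqP <-; rewrite map_f ?orbT.
  by apply/hasP; exists m => //; apply: sM; rewrite inE mQ orbT.
by rewrite !h ?inc_s ?inc_d.
Qed.

End Certificates.

End Multigraph.

(** * Closure properties of recursive functions *)

(** Functions of [n] arguments take lists, of which only those of length [n]
    matter: a variable is [nth 0 xs i], and binding one prepends it to [xs]. *)
Definition computable n (f : seq nat -> nat) : Prop :=
  exists p : recfun n, forall xs : n.-tuple nat, eval p xs (f xs).

Lemma computable_ext n f g : (forall xs, size xs = n -> f xs = g xs) ->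
  computable n f -> computable n g.
Proof. by move=> e [p hp]; exists p => xs; rewrite -e ?size_tuple. Qed.

Lemma computable_nth n i : i < n -> computable n (fun xs => nth 0 xs i).
Proof.
move=> lt; exists (Proj (Ordinal lt)) => xs.
by rewrite -(tnth_nth 0 xs (Ordinal lt)); apply: eval_proj.
Qed.

Lemma computable_comp n f (gs : seq (seq nat -> nat)) :
  computable (size gs) f -> (forall i, i < size gs ->
    computable n (nth (fun _ => 0) gs i)) ->
  computable n (fun xs => f [seq g xs | g <- gs]).
Proof.
move=> [p hp] hg; have [q hq] : {q : 'I_(size gs) -> recfun n &
    forall i (xs : n.-tuple nat), eval (q i) xs (nth (fun _ => 0) gs i xs)}.
  apply: (@boolp.choice _ _ (fun (i : 'I_(size gs)) q =>
      forall xs : n.-tuple nat, eval q xs (nth (fun _ => 0) gs i xs))).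
  by move=> i; exact: hg (ltn_ord i).
exists (Comp p q) => xs; have sz : size [seq g (xs : seq nat) | g <- gs] == size gs by
  rewrite size_map.
apply: (@eval_comp _ _ p q xs (Tuple sz)); last exact: hp.
move=> i; rewrite (tnth_nth 0) /= (nth_map (fun _ => 0)) //; exact: hq.
Qed.

Lemma computable1 n f g : computable 1 f -> computable n g ->
  computable n (fun xs => f [:: g xs]).
Proof. by move=> cf cg; apply: (@computable_comp n f [:: g]) => // -[]. Qed.

Lemma computable2 n f g h : computable 2 f -> computable n g -> computable n h ->
  computable n (fun xs => f [:: g xs; h xs]).
Proof. by move=> cf cg ch; apply: (@computable_comp n f [:: g; h]) => // -[|[]]. Qed.

Lemma computable3 n f g h k : computable 3 f -> computable n g -> computable n h ->
  computable n k -> computable n (fun xs => f [:: g xs; h xs; k xs]).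
Proof.
by move=> cf cg ch ck; apply: (@computable_comp n f [:: g; h; k]) => // -[|[|[]]].
Qed.

Lemma map_nth_proj (xs : seq nat) n : size xs = n ->
  [seq g xs | g <- mkseq (fun i (xs : seq nat) => nth 0 xs i) n] = xs.
Proof. by move=> <-; rewrite /mkseq -map_comp -[RHS](mkseq_nth 0). Qed.

Lemma computable_subst n f g : computable n.+1 f -> computable n g ->
  computable n (fun xs => f (g xs :: xs)).
Proof.
move=> cf cg; pose gs := g :: mkseq (fun i (xs : seq nat) => nth 0 xs i) n.
have szg : size gs = n.+1 by rewrite /= size_mkseq.
apply: (@computable_ext n (fun xs => f [seq h xs | h <- gs])).
  by move=> xs sz /=; rewrite map_nth_proj.
apply: computable_comp; rewrite szg // => -[//|i] lt.
rewrite /= nth_mkseq //; exact: computable_nth.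
Qed.

Lemma computable_behead n f : computable n f -> computable n.+1 (fun xs => f (behead xs)).
Proof.
move=> cf; pose gs := mkseq (fun i (xs : seq nat) => nth 0 xs i.+1) n.
have szg : size gs = n by rewrite size_mkseq.
apply: (@computable_ext _ (fun xs => f [seq h xs | h <- gs])).
  case=> // x xs [sz] /=; congr f.
  by rewrite /gs /mkseq -map_comp -[RHS](mkseq_nth 0) sz.
apply: computable_comp; rewrite szg // => i lt.
rewrite /= nth_mkseq //; exact: computable_nth.
Qed.

Lemma computable_iteri n k b st :
  computable n k -> computable n b -> computable n.+2 st ->
  computable n (fun xs => iteri (k xs) (fun m r => st [:: m, r & xs]) (b xs)).
Proof.
move=> ck [p hp] [q hq].
suff : computable n.+1 (fun ys => iteri (head 0 ys)
    (fun m r => st [:: m, r & behead ys]) (b (behead ys))).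
  by move/computable_subst => /(_ _ ck).
exists (PrimRec p q) => ys; case/tupleP: ys => m xs /=.
elim: m => [|m IH]; first exact: eval_rec0.
apply: eval_recS IH _; exact: hq.
Qed.

Lemma computable_const n c : computable n (fun _ => c).
Proof.
elim: c => [|c IH]; first by exists (Zero n) => xs; apply: eval_zero.
suff cS : computable 1 (fun xs => (nth 0 xs 0).+1) by apply: (computable1 cS IH).
exists Succ => xs; case/tupleP: xs => x xs; rewrite [xs]tuple0.
exact: eval_succ.
Qed.

Lemma computable_succ n f : computable n f -> computable n (fun xs => (f xs).+1).
Proof.
suff cS : computable 1 (fun xs => (nth 0 xs 0).+1) by move=> cf;
  apply: (computable1 cS cf).
exists Succ => xs; case/tupleP: xs => x xs; rewrite [xs]tuple0.
exact: eval_succ.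
Qed.

Section Arith.
Variables (n : nat) (f g : seq nat -> nat).
Hypotheses (cf : computable n f) (cg : computable n g).

Lemma computable_add : computable n (fun xs => f xs + g xs).
Proof.
apply: computable_ext (computable_iteri cf cg (st := fun ys => (nth 0 ys 1).+1) _).
  by move=> xs _; elim: (f xs) => //= m ->.
by apply: computable_succ; apply: computable_nth.
Qed.

Lemma computable_pred : computable n (fun xs => (f xs).-1).
Proof.
apply: computable_ext (computable_iteri cf (computable_const n 0) (st := fun ys =>
    nth 0 ys 0) _).
  by move=> xs _; case: (f xs).
exact: computable_nth.
Qed.

End Arith.

Lemma computable_sub n f g : computable n f -> computable n g ->
  computable n (fun xs => f xs - g xs).
Proof.
move=> cf cg.
apply: computable_ext (computable_iteri cg cf (st := fun ys => (nth 0 ys 1).-1) _).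
  by move=> xs _; elim: (g xs) => [|m /= ->]; rewrite ?subn0 ?subnS.
by apply: computable_pred; apply: computable_nth.
Qed.

Lemma computable_mul n f g : computable n f -> computable n g ->
  computable n (fun xs => f xs * g xs).
Proof.
move=> cf cg.
have cm : computable 2 (fun xs => nth 0 xs 0 * nth 0 xs 1).
  apply: computable_ext (@computable_iteri 2 (fun xs => nth 0 xs 0) (fun=> 0)
     (fun ys => nth 0 ys 3 + nth 0 ys 1) _ _ _).
  - by move=> xs _; elim: (nth 0 xs 0) => //= m ->; rewrite mulSn.
  - exact: computable_nth.
  - exact: computable_const.
  - by apply: computable_add; apply: computable_nth.
exact: (computable2 cm cf cg).
Qed.

Lemma computable_exp2 n f : computable n f -> computable n (fun xs => 2 ^ f xs).
Proof.
move=> cf.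
apply: computable_ext (computable_iteri cf (computable_const n 1)
   (st := fun ys => 2 * nth 0 ys 1) _).
  by move=> xs _; elim: (f xs) => //= m ->; rewrite expnS.
by apply: computable_mul; [exact: computable_const|exact: computable_nth].
Qed.

Lemma computable_neg n (b : seq nat -> bool) : computable n b ->
  computable n (fun xs => ~~ b xs).
Proof.
move=> cb; apply: computable_ext (computable_sub (computable_const n 1) cb).
by move=> xs _; case: (b xs).
Qed.

Lemma computable_and n (b c : seq nat -> bool) : computable n b -> computable n c ->
  computable n (fun xs => b xs && c xs).
Proof.
move=> cb cc; apply: computable_ext (computable_mul cb cc).
by move=> xs _; case: (b xs); case: (c xs).
Qed.

Lemma computable_or n (b c : seq nat -> bool) : computable n b -> computable n c ->
  computable n (fun xs => b xs || c xs).
Proof.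
move=> cb cc.
apply: computable_ext (computable_neg (computable_and (computable_neg cb)
    (computable_neg cc))).
by move=> xs _; rewrite negb_and !negbK.
Qed.

Lemma computable_le n f g : computable n f -> computable n g ->
  computable n (fun xs => f xs <= g xs).
Proof.
move=> cf cg; apply: computable_ext (computable_sub (computable_const n 1)
    (computable_sub cf cg)).
by move=> xs _; rewrite -subn_eq0; case: (_ - g xs).
Qed.

Lemma computable_eq n f g : computable n f -> computable n g ->
  computable n (fun xs => f xs == g xs).
Proof.
move=> cf cg; apply: computable_ext (computable_and (computable_le cf cg)
    (computable_le cg cf)).
by move=> xs _; rewrite eqn_leq.
Qed.

Lemma computable_if n (b : seq nat -> bool) f g : computable n b ->
  computable n f -> computable n g ->
  computable n (fun xs => if b xs then f xs else g xs).
Proof.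
move=> cb cf cg; apply: computable_ext (computable_add (computable_mul cb cf)
  (computable_mul (computable_neg cb) cg)).
by move=> xs _; case: (b xs); rewrite /= ?mul1n ?mul0n ?addn0.
Qed.

Lemma eval_mu_least n (f : seq nat -> nat) (p : recfun n.+1) (xs : n.-tuple nat) m :
  (forall k, k <= m -> eval p [tuple of k :: xs] (f (k :: xs))) ->
  f (m :: xs) = 0 -> (forall k, k < m -> f (k :: xs) <> 0) ->
  eval (Mu p) xs m.
Proof.
move=> hp f0 h; apply: (@eval_mu _ _ _ _ (fun k => (f (k :: xs)).-1)).
  move=> k lt; rewrite prednK ?lt0n; last by apply/eqP/h.
  exact/hp/ltnW.
by rewrite -f0; apply: hp.
Qed.

Lemma computable_search n (P : seq nat -> bool) : computable n.+1 P ->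
  (forall xs, size xs = n -> exists m, P (m :: xs)) ->
  exists2 g, computable n g & forall xs, size xs = n -> P (g xs :: xs).
Proof.
move=> /computable_neg[p hp] ex.
pose g xs := if pselect (exists m, P (m :: xs)) is left e then ex_minn e else 0.
have gP xs : size xs = n -> P (g xs :: xs) /\ forall k, k < g xs -> ~~ P (k :: xs).
  move=> sz; rewrite /g; case: pselect => [e|]; last by case: (ex xs sz) => m h [];
      exists m.
  case: ex_minnP => m Pm hm; split => // k; rewrite ltnNge; apply: contra; exact: hm.
exists g; last by move=> xs /gP[].
exists (Mu p) => xs; have [Pg lt] := gP xs (size_tuple xs).
apply: (@eval_mu_least _ (fun ys => ~~ P ys)) => [k _||k /lt ->] //; last by rewrite Pg.
exact: hp.
Qed.

(** A function with a recursive graph is recursive; this avoids programming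
    inverse functions such as the decoding of lists. *)
Lemma computable_graph n (P : seq nat -> bool) g : computable n.+1 P ->
  (forall xs m, size xs = n -> P (m :: xs) = (m == g xs)) -> computable n g.
Proof.
move=> cP h; have [|g' cg' hg'] := @computable_search n P cP.
  by move=> xs sz; exists (g xs); rewrite h ?eqxx.
apply: computable_ext cg' => xs sz; have := hg' xs sz.
by rewrite h // => /eqP.
Qed.

(** * Recursion on codes of lists *)

Notation code := CodeSeq.code.
Notation decode := CodeSeq.decode.

Lemma decode_cons x c : decode (2 ^ x * c.*2.+1) = x :: decode c.
Proof. by rewrite -[c in LHS]CodeSeq.decodeK -[_ * _]/(code (x :: decode c))
  CodeSeq.codeK. Qed.

Lemma code_eq0 c : (c == 0) = nilp (decode c).
Proof.
apply/eqP/nilP => [->//|h]; by rewrite -[c]CodeSeq.decodeK h.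
Qed.

Lemma computable_cons n f g : computable n f -> computable n g ->
  computable n (fun xs => code (f xs :: decode (g xs))).
Proof.
move=> cf cg; have cd : computable n (fun xs => (g xs).*2.+1).
  apply: computable_succ; apply: computable_ext (computable_add cg cg).
  by move=> xs _; rewrite addnn.
apply: computable_ext (computable_mul (computable_exp2 cf) cd).
by move=> xs _; rewrite -decode_cons CodeSeq.decodeK.
Qed.

Lemma computable_reindex n k f (idx : seq nat) : size idx = k ->
  all (fun i => i < n) idx -> computable k f ->
  computable n (fun xs => f [seq nth 0 xs i | i <- idx]).
Proof.
move=> <- /allP lt cf; pose gs := [seq (fun xs : seq nat => nth 0 xs i) | i <- idx].
apply: (@computable_ext _ (fun xs => f [seq g xs | g <- gs])).
  by move=> xs _; rewrite -map_comp.
apply: computable_comp; rewrite size_map // => i lti.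
by rewrite (nth_map 0) //; apply/computable_nth/lt/mem_nth.
Qed.

Lemma computable_bounded_ex n k (P : seq nat -> bool) :
  computable n k -> computable n.+1 P ->
  computable n (fun xs => has (fun i => P (i :: xs)) (iota 0 (k xs))).
Proof.
move=> ck cP; pose st ys := maxn (P (head 0 ys :: drop 2 ys)) (nth 0 ys 1).
apply: (@computable_ext _ (fun xs => iteri (k xs) (fun m r => st [:: m, r & xs]) 0)).
  move=> xs _; elim: (k xs) => // m IH.
  rewrite -[in iota 0 m.+1]addn1 iotaD has_cat /= IH /st /= drop0 orbF.
  by case: (P _); case: has.
apply: computable_iteri => //; first exact: computable_const.
have c : computable n.+2 (fun ys => P (head 0 ys :: drop 2 ys)).
  apply: (@computable_ext _ (fun ys => P [seq nth 0 ys i | i <- 0 :: iota 2 n])).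
    case=> [|a [|b ys]] //= [sz]; rewrite drop0 (iotaDl 2 0) -map_comp.
    by rewrite -[ys in RHS](mkseq_nth 0) sz.
  apply: (@computable_reindex n.+2 n.+1 (fun xs => P xs) (0 :: iota 2 n)) => //.
    by rewrite /= size_iota.
  by apply/allP => i; rewrite inE mem_iota => /orP[/eqP->|] //; lia.
have c1 : computable n.+2 (fun ys => nth 0 ys 1) by exact: computable_nth.
apply: computable_ext (computable_add c (computable_sub c1 c)).
by move=> ys _; rewrite /st maxnE.
Qed.

Lemma code_cons_ltn x c : x < 2 ^ x * c.*2.+1.
Proof.
by apply: leq_trans (ltn_expl x (ltnSn 1)) _; rewrite leq_pmulr.
Qed.

(** The graph of the tail: for a nonempty list the head is searched for below
    the code. *)
Lemma computable_tail : computable 1 (fun xs => code (behead (decode (nth 0 xs 0)))).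
Proof.
pose P (ys : seq nat) := (nth 0 ys 1 == 0) && (nth 0 ys 0 == 0) ||
  has (fun h => nth 0 (h :: ys) 2 ==
    2 ^ nth 0 (h :: ys) 0 * (nth 0 (h :: ys) 1 + nth 0 (h :: ys) 1).+1) (iota 0 (nth 0
      ys 1)).
apply: (@computable_graph _ P).
  apply: computable_or.
    by apply: computable_and; apply: computable_eq;
       first [exact: computable_nth | exact: computable_const].
  apply: (@computable_bounded_ex 2 _ (fun ys => nth 0 ys 2 ==
    2 ^ nth 0 ys 0 * (nth 0 ys 1 + nth 0 ys 1).+1)); first exact: computable_nth.
  apply: computable_eq; first exact: computable_nth.
  apply: computable_mul; first by apply: computable_exp2; exact: computable_nth.
  by apply: computable_succ; apply: computable_add; exact: computable_nth.
case=> // c [|//] m _; rewrite /P /=.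
apply/orP/eqP => [[/andP[/eqP-> /eqP->]//|/hasP[h _ /eqP->]]|->].
  by rewrite addnn decode_cons /= CodeSeq.decodeK.
rewrite -[c]CodeSeq.decodeK; case: (decode c) => [|h t]; first by left.
right; apply/hasP; exists h.
  by rewrite mem_iota /= code_cons_ltn.
by rewrite CodeSeq.codeK /= addnn.
Qed.

Lemma computable_head : computable 1 (fun xs => head 0 (decode (nth 0 xs 0))).
Proof.
pose tl (ys : seq nat) := code (behead (decode (nth 0 ys 1))).
have ct : computable 2 tl.
  by apply: (computable1 computable_tail); apply: computable_nth.
pose P (ys : seq nat) := (nth 0 ys 1 == 0) && (nth 0 ys 0 == 0) ||
  (nth 0 ys 1 == 2 ^ nth 0 ys 0 * (tl ys + tl ys).+1).
apply: (@computable_graph _ P).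
  apply: computable_or.
    by apply: computable_and; apply: computable_eq;
       first [exact: computable_nth | exact: computable_const].
  apply: computable_eq; first exact: computable_nth.
  apply: computable_mul; first by apply: computable_exp2; exact: computable_nth.
  by apply: computable_succ; apply: computable_add.
case=> // c [|//] m _; rewrite /P /tl /=.
rewrite -[c]CodeSeq.decodeK; case: (decode c) => [|h t] //=.
  by rewrite [0 == _]eq_sym muln_eq0 expn_eq0 /= orbF.
rewrite decode_cons /= CodeSeq.decodeK addnn muln_eq0 expn_eq0 /=.
by rewrite eqn_pmul2r // eqn_exp2l // eq_sym.
Qed.

Lemma computable_drop n f g : computable n f -> computable n g ->
  computable n (fun xs => code (drop (f xs) (decode (g xs)))).
Proof.
move=> cf cg; apply: computable_ext (computable_iteri cf cg
  (st := fun ys => code (behead (decode (nth 0 ys 1)))) _).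
  move=> xs _; elim: (f xs) => [|m /= ->]; first by rewrite drop0 CodeSeq.decodeK.
  by rewrite CodeSeq.codeK -drop1 drop_drop.
by apply: (computable1 computable_tail); apply: computable_nth.
Qed.

Lemma computable_nth_decode n f g : computable n f -> computable n g ->
  computable n (fun xs => nth 0 (decode (g xs)) (f xs)).
Proof.
move=> cf cg; apply: computable_ext (computable1 computable_head (computable_drop cf cg)).
by move=> xs _ /=; rewrite CodeSeq.codeK -nth0 nth_drop addn0.
Qed.

Lemma computable_size n f : computable n f ->
  computable n (fun xs => size (decode (f xs))).
Proof.
suff cs : computable 1 (fun xs => size (decode (nth 0 xs 0))).
  by move=> cf; apply: (computable1 cs cf).
pose dr k (ys : seq nat) := code (drop k (decode (nth 0 ys 1))).
apply: (@computable_graph _ (fun ys => (dr (nth 0 ys 0) ys == 0) &&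
   ((nth 0 ys 0 == 0) || ~~ (dr (nth 0 ys 0).-1 ys == 0)))).
  have c0 := @computable_nth 2 0 isT; have c1 := @computable_nth 2 1 isT.
  have z := computable_const 2 0.
  apply: computable_and; first by apply: computable_eq => //; apply: computable_drop.
  apply: computable_or; first exact: computable_eq.
  apply: computable_neg; apply: computable_eq => //; apply: computable_drop => //.
  exact: computable_pred.
case=> // c [|//] m _; rewrite /dr /= !(code_eq0 (code _)) !CodeSeq.codeK /nilp
  !size_drop.
by case: m => [|m]; rewrite /= ?subn0; lia.
Qed.

(** The step sees the tail as well, as the clauses of [uniq], [chain] and
    [pieces] require. *)
Fixpoint para (z : nat) (st : nat -> seq nat -> nat -> nat) (l : seq nat) : nat :=
  if l is x :: l' then st x l' (para z st l') else z.

(** The recursion runs over the suffixes of the list, from the shortest one. *)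
Lemma computable_para n z st l : computable n z -> computable n.+3 st ->
  computable n l ->
  computable n (fun xs => para (z xs) (fun x l' r => st [:: x, code l', r & xs])
                               (decode (l xs))).
Proof.
move=> cz cst cl.
suff cp : computable n.+1 (fun ys => para (z (behead ys))
    (fun x l' r => st [:: x, code l', r & behead ys]) (decode (head 0 ys))).
  exact: computable_subst cp cl.
pose i (ys : seq nat) := size (decode (nth 0 ys 2)) - (nth 0 ys 0).+1.
pose st' ys := st [:: nth 0 (decode (nth 0 ys 2)) (i ys),
   code (drop (i ys).+1 (decode (nth 0 ys 2))), nth 0 ys 1 & drop 3 ys].
apply: (@computable_ext _ (fun ys => iteri (size (decode (head 0 ys)))
   (fun m r => st' [:: m, r & ys]) (z (behead ys)))).
  case=> // c xs _; rewrite /= /st' /i /= drop0; set L := decode c.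
  suff h m : m <= size L -> iteri m (fun m0 r => st
      [:: nth 0 L (size L - m0.+1), code (drop (size L - m0.+1).+1 L), r & xs]) (z xs) =
      para (z xs) (fun x l' r => st [:: x, code l', r & xs]) (drop (size L - m) L).
    by rewrite h // subnn drop0.
  elim: m => [|m IH] lt; first by rewrite subn0 drop_size.
  rewrite [LHS]/= IH 1?ltnW // [in RHS](drop_nth 0) /=; last by lia.
  by rewrite (_ : (size L - m.+1).+1 = size L - m) //; lia.
have c0 := @computable_nth n.+3 0 isT; have c1 := @computable_nth n.+3 1 isT.
have c2 := @computable_nth n.+3 2 isT.
apply: computable_iteri.
- apply: computable_size; apply: computable_ext (@computable_nth n.+1 0 isT).
  by move=> xs _; rewrite nth0.
- exact: computable_behead.
have ci : computable n.+3 i.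
  by apply: computable_sub; [apply: computable_size|apply: computable_succ].
pose gs := [:: (fun ys => nth 0 (decode (nth 0 ys 2)) (i ys)),
   (fun ys => code (drop (i ys).+1 (decode (nth 0 ys 2)))),
   (fun ys => nth 0 ys 1) & mkseq (fun k ys => nth 0 ys k.+3) n].
have szg : size gs = n.+3 by rewrite /= size_mkseq.
apply: (@computable_ext _ (fun ys => st [seq g ys | g <- gs])).
  move=> ys sz; rewrite /st' /=; congr (st [:: _, _, _ & _]).
  rewrite /mkseq -map_comp; case: ys sz => [|? [|? [|? ys]]] // [sz].
  by rewrite /= drop0 -[RHS](mkseq_nth 0) sz.
apply: computable_comp; rewrite szg // => -[|[|[|k]]] lt //=.
- exact: computable_nth_decode.
- by apply: computable_drop => //; apply: computable_succ.
- by rewrite nth_mkseq //; apply: computable_nth.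
Qed.

Lemma computable_skip n f : computable n.+1 f ->
  computable n.+3 (fun ys => f (nth 0 ys 0 :: drop 3 ys)).
Proof.
move=> cf; apply: (@computable_ext _ (fun ys => f [seq nth 0 ys i | i <- 0 :: iota 3 n])).
  case=> [|a [|b [|c ys]]] //= [sz]; rewrite drop0 (iotaDl 3 0) -map_comp.
  by rewrite -[ys in RHS](mkseq_nth 0) sz.
apply: (@computable_reindex n.+3 n.+1 f (0 :: iota 3 n)) => //.
  by rewrite /= size_iota.
by apply/allP => i; rewrite inE mem_iota => /orP[/eqP->|] //; lia.
Qed.

Lemma computable_all n l (P : seq nat -> bool) : computable n.+1 P -> computable n l ->
  computable n (fun xs => all (fun x => P (x :: xs)) (decode (l xs))).
Proof.
move=> cP cl; pose st ys := P (nth 0 ys 0 :: drop 3 ys) * nth 0 ys 2.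
apply: (@computable_ext _ (fun xs => para 1 (fun x l' r =>
    st [:: x, code l', r & xs]) (decode (l xs)))).
  move=> xs _; elim: (decode (l xs)) => //= x l' ->; rewrite /st /= drop0.
  by case: (P _); case: all.
apply: computable_para => //; first exact: computable_const.
by apply: computable_mul; [exact: (@computable_skip n (fun ys =>
    P ys))|exact: computable_nth].
Qed.

Lemma computable_has n l (P : seq nat -> bool) : computable n.+1 P -> computable n l ->
  computable n (fun xs => has (fun x => P (x :: xs)) (decode (l xs))).
Proof.
move=> cP cl; apply: computable_ext (computable_neg (computable_all (computable_neg cP)
    cl)).
by move=> xs _; rewrite -has_predC; congr (nat_of_bool _); apply: eq_has => x /=;
    rewrite negbK.
Qed.

Lemma computable_mem n f l : computable n f -> computable n l ->
  computable n (fun xs => f xs \in decode (l xs)).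
Proof.
have c : computable 2 (fun xs => nth 0 xs 0 \in decode (nth 0 xs 1)).
  apply: computable_ext (@computable_has 2 (fun xs => nth 0 xs 1)
    (fun ys => nth 0 ys 0 == nth 0 ys 1) _ _).
  - by move=> xs _; rewrite -has_pred1.
  - by apply: computable_eq; apply: computable_nth.
  - exact: computable_nth.
by move=> cf cl; apply: (computable2 c cf cl).
Qed.

Lemma computable_cat n f g : computable n f -> computable n g ->
  computable n (fun xs => code (decode (f xs) ++ decode (g xs))).
Proof.
move=> cf cg; apply: (@computable_ext _ (fun xs => para (g xs)
   (fun x l' r => (fun ys => code (nth 0 ys 0 :: decode (nth 0 ys 2))) [:: x, code l',
     r & xs]) (decode (f xs)))).
  move=> xs _; elim: (decode (f xs)) => [|x l' /= ->];
      first by rewrite /= CodeSeq.decodeK.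
  by rewrite CodeSeq.codeK.
apply: (@computable_para n g (fun ys => code (nth 0 ys 0 :: decode (nth 0 ys 2))) f) =>
    //.
by apply: computable_cons; exact: computable_nth.
Qed.

Lemma computable_uniq n f : computable n f ->
  computable n (fun xs => uniq (decode (f xs))).
Proof.
move=> cf; pose st ys := ~~ (nth 0 ys 0 \in decode (nth 0 ys 1)) * nth 0 ys 2.
apply: (@computable_ext _ (fun xs => para 1 (fun x l' r =>
    st [:: x, code l', r & xs]) (decode (f xs)))).
  move=> xs _; elim: (decode (f xs)) => //= x l' ->; rewrite /st /= CodeSeq.codeK.
  by case: (x \in l'); case: uniq.
apply: computable_para => //; first exact: computable_const.
apply: computable_mul; last exact: computable_nth.
by apply: computable_neg; apply: computable_mem; exact: computable_nth.
Qed.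

(** * Checking certificates is recursive *)

Section Checks.
Variables (Ed : pred nat) (s d degc : nat -> nat).
Hypothesis cEd : computable 1 (fun xs => Ed (nth 0 xs 0)).
Hypothesis cs : computable 1 (fun xs => s (nth 0 xs 0)).
Hypothesis cd : computable 1 (fun xs => d (nth 0 xs 0)).
Hypothesis cdeg : computable 1 (fun xs => degc (nth 0 xs 0)).

Lemma computable_Ed n f : computable n f -> computable n (fun xs => Ed (f xs)).
Proof. exact: (computable1 cEd). Qed.
Lemma computable_s n f : computable n f -> computable n (fun xs => s (f xs)).
Proof. exact: (computable1 cs). Qed.
Lemma computable_d n f : computable n f -> computable n (fun xs => d (f xs)).
Proof. exact: (computable1 cd). Qed.

Lemma computable_inc n f g : computable n f -> computable n g ->
  computable n (fun xs => inc s d (f xs) (g xs)).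
Proof.
move=> cf cg; apply: computable_or; apply: computable_eq => //.
  exact: computable_s.
exact: computable_d.
Qed.

Lemma computable_touch n f g : computable n f -> computable n g ->
  computable n (fun xs => touch s d (f xs) (g xs)).
Proof.
move=> cf cg; apply: computable_or; apply: computable_inc => //.
  exact: computable_s.
exact: computable_d.
Qed.

Lemma computable_deg_in n f g : computable n f -> computable n g ->
  computable n (fun xs => deg_in s d (decode (f xs)) (g xs)).
Proof.
have c : computable 2 (fun xs => deg_in s d (decode (nth 0 xs 0)) (nth 0 xs 1)).
  pose st ys := (s (nth 0 ys 0) == nth 0 ys 4) + (d (nth 0 ys 0) == nth 0 ys 4) + nth 0
      ys 2.
  apply: (@computable_ext _ (fun xs => para 0 (fun x l' r =>
      st [:: x, code l', r & xs]) (decode (nth 0 xs 0)))).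
    move=> xs _; elim: (decode _) => [|x l /= ->]; first by rewrite /deg_in big_nil.
    by rewrite deg_in_cons.
  apply: computable_para; [exact: computable_const| |exact: computable_nth].
  apply: computable_add; last exact: computable_nth.
  apply: computable_add; apply: computable_eq; try exact: computable_nth.
    by apply: computable_s; exact: computable_nth.
  by apply: computable_d; exact: computable_nth.
by move=> cf cg; apply: (computable2 c cf cg).
Qed.

Lemma computable_saturated n f g : computable n f -> computable n g ->
  computable n (fun xs => saturated s d degc (decode (f xs)) (g xs)).
Proof.
move=> cf cg; apply: computable_eq; first exact: (computable1 cdeg).
by apply: computable_succ; apply: computable_deg_in.
Qed.

Lemma computable_refutes n f g : computable n f -> computable n g ->
  computable n (fun xs => refutes Ed s d degc (decode (f xs)) (decode (g xs))).
Proof.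
have c : computable 2 (fun xs =>
    refutes Ed s d degc (decode (nth 0 xs 0)) (decode (nth 0 xs 1))).
  have p0 n' : computable n'.+1 (fun xs => nth 0 xs 0) by exact: computable_nth.
  have p1 n' : computable n'.+2 (fun xs => nth 0 xs 1) by exact: computable_nth.
  have p2 n' : computable n'.+3 (fun xs => nth 0 xs 2) by exact: computable_nth.
  have K := computable_cat (p0 1) (p1 0).
  have K' := computable_cat (p1 1) (p2 0).
  apply: computable_and.
    apply: computable_ext (computable_neg (computable_eq (p1 0) (computable_const 2 0))).
    by move=> xs _; rewrite code_eq0 /nilp size_eq0.
  apply: computable_and.
    by apply: computable_ext (computable_uniq K) => xs _; rewrite CodeSeq.codeK.
  apply: computable_and.
    exact: (@computable_all 2 _ (fun ys =>
        Ed (nth 0 ys 0)) (computable_Ed (p0 2)) (p1 0)).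
  apply: (@computable_all 2 (fun xs => nth 0 xs 1) (fun ys =>
    saturated s d degc (decode (nth 0 ys 1) ++ decode (nth 0 ys 2)) (s (nth 0 ys 0)) &&
    saturated s d degc (decode (nth 0 ys 1) ++ decode (nth 0 ys 2)) (d (nth 0 ys 0))))
      => //.
  apply: computable_and.
    apply: computable_ext (computable_saturated K' (computable_s (p0 2))) => xs _.
    by rewrite CodeSeq.codeK.
  apply: computable_ext (computable_saturated K' (computable_d (p0 2))) => xs _.
  by rewrite CodeSeq.codeK.
by move=> cf cg; apply: (computable2 c cf cg).
Qed.

Lemma computable_chain n f g : computable n f -> computable n g ->
  computable n (fun xs => chain Ed s d degc (decode (f xs)) (decode (g xs))).
Proof.
have c : computable 2 (fun xs =>
    chain Ed s d degc (decode (nth 0 xs 0)) (decode (nth 0 xs 1))).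
  have p i : i < 5 -> computable 5 (fun xs => nth 0 xs i) by exact: computable_nth.
  pose X ys := code (decode (nth 0 ys 1) ++ decode (nth 0 ys 3)).
  pose eX ys := code (nth 0 ys 0 :: decode (X ys)).
  have cX : computable 5 X by apply: computable_cat; apply: p.
  have ceX : computable 5 eX by apply: computable_cons => //; apply: p.
  pose st ys := nth 0 ys 2 * [&& Ed (nth 0 ys 0), nth 0 ys 0 \notin decode (X ys) &
    ~~ (saturated s d degc (decode (eX ys)) (s (nth 0 ys 0)) &&
      saturated s d degc (decode (eX ys)) (d (nth 0 ys 0)))].
  apply: (@computable_ext _ (fun xs => para 1 (fun x l' r =>
      st [:: x, code l', r & xs]) (decode (nth 0 xs 1)))).
    move=> xs _; elim: (decode (nth 0 xs 1)) => //= x l ->.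
    rewrite /st /eX /X /= !decode_cons !CodeSeq.codeK.
    by case: chain; rewrite ?mul1n ?mul0n.
  apply: computable_para; [exact: computable_const| |exact: computable_nth].
  apply: computable_mul; first exact: p.
  apply: computable_and; first by apply: computable_Ed; apply: p.
  apply: computable_and; first by apply: computable_neg; apply: computable_mem => //;
      apply: p.
  apply: computable_neg; apply: computable_and; apply: computable_saturated => //.
    by apply: computable_s; apply: p.
  by apply: computable_d; apply: p.
by move=> cf cg; apply: (computable2 c cf cg).
Qed.

Lemma computable_pieces n f : computable n f ->
  computable n (fun xs => pieces s d (decode (f xs))).
Proof.
have c : computable 1 (fun xs => pieces s d (decode (nth 0 xs 0))).
  pose st ys := ~~ has (fun e =>
      touch s d (nth 0 ys 0) e) (decode (nth 0 ys 1)) + nth 0 ys 2.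
  apply: (@computable_ext _ (fun xs => para 0 (fun x l' r =>
      st [:: x, code l', r & xs]) (decode (nth 0 xs 0)))).
    move=> xs _; elim: (decode (nth 0 xs 0)) => //= x l ->.
    by rewrite /st /= CodeSeq.codeK.
  apply: computable_para; [exact: computable_const| |exact: computable_nth].
  apply: computable_add; last exact: computable_nth.
  apply: computable_neg.
  apply: (@computable_has 4 (fun ys => nth 0 ys 1) (fun zs =>
      touch s d (nth 0 zs 1) (nth 0 zs 0))).
    by apply: computable_touch; exact: computable_nth.
  exact: computable_nth.
by move=> cf; apply: (computable1 c cf).
Qed.

Lemma computable_confirms k S n f g h : computable n f -> computable n g ->
  computable n h ->
  computable n (fun xs => confirms Ed s d degc k S (decode (f xs)) (decode (g xs))
    (decode (h xs))).
Proof.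
have c : computable 3 (fun xs => confirms Ed s d degc k S
    (decode (nth 0 xs 0)) (decode (nth 0 xs 1)) (decode (nth 0 xs 2))).
  have p0 n' : computable n'.+1 (fun xs => nth 0 xs 0) by exact: computable_nth.
  have p1 n' : computable n'.+2 (fun xs => nth 0 xs 1) by exact: computable_nth.
  have p2 n' : computable n'.+3 (fun xs => nth 0 xs 2) by exact: computable_nth.
  have p3 n' : computable n'.+4 (fun xs => nth 0 xs 3) by exact: computable_nth.
  pose K (xs : seq nat) := code (decode (nth 0 xs 1) ++ decode (nth 0 xs 0)).
  have cK n' : computable n'.+2 K by exact: computable_cat.
  pose Kb (xs : seq nat) := code (decode (nth 0 xs 2) ++ decode (nth 0 xs 1)).
  have cKb n' : computable n'.+3 Kb by exact: computable_cat.
  apply: computable_and; first exact: computable_chain.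
  apply: computable_and.
    have cS := computable_const 3 (code S).
    apply: computable_ext (@computable_all 3 _ (fun ys => nth 0 ys 0 \in decode (Kb ys))
      (computable_mem (p0 3) (cKb 1)) cS).
    move=> xs _; rewrite CodeSeq.codeK; congr (nat_of_bool _); apply: eq_all => e.
    by rewrite /Kb /= CodeSeq.codeK.
  apply: computable_and.
    apply: computable_ext (computable_neg (computable_eq (p2 0) (computable_const 3 0))).
    by move=> xs _; rewrite code_eq0 /nilp size_eq0.
  apply: computable_and.
    have cP : computable 4 (fun ys =>
        Ed (nth 0 ys 0) && (nth 0 ys 0 \notin decode (Kb ys))).
      apply: computable_and; first exact: computable_Ed.
      by apply: computable_neg; apply: computable_mem.
    apply: computable_ext (computable_all cP (p2 0)).
    move=> xs _; congr (nat_of_bool _); apply: eq_all => e.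
    by rewrite /Kb /= CodeSeq.codeK.
  apply: computable_and.
    apply: computable_le; last exact: computable_const.
    exact: computable_pieces.
  have cv n' f' g' h' : computable n' f' -> computable n' g' -> computable n' h' ->
    computable n' (fun ys => saturated s d degc (decode (f' ys)) (g' ys) ||
      has (fun m => inc s d m (g' ys)) (decode (h' ys))).
    have cv : computable 3 (fun ys =>
        saturated s d degc (decode (nth 0 ys 0)) (nth 0 ys 1) ||
      has (fun m => inc s d m (nth 0 ys 1)) (decode (nth 0 ys 2))).
      apply: computable_or; first exact: computable_saturated.
      apply: (@computable_has 3 (fun ys => nth 0 ys 2) (fun ys =>
          inc s d (nth 0 ys 0) (nth 0 ys 2))) => //.
      exact: computable_inc.
    by move=> cf cg ch; apply: (computable3 cv cf cg ch).
  have cP : computable 4 (fun ys => let v := s (nth 0 ys 0) in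
      (saturated s d degc (decode (Kb ys)) v || has (fun m =>
        inc s d m v) (decode (nth 0 ys 3))) &&
      let v := d (nth 0 ys 0) in
      (saturated s d degc (decode (Kb ys)) v || has (fun m =>
        inc s d m v) (decode (nth 0 ys 3)))).
    apply: computable_and; apply: cv => //; first exact: computable_s.
    exact: computable_d.
  apply: computable_ext (computable_all cP (cK 1)).
  move=> xs _; rewrite /K CodeSeq.codeK; congr (nat_of_bool _); apply: eq_all => e.
  by rewrite /= andbT.
by move=> cf cg ch; apply: (computable3 c cf cg ch).
Qed.

End Checks.

(** * Deciding by searching for certificates *)

(** Search for a certificate of either kind, then see which kind was found. *)
Lemma decidable_by_search T (D : T -> Prop) (cod : T -> nat) (Q : T -> Prop)
    (P N : seq nat -> bool) :
  computable 2 P -> computable 2 N ->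
  (forall x, D x -> (Q x <-> exists z, P [:: z; cod x]) /\
                    (~ Q x <-> exists z, N [:: z; cod x])) ->
  algorithmically_decidable D cod Q.
Proof.
move=> cP cN h; have [pR hR] := computable_neg (computable_or cP cN).
have [pP hP] := cP.
exists (Comp pP (fun i : 'I_2 => if i == 0 :> nat then Mu pR else Proj ord0)) => x Dx.
have [hQ hNQ] := h x Dx.
have ex : exists z, P [:: z; cod x] || N [:: z; cod x].
  have [/hQ[z Pz]|/hNQ[z Nz]] := pselect (Q x); exists z; first by rewrite Pz.
  by rewrite Nz orbT.
have eM : eval (Mu pR) [tuple cod x] (ex_minn ex).
  case: ex_minnP => z Pz hz.
  apply: (@eval_mu_least _ (fun ys => ~~ (P ys || N ys))) => [k _||k lt]; first exact: hR.
    by rewrite Pz.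
  by case: (boolP (P _ || N _)) => // /hz; rewrite leqNgt lt.
have -> : `[< Q x >] = P [:: ex_minn ex; cod x].
  case: ex_minnP => z Pz _; apply/asboolP/idP => [Qx|Pz'].
    have : ~ N [:: z; cod x] by move=> Nz; suff : ~ Q x by []; apply/hNQ; exists z.
    by case/orP: Pz.
  by apply/hQ; exists z.
apply: (@eval_comp _ _ _ _ _ [tuple ex_minn ex; cod x]); last exact: hP.
case=> -[|[|//]] lt; rewrite (tnth_nth 0) /=; first exact: eM.
exact: (@eval_proj 1 ord0 [tuple cod x]).
Qed.

Lemma decidable_rel_computable n (A : set (n.-tuple nat)) (B : seq nat -> Prop) :
  (forall xs : n.-tuple nat, A xs <-> B xs) -> decidable_rel A ->
  computable n (fun xs => `[< B xs >]).
Proof.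
move=> AB [p hp]; exists p => xs; have := hp xs.
by rewrite (_ : `[< A xs >] = `[< B xs >]) //; apply/asbool_equiv_eq.
Qed.

(** The ends of an edge are found by search in the incidence relation.  Searching
    and the given degree program only behave well on codes of edges and of
    vertices; the functions are made total by deciding first whether the
    argument is such a code, and replacing it by a fixed one if it is not. *)
Lemma computable_model (V E : Type) (G : graph V E) (iV : V -> nat) (iE : E -> nat) v0 :
  moderately_computable_graph iV iE G -> vset G v0 ->
  exists (Ed : pred nat) (s d degc : nat -> nat),
  [/\ computable 1 (fun xs => Ed (nth 0 xs 0)), computable 1 (fun xs => s (nth 0 xs 0)),
      computable 1 (fun xs => d (nth 0 xs 0)) & computable 1 (fun xs =>
        degc (nth 0 xs 0))] /\
  [/\ forall c, Ed c <-> exists2 e, eset G e & iE e = c,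
      forall e, eset G e ->
        exists u v, [/\ joins G e u v, s (iE e) = iV u & d (iE e) = iV v] &
      forall x, vset G x -> degc (iV x) = code_degree (degree G x)].
Proof.
move=> [[[injV injE] dV dE _ dJ] [p hp]] v0G.
have cV : computable 1 (fun xs => `[< exists2 v, vset G v & iV v = nth 0 xs 0 >]).
  apply: decidable_rel_computable dV => xs; split=> -[v vG e]; exists v => //.
    by rewrite e.
  by apply: val_inj => /=; case/tupleP: xs e => x xs /= ->; rewrite [xs]tuple0.
pose Ed c := `[< exists2 e, eset G e & iE e = c >].
have cE : computable 1 (fun xs => Ed (nth 0 xs 0)).
  apply: decidable_rel_computable dE => xs; split=> -[v vG e]; exists v => //.
    by rewrite e.
  by apply: val_inj => /=; case/tupleP: xs e => x xs /= ->; rewrite [xs]tuple0.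
pose J xs := exists e u v, joins G e u v /\ xs = [:: iE e; iV u; iV v].
have cJ : computable 3 (fun xs => `[< J xs >]).
  apply: decidable_rel_computable dJ => xs; split=> -[e [u [v [j h]]]]; exists e, u, v;
      split => //.
    by rewrite h.
  exact: val_inj.
pose P ys := ~~ Ed (nth 0 ys 1) || `[< J [:: nth 0 ys 1; nth 0 (decode (nth 0 ys 0)) 0;
                                         nth 0 (decode (nth 0 ys 0)) 1] >].
have cP : computable 2 P.
  have p0 := @computable_nth 2 0 isT; have p1 := @computable_nth 2 1 isT.
  apply: computable_or; first by apply: computable_neg; apply: (computable1 cE p1).
  apply: (computable3 cJ p1); apply: computable_nth_decode => //; exact: computable_const.
have [|g cg hg] := @computable_search 1 P cP.
  case=> // c [|//] _; rewrite /P /=.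
  have [Ec|] := boolP (Ed c); last by exists 0.
  have [e [u [v j]] <-] : exists2 e, eset G e & iE e = c by apply/asboolP.
  by exists (code [:: iV u; iV v]); apply/asboolP; rewrite CodeSeq.codeK; exists e, u, v.
pose s c := nth 0 (decode (g [:: c])) 0; pose d c := nth 0 (decode (g [:: c])) 1.
pose vx x : V := if pselect (exists v, vset G v /\
    iV v = x) is left h then projT1 (cid h) else v0.
have vxP x : vset G (vx x) /\ (forall v, vset G v -> iV v = x -> vx x = v).
  rewrite /vx; case: pselect => [h|no].
    case: (cid h) => w /= [wG wx]; split=> // v vG vx'; apply: injV; rewrite ?inE //.
    by rewrite wx.
  by split => // v vG vx'; case: no; exists v.
pose degc x := code_degree (degree G (vx x)).
have c0 := @computable_nth 1 0 isT.
have cg' : computable 1 (fun xs => g [:: nth 0 xs 0]).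
  by apply: computable_ext cg => -[|x [|]].
exists Ed, s, d, degc; split; split => //.
- by apply: computable_nth_decode => //; apply: computable_const.
- by apply: computable_nth_decode => //; apply: computable_const.
- pose h xs := if `[< exists2 v,
    vset G v & iV v = nth 0 xs 0 >] then nth 0 xs 0 else iV v0.
  have [q hq] : computable 1 h by apply: computable_if => //; apply: computable_const.
  exists (Comp p (fun _ => q)) => xs.
  apply: (@eval_comp _ _ _ _ _ [tuple h xs]) => [i|].
    by rewrite (tnth_nth 0) ord1 /=; apply: hq.
  have [vG vu] := vxP (nth 0 xs 0).
  rewrite (_ : h xs = iV (vx (nth 0 xs 0))); first exact: hp.
  rewrite /h; case: asboolP => [[v vG' e]|no]; first by rewrite (vu v).
  rewrite /vx; case: pselect => // -[v [? ?]]; case: no; by exists v.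
- by move=> c; split=> /asboolP.
- move=> e Ee; have := hg [:: iE e] erefl; rewrite /P /=.
  have -> : Ed (iE e) by apply/asboolP; exists e.
  case/asboolP=> f [u [v [j [ef eu ev]]]]; exists u, v; split=> //.
  have Ef : eset G f by exists u, v.
  by rewrite (injE e f) ?inE.
- by move=> x xG; rewrite /degc; have [_ h] := vxP (iV x); rewrite (h x).
Qed.

Section Decide.
Variables (Ed : pred nat) (s d degc : nat -> nat).
Hypothesis cEd : computable 1 (fun xs => Ed (nth 0 xs 0)).
Hypothesis cs : computable 1 (fun xs => s (nth 0 xs 0)).
Hypothesis cd : computable 1 (fun xs => d (nth 0 xs 0)).
Hypothesis cdeg : computable 1 (fun xs => degc (nth 0 xs 0)).
Hypothesis degP : forall U e v, uniq U -> all Ed U -> Ed e -> inc s d e v ->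
  reflect (~ unsaturated Ed s d U v) (saturated s d degc U v).
Hypothesis connE : forall c c', Ed c -> Ed c' -> conn Ed s d [::] c c'.
Hypothesis infE : forall l : seq nat, exists2 c, Ed c & c \notin l.
Variables (k : nat) (S q : seq nat).
Hypothesis ends_k : forall U, ends_at_most Ed s d U k.
Hypothesis ES : all Ed S.
Hypothesis szq : size q = k.
Hypothesis oq : all (outside Ed S) q.
Hypothesis aq : apart Ed s d S q.
Hypothesis iq : forall e, e \in q -> in_infinite_part Ed s d S e.

(** [pre] is the part of the criterion that is decided directly, and [Uc] extracts
    the used edges from an instance. *)
Lemma decidable_by_certificates T (D : T -> Prop) (cod : T -> nat) (Q : T -> Prop)
    (pre : nat -> bool) (Uc : nat -> nat) :
  computable 1 (fun xs => pre (nth 0 xs 0)) ->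
  computable 1 (fun xs => Uc (nth 0 xs 0)) ->
  (forall x, D x -> let U := decode (Uc (cod x)) in
     [/\ uniq U, all Ed U & Q x <-> pre (cod x) /\ no_finite_part Ed s d U]) ->
  algorithmically_decidable D cod Q.
Proof.
move=> cp cU h.
pose P ys := pre (nth 0 ys 1) && confirms Ed s d degc k S (decode (Uc (nth 0 ys 1)))
  (decode (nth 0 (decode (nth 0 ys 0)) 0)) (decode (nth 0 (decode (nth 0 ys 0)) 1)).
pose N ys := ~~ pre (nth 0 ys 1) ||
    refutes Ed s d degc (decode (Uc (nth 0 ys 1))) (decode (nth 0 ys 0)).
have p0 := @computable_nth 2 0 isT; have p1 := @computable_nth 2 1 isT.
have cpre : computable 2 (fun ys => pre (nth 0 ys 1)) by exact: (computable1 cp p1).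
have cUc : computable 2 (fun ys => Uc (nth 0 ys 1)) by exact: (computable1 cU p1).
apply: (@decidable_by_search _ _ _ _ P N).
- apply: computable_and => //; apply: computable_confirms => //;
    by apply: computable_nth_decode => //; exact: computable_const.
- by apply: computable_or; [exact: computable_neg|exact: computable_refutes].
move=> x Dx; have [uU EU hQ] := h x Dx.
have rf := refutes_correct degP EU uU.
have cf : (exists z, confirms Ed s d degc k S (decode (Uc (cod x)))
    (decode (nth 0 (decode z) 0)) (decode (nth 0 (decode z) 1))) <->
    no_finite_part Ed s d (decode (Uc (cod x))).
  split=> [[z hz]|nU]; first exact: (confirms_sound degP connE szq oq aq iq uU EU hz).
  have [L [M hLM]] := confirms_complete degP infE ends_k ES uU EU nU.
  by exists (code [:: code L; code M]); rewrite (CodeSeq.codeK [:: code L;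
      code M]) [nth 0 _ 0]/= [nth 0 _ 1]/= !CodeSeq.codeK.
split; split.
- move=> /hQ[px /cf[z hz]]; exists z; by rewrite /P /= px.
- case=> z /andP[/= px hz]; apply/hQ; split => //; apply/cf; by exists z.
- move=> nQ; have [px|px] := boolP (pre (cod x)); last by exists 0; rewrite /N /= px.
  have [F hF] : exists F, refutes Ed s d degc (decode (Uc (cod x))) F.
    by apply/rf => nU; apply: nQ; apply/hQ.
  by exists (code F); rewrite /N /= CodeSeq.codeK hF orbT.
- case=> z; rewrite /N /= => /orP[/negP px /hQ[]//|hF] /hQ[_]; apply/rf.
  by exists (decode z).
Qed.

End Decide.

(** * Cardinalities of coded sets *)

Lemma card_set_seq (l : seq nat) : uniq l -> ([set` l] #= `I_(size l))%card.
Proof.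
move=> ul; have inj : {in `I_(size l) &, injective (nth 0 l)}.
  by move=> i j; rewrite !inE => hi hj /eqP; rewrite nth_uniq // => /eqP.
have := inj_card_eq inj; congr (card_eq _ _).
apply/seteqP; split=> [c [i hi <-]|c cl] /=; first exact: mem_nth.
by exists (index c l); [rewrite /mkset index_mem|rewrite nth_index].
Qed.

Lemma ncard_eq T (A : set T) n : (A #= `I_n)%card -> ncard A = n.
Proof.
move=> h; rewrite /ncard; case: xgetP => [m _ /= hm|/(_ n)//].
by apply/card_eq_II; rewrite -(card_eql hm).
Qed.

Lemma ncard_image T (f : T -> nat) (A : set T) l :
  (forall x y, A x -> A y -> f x = f y -> x = y) -> uniq l ->
  (forall c, c \in l <-> exists2 x, A x & f x = c) ->
  finite_set A /\ ncard A = size l.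
Proof.
move=> inj ul hl.
have e : (A #= `I_(size l))%card.
  rewrite card_eq_sym; have := card_set_seq ul; rewrite card_eq_sym => h.
  apply: card_eq_trans h _; have inj' : {in A &, injective f}.
    by move=> x y; rewrite !inE; apply: inj.
  have := inj_card_eq inj'; congr (card_eq _ _).
  apply/seteqP; split=> c /=; [by move=> h; apply/hl|by move/hl].
split; last exact: ncard_eq.
by exists (size l).
Qed.

Lemma finite_codes T (f : T -> nat) (A : set T) :
  (forall x y, A x -> A y -> f x = f y -> x = y) ->
  finite_set A <-> exists l : seq nat, forall x, A x -> f x \in l.
Proof.
move=> inj; split=> [/(finite_image f)/finite_seqP[l hl]|[l hl]].
  exists l => x Ax; have : [set f x | x in A]%classic (f x) by exists x.
  by rewrite hl.
pose l' := undup [seq c <- l | `[< exists2 x, A x & f x = c >]].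
have [|//] := @ncard_image T f A l' inj (undup_uniq _).
move=> c; rewrite mem_undup mem_filter; split=> [/andP[/asboolP]//|[x Ax fx]].
by apply/andP; split; [apply/asboolP; exists x|rewrite -fx; apply: hl].
Qed.

(** * Coding an abstract graph by natural numbers *)

Section Transport.
Variables (V E : Type) (G : graph V E) (iV : V -> nat) (iE : E -> nat).
Hypothesis injV : forall u v, vset G u -> vset G v -> iV u = iV v -> u = v.
Hypothesis injE : forall e f, eset G e -> eset G f -> iE e = iE f -> e = f.
Variables (Ed : pred nat) (s d : nat -> nat).
Hypothesis EdP : forall c, Ed c <-> exists2 e, eset G e & iE e = c.
Hypothesis endsP : forall e, eset G e ->
  exists u v, [/\ joins G e u v, s (iE e) = iV u & d (iE e) = iV v].
Variables (v0 : V) (e0 : E).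

Local Notation incG := (inc s d).
Local Notation otherG := (other s d).
Local Notation deg_inG := (deg_in s d).
Local Notation outsideG := (outside Ed).
Local Notation walkG := (walk s d).
Local Notation walk_endG := (walk_end s d).
Local Notation trailG := (trail Ed s d).
Local Notation linkedG := (linked Ed s d).
Local Notation connG := (conn Ed s d).
Local Notation residual_parityG := (residual_parity Ed s d).

(** Decoding of vertices and edges, with a default for numbers that are not
    codes. *)
Definition dV (c : nat) : V :=
  if pselect (exists v, vset G v /\ iV v = c) is left h then projT1 (cid h) else v0.
Definition dE (c : nat) : E :=
  if pselect (exists e, eset G e /\ iE e = c) is left h then projT1 (cid h) else e0.

Lemma dVK v : vset G v -> dV (iV v) = v.
Proof.
move=> h; rewrite /dV; case: pselect => [h'|[]]; last by exists v.
by case: (cid h') => w /= [vw e]; apply: injV.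
Qed.

Lemma dEK e : eset G e -> dE (iE e) = e.
Proof.
move=> h; rewrite /dE; case: pselect => [h'|[]]; last by exists e.
by case: (cid h') => w /= [vw ee]; apply: injE.
Qed.

Lemma coded_edge e : eset G e -> Ed (iE e).
Proof. by move=> h; apply/EdP; exists e. Qed.

Lemma dEP c : Ed c -> eset G (dE c) /\ iE (dE c) = c.
Proof. by move=> /EdP[e he <-]; rewrite dEK. Qed.

Lemma joins_eset e x y : joins G e x y -> eset G e.
Proof. by move=> h; exists x, y. Qed.

Lemma joins_ends e x y : joins G e x y -> vset G x /\ vset G y.
Proof. by move=> h; split; [exact: joins_vset h|exact: joins_vset (joins_sym h)]. Qed.

Lemma joins_step e x y : joins G e x y ->
  incG (iE e) (iV x) /\ otherG (iE e) (iV x) = iV y.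
Proof.
move=> h; have [u [v [j es ed]]] := endsP (joins_eset h).
rewrite /inc /other es ed.
have [[-> ->]|[-> ->]] := joins_pair j h; first by rewrite eqxx.
have [vu vv] := joins_ends j.
by rewrite eqxx orbT; split => //; case: eqP => // /injV ->.
Qed.

Lemma step_joins c x : Ed c -> vset G x -> incG c (iV x) ->
  exists2 y, joins G (dE c) x y & otherG c (iV x) = iV y.
Proof.
move=> Ec vx ic; have [Ee ei] := dEP Ec.
have [u [v [j es ed]]] := endsP Ee; have [vu vv] := joins_ends j.
have [y j'] : exists y, joins G (dE c) x y.
  have : incG (iE (dE c)) (iV x) by rewrite ei.
  rewrite /inc es ed => /orP[]/eqP h.
    by exists v; rewrite -(injV vu vx h).
  by exists u; rewrite -(injV vv vx h); apply: joins_sym.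
by exists y => //; have [_] := joins_step j'; rewrite ei.
Qed.

Lemma inc_incident e x : eset G e -> vset G x -> incG (iE e) (iV x) <-> incident G e x.
Proof.
move=> Ee vx; split=> [ie|[y /joins_step[]//]].
by have [y] := step_joins (coded_edge Ee) vx ie; rewrite dEK // => j _; exists y.
Qed.

Lemma inc_vset c n : Ed c -> incG c n -> exists2 x, vset G x & iV x = n.
Proof.
move=> /EdP[e Ee <-]; have [u [v [j es ed]]] := endsP Ee.
have [vu vv] := joins_ends j.
by rewrite /inc es ed => /orP[]/eqP <-; [exists u|exists v].
Qed.

Lemma joins_loop e x : eset G e -> vset G x -> incG (iE e) (iV x) ->
  mult s d (iE e) (iV x) = 1 + `[< joins G e x x >].
Proof.
move=> Ee vx ix; have [y j o] := step_joins (coded_edge Ee) vx ix.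
rewrite dEK // in j; have [u [v [j' es ed]]] := endsP Ee.
have [vu vv] := joins_ends j'.
rewrite /mult es ed.
have -> : `[< joins G e x x >] = (iV u == iV x) && (iV v == iV x).
  apply/asboolP/andP => [jx|[/eqP hu /eqP hv]].
    by have [[-> ->]|[-> ->]] := joins_pair jx j'; rewrite eqxx.
  by rewrite -{1}(injV vu vx hu) -(injV vv vx hv).
move: ix; rewrite /inc es ed.
by case: (iV u == iV x); case: (iV v == iV x).
Qed.

Lemma degree_seq (K : graph V E) x l : subgraph K G -> vset G x -> uniq l ->
  (forall e, incident K e x <-> eset G e /\ iE e \in l) ->
  (forall e, joins K e x x <-> joins G e x x /\ iE e \in l) ->
  (forall c, c \in l -> Ed c) ->
  degree K x = Some (deg_inG l (iV x)).
Proof.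
move=> [_ KG] vx ul hi hj El.
have [||fi ni] := @ncard_image E iE [set e | incident K e x]%classic l _ ul.
- by move=> e f /= /hi[he _] /hi[hf _]; apply: injE.
- move=> c; split=> [cl|[e /= /hi[_ ?] <-]//].
  by have [Ee ei] := dEP (El c cl); exists (dE c) => //=; apply/hi; rewrite ei.
pose l' := [seq c <- l | `[< joins G (dE c) x x >]].
have [||fj nj] := @ncard_image E iE [set e | joins K e x x]%classic l' _ (filter_uniq _
    ul).
- by move=> e f /= /hj[/joins_eset he _] /hj[/joins_eset hf _]; apply: injE.
- move=> c; rewrite mem_filter; split=> [/andP[/asboolP j cl]|[e /= /hj[j cl] <-]].
    by have [Ee ei] := dEP (El c cl); exists (dE c) => //=; apply/hj; rewrite ei.
  by rewrite cl dEK ?andbT; [apply/asboolP|apply: joins_eset j].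
rewrite /degree; case: asboolP => // _; congr Some; rewrite ni nj /l' size_filter.
have incl c : c \in l -> incG c (iV x).
  move=> cl; have [Ee ei] := dEP (El c cl); rewrite -ei; apply/inc_incident => //.
  have /hi[y /KG j] : eset G (dE c) /\ iE (dE c) \in l by rewrite ei.
  by exists y.
rewrite /deg_in -sum1_size -sum1_count [X in _ + X = _]big_mkcond -big_split /= big_seq
    [RHS]big_seq.
apply: eq_bigr => c cl; have [Ee ei] := dEP (El c cl).
have := @joins_loop (dE c) x Ee vx; by rewrite ei => -> //; exact: incl.
Qed.

Lemma degree_some x n : vset G x -> degree G x = Some n ->
  exists l, [/\ uniq l, forall c, (c \in l) = Ed c &&
    incG c (iV x) & deg_inG l (iV x) = n].
Proof.
move=> vx; have [fin|nf] := pselect (finite_set [set e | incident G e x]%classic);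
  last by rewrite /degree; case: asboolP.
have inj : forall e f, incident G e x -> incident G f x -> iE e = iE f -> e = f.
  by move=> e f [y /joins_eset he] [z /joins_eset hf]; apply: injE.
have [l' hl'] := (finite_codes inj).1 fin.
pose l := undup [seq c <- l' | Ed c && incG c (iV x)].
have hl c : (c \in l) = Ed c && incG c (iV x).
  rewrite mem_undup mem_filter; apply: andb_idr => /andP[Ec ic].
  have [Ee ei] := dEP Ec; rewrite -ei; apply: hl' => /=; apply/inc_incident => //.
  by rewrite ei.
have hd : degree G x = Some (deg_inG l (iV x)).
  have GG : subgraph G G by split.
  apply: (degree_seq GG vx (undup_uniq _)).
  - move=> e; rewrite hl; split=> [[y j]|[Ee /andP[_ ix]]];
      last exact/(inc_incident Ee vx).
    have Ee := joins_eset j; rewrite (coded_edge Ee); split => //.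
    by have [] := joins_step j.
  - move=> e; rewrite hl; split=> [j|[]//]; split => //.
    by rewrite (coded_edge (joins_eset j)); have [-> _] := joins_step j.
  - by move=> c; rewrite hl => /andP[].
by move=> h; exists l; split => //; [exact: undup_uniq|move: h; rewrite hd => -[]].
Qed.

Lemma degree_none x : vset G x -> degree G x = None ->
  forall l : seq nat, exists c, [/\ Ed c, incG c (iV x) & c \notin l].
Proof.
move=> vx; rewrite /degree; case: asboolP => // nfin _ l.
apply: contrapT => no; apply: nfin.
have inj : forall e f, incident G e x -> incident G f x -> iE e = iE f -> e = f.
  by move=> e f [y /joins_eset he] [z /joins_eset hf]; apply: injE.
apply/(finite_codes inj); exists l => e /= [y j]; apply: contrapT => /negP h.
apply: no; exists (iE e); split => //; first exact: coded_edge (joins_eset j).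
by have [] := joins_step j.
Qed.

Lemma degree_complete x (l : seq nat) : vset G x -> uniq l ->
  (forall c, (c \in l) = Ed c && incG c (iV x)) -> degree G x = Some (deg_inG l (iV x)).
Proof.
move=> vx ul hl; case dx: (degree G x) => [n|]; last first.
  have [c [Ec ic]] := degree_none vx dx l; by rewrite hl Ec ic.
have [l' [ul' hl' <-]] := degree_some vx dx.
by congr Some; apply: deg_in_perm; apply: uniq_perm => // c; rewrite hl hl'.
Qed.

Section Deg.
Variable degc : nat -> nat.
Hypothesis degcP : forall x, vset G x -> degc (iV x) = code_degree (degree G x).

Lemma saturatedP U c n : uniq U -> all Ed U -> Ed c -> incG c n ->
  reflect (~ unsaturated Ed s d U n) (saturated s d degc U n).
Proof.
move=> uU EU Ec ic; suff h : saturated s d degc U n <->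
    ~ unsaturated Ed s d U n by apply: (iffP idP); case: h.
have [x vx <-] := inc_vset Ec ic; rewrite /saturated degcP //.
case dx: (degree G x) => [m|] /=; last first.
  split=> // no; case: no; have [f [Ef fx fU]] := degree_none vx dx U.
  by exists f => //; rewrite /outside Ef.
have [l [ul hl <-]] := degree_some vx dx; rewrite eqSS.
have p : perm_eq l ([seq c <- U | incG c (iV x)] ++ [seq c <- l | c \notin U]).
  apply: uniq_perm => //.
    rewrite cat_uniq !filter_uniq // andbT /=; apply/hasPn => f.
    by rewrite !mem_filter => /andP[/negbTE-> _] /=; rewrite andbF.
  move=> f; rewrite mem_cat !mem_filter hl; have [fU|fU] := boolP (f \in U).
    by rewrite (allP EU) // andbT orbF.
  by rewrite andbF.
rewrite (deg_in_perm _ _ _ p) deg_in_cat deg_in_filter -{2}[deg_in _ _ U _]addn0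
    eqn_add2l.
split=> [/eqP h0 [f /andP[Ef fU] fx]|no].
  have fl : f \in [seq c <- l | c \notin U] by rewrite mem_filter fU hl Ef.
  move: h0; rewrite (deg_in_perm _ _ _ (perm_to_rem fl)) deg_in_cons => /eqP.
  by rewrite addn_eq0 => /andP[]; rewrite -leqn0 leqNgt mult_gt0 fx.
apply/eqP/deg_in_eq0 => f; rewrite mem_filter => /andP[fU]; rewrite hl => /andP[Ef fx].
by case: no; exists f => //; rewrite /outside Ef.
Qed.

End Deg.

(** * Paths and walks *)

Lemma hom_step (K : graph V E) I t c : is_path K I t -> I c -> I (c + 1)%R ->
  joins K (pe t c) (pv t c) (pv t (c + 1)%R).
Proof. by move=> [[_ h] _] Ic Ic1; apply: h; split => //; left. Qed.

Lemma is_path_intro (K : graph V E) (I : set int) t :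
  (forall c, I c -> vset K (pv t c)) ->
  (forall c, I c -> I (c + 1)%R -> joins K (pe t c) (pv t c) (pv t (c + 1)%R)) ->
  (forall c c', I c -> I (c + 1)%R -> I c' -> I (c' + 1)%R -> pe t c = pe t c' ->
    c = c') ->
  is_path K I t.
Proof.
move=> hv hj hi; split; [split => //|].
- move=> c x y [[Ic Ic1] [[-> ->]|[-> ->]]]; first exact: hj.
  by apply: joins_sym; apply: hj.
- by move=> c c' [x [y [[? ?] _]]] [x' [y' [[? ?] _]]]; apply: hi.
Qed.

Lemma steps_walk (pvs : nat -> V) (pes : nat -> E) n :
  (forall i, i < n -> joins G (pes i) (pvs i) (pvs i.+1)) ->
  walkG (iV (pvs 0)) (mkseq (fun i => iE (pes i)) n) /\
  walk_endG (iV (pvs 0)) (mkseq (fun i => iE (pes i)) n) = iV (pvs n).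
Proof.
elim: n => [//|n IH] h; have [|w e] := IH; first by move=> i lt; apply/h/ltnW.
rewrite mkseqS -cats1 walk_cat walk_end_cat w e /=.
by have [-> ->] := joins_step (h n (ltnSn n)).
Qed.

Lemma walk_end_vset x l : vset G x -> all Ed l -> walkG (iV x) l ->
  vset G (dV (walk_endG (iV x) l)) /\ iV (dV (walk_endG (iV x) l)) = walk_endG (iV x) l.
Proof.
elim: l x => [|c l IH] x vx /=; first by rewrite dVK.
case/andP=> Ec El /andP[ic]; have [y j ->] := step_joins Ec vx ic.
by apply: IH => //; have [] := joins_ends j.
Qed.

Lemma walk_joins x l c : vset G x -> all Ed (rcons l c) -> walkG (iV x) (rcons l c) ->
  joins G (dE c) (dV (walk_endG (iV x) l)) (dV (walk_endG (iV x) (rcons l c))).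
Proof.
rewrite -cats1 all_cat walk_cat walk_end_cat /= !andbT => vx /andP[El Ec] /andP[wl ic].
have [vy ey] := walk_end_vset vx El wl; move: ic; rewrite -{1}ey => ic.
have [z j] := step_joins Ec vy ic; rewrite ey => ->.
by rewrite dVK //; have [] := joins_ends j.
Qed.

Section Finite.
Local Open Scope ring_scope.

Lemma path_walk (K : graph V E) a b t :
  (forall e u v, joins K e u v -> joins G e u v) -> finite_path K a b t ->
  let l := mkseq (fun i => iE (pe t (a + i%:Z))) `|(b - a)%R|%N in
  [/\ walkG (iV (pv t a)) l,
      forall i, (i <= `|b - a|)%N ->
        walk_endG (iV (pv t a)) (take i l) = iV (pv t (a + i%:Z)),
      uniq l & forall c, c \in l -> exists e u v, joins K e u v /\ iE e = c].
Proof.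
move=> KG [ab ip] l; set n := `|(b - a)%R|%N in l *.
have st i : (i < n)%N -> joins K (pe t (a + i%:Z)) (pv t (a + i%:Z)) (pv t (a + i.+1%:Z)).
  move=> lt; have := hom_step (c := a + i%:Z) ip.
  have -> : a + i%:Z + 1 = a + i.+1%:Z by lia.
  by apply; rewrite /int_interval /=; move: lt; rewrite /n; lia.
have sw i : (i <= n)%N -> walkG (iV (pv t a)) (take i l) /\
    walk_endG (iV (pv t a)) (take i l) = iV (pv t (a + i%:Z)).
  move=> le; rewrite take_mkseq //.
  have := @steps_walk (fun i => pv t (a + i%:Z)) (fun i => pe t (a + i%:Z)) i.
  rewrite /= addr0; apply=> j lt; apply/KG/st; exact: leq_trans lt le.
split.
- by have := (sw n (leqnn n)).1; rewrite take_oversize // size_mkseq.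
- by move=> i /sw[].
- rewrite map_inj_in_uniq ?iota_uniq // => i j; rewrite !mem_iota /= => hi hj.
  move=> /injE h; have {h}: pe t (a + i%:Z) = pe t (a + j%:Z).
    by apply: h; [have := st i hi|have := st j hj] => /KG/joins_eset.
  case: ip => _ inj /inj h; suff: a + i%:Z = a + j%:Z by lia.
  have el k : (k < n)%N -> eset (line (int_interval a b)) (a + k%:Z).
    move=> hk; exists (a + k%:Z), (a + k%:Z + 1); split; last by left.
    by rewrite /int_interval /=; move: hk; rewrite /n; lia.
  by apply: h; apply: el.
- move=> c /mapP[i]; rewrite mem_iota /= => hi ->.
  by exists (pe t (a + i%:Z)), (pv t (a + i%:Z)), (pv t (a + i.+1%:Z)); split => //;
      apply: st.
Qed.

Lemma walk_path (K : graph V E) x l : vset G x -> all Ed l -> uniq l -> walkG (iV x) l ->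
  vset K x -> (forall e u v, iE e \in l -> joins G e u v -> joins K e u v) ->
  exists t, [/\ finite_path K 0 (size l)%:Z t,
    pv t 0 = x & pv t (size l)%:Z = dV (walk_endG (iV x) l)].
Proof.
move=> vx El ul wl Kx GK.
pose t := @Pathmap V E (fun c => dV (walk_endG (iV x) (take `|c|%N l))) (fun c =>
    dE (nth 0%N l `|c|%N)).
have jn i : (i < size l)%N ->
    joins K (dE (nth 0%N l i)) (dV (walk_endG (iV x) (take i l)))
    (dV (walk_endG (iV x) (take i.+1 l))).
  move=> lt; have il := mem_nth 0%N lt; apply: GK.
    by rewrite (dEP (allP El _ il)).2.
  rewrite (take_nth 0%N lt); apply: walk_joins => //; rewrite -take_nth //.
    by apply/allP => c /mem_take/(allP El).
  by move: wl; rewrite -{1}(cat_take_drop i.+1 l) walk_cat => /andP[].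
exists t; split => /=; last by rewrite take_size.
  split=> //; apply: is_path_intro => [c|c|c c']; rewrite /int_interval /=.
  - move=> h; have [z|nz] := eqVneq c 0; first by rewrite z take0 /= dVK.
    have lt : (`|c|.-1 < size l)%N by move: h nz; lia.
    have := joins_vset (joins_sym (jn _ lt)).
    by rewrite prednK //; move: nz; lia.
  - move=> h1 h2; have -> : `|(c + 1)%R|%N = `|c|%N.+1 by move: h1; lia.
    by apply: jn; move: h1 h2; lia.
  - move=> h1 h2 h3 h4.
    have lt : (`|c| < size l)%N by move: h1 h2; lia.
    have lt' : (`|c'| < size l)%N by move: h3 h4; lia.
    move=> /(congr1 iE); rewrite !(dEP (allP El _ (mem_nth 0%N _))).2 // => /eqP.
    by rewrite nth_uniq // => /eqP; move: h1 h3; lia.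
by rewrite take0 /= dVK.
Qed.

End Finite.

Lemma graph_ext (H K : graph V E) : vset H = vset K -> joins H = joins K -> H = K.
Proof.
case: H => vH jH a b c; case: K => vK jK a' b' c' /= e1 e2; subst vK jK.
by rewrite (Prop_irrelevance a a') (Prop_irrelevance b b') (Prop_irrelevance c c').
Qed.

(** * Components and ends *)

Section Ends.
Variable U : seq nat.
Definition coded_edges : set E := [set e | eset G e /\ iE e \in U]%classic.
Local Notation GU := (remove_edges G coded_edges).

Lemma joins_GU e u v : joins GU e u v <-> joins G e u v /\ outsideG U (iE e).
Proof.
split=> [[[Ee nF] j]|[j /andP[_ nU]]].
  by split => //; rewrite /outside coded_edge //; apply/negP => h; apply: nF.
have Ee := joins_eset j; split=> //; split => // -[_].
by move/negP: nU.
Qed.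

Definition component_of_vset c : set V :=
  [set v | vset G v /\ exists2 f, connG U c f & incG f (iV v)]%classic.
Definition component_of_joins c e u v := joins G e u v /\ connG U c (iE e).

Lemma component_of_sym c e u v : component_of_joins c e u v -> component_of_joins c e v u.
Proof. by move=> [j cf]; split => //; apply: joins_sym. Qed.

Lemma component_of_pair c e u v u' v' : component_of_joins c e u v ->
  component_of_joins c e u' v' ->
  (u' = u /\ v' = v) \/ (u' = v /\ v' = u).
Proof. by case=> j _ [j' _]; apply: joins_pair j'. Qed.

Lemma component_of_incl c e u v : component_of_joins c e u v -> component_of_vset c u.
Proof.
case=> j ce; split; first exact: joins_vset j.
by exists (iE e) => //; have [] := joins_step j.
Qed.

(** The component of the edge coded by [c] in the graph [G] minus the edges coded
    by [U]. *)
Definition component_of c : graph V E :=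
  Graph (@component_of_sym c) (@component_of_pair c) (@component_of_incl c).

Lemma path_linked (K : graph V E) x y :
  (forall e u v, joins K e u v -> joins GU e u v) -> connected K ->
  vset K x -> vset K y -> linkedG U (iV x) (iV y).
Proof.
move=> KG cK Kx Ky; have [a [b [t [ft <- <-]]]] := cK x y Kx Ky.
have KG' e u v : joins K e u v -> joins G e u v.
  by move=> j; have /joins_GU[] := KG _ _ _ j.
have [w e ul hl] := path_walk KG' ft.
set l := mkseq _ _ in w e ul hl; exists l.
  rewrite /trail ul w andbT; apply/allP => c /hl[f [u [v [j <-]]]].
  by have /joins_GU[] := KG _ _ _ j.
have := e _ (leqnn _); rewrite take_oversize ?size_mkseq // => ->.
by have [ab _] := ft; congr (iV (pv t _)); lia.
Qed.

Lemma component_ofP c : outsideG U c -> connected_component (component_of c) GU.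
Proof.
move=> oc; have cout f : connG U c f -> outsideG U f by apply: conn_outside.
have sub : forall e u v, component_of_joins c e u v -> joins GU e u v.
  by move=> e u v [j cf]; apply/joins_GU; split => //; apply: cout.
split.
- split=> // v [vv [f cf fv]]; have /andP[Ef _] := cout f cf.
  have [y j _] := step_joins Ef vv fv.
  have jG : joins GU (dE f) v y.
    by apply/joins_GU; split => //; rewrite (dEP Ef).2; apply: cout.
  exact: joins_vset jG.
- move=> u v [vu [f cf fu]] [vv [g cg gv]].
  have [l /and3P[ul ol wl] el] : linkedG U (iV u) (iV v).
    apply: linked_conn (cout f cf) _ gv => //.
    by apply: conn_trans cg; apply: conn_sym.
  have El : all Ed l by apply/allP => a /(allP ol)/andP[].
  have [||t [ft t0 t1]] := @walk_path (component_of c) u l vu El ul wl.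
  + by split => //; exists f.
  + move=> e x y el' j; split => //; have oe := allP ol _ el'.
    apply: (conn_trans cf); case/splitPr: el' {el El} ul ol wl => l1 l2.
    rewrite walk_cat all_cat cat_uniq => /and3P[ul1 _ _] /andP[ol1 _] /and3P[wl1 ie _].
    apply: (linked_conn_edges (u := iV u) (v := walk_endG (iV u) l1)) => //;
        last exact: cout.
    by exists l1 => //; rewrite /trail ul1 ol1.
  by exists 0%R, (Posz (size l)), t; split => //; rewrite t1 el dVK.
- move=> K [KV KG] cK [cV cJ].
  have [Ec ec] : eset G (dE c) /\ iE (dE c) = c by apply: dEP; case/andP: oc.
  have [x [y [j _ _]]] := endsP Ec.
  have [cx _] := joins_step j; rewrite ec in cx.
  have Kx : vset K x by apply: cV; split; [exact: joins_vset j|exists c => //;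
      apply: conn_refl].
  have lk z : vset K z -> linkedG U (iV x) (iV z) by apply: path_linked.
  have reach e u v : joins GU e u v -> vset K u -> connG U c (iE e).
    move=> /joins_GU[j' oe] /lk lu; apply: linked_conn_edges lu oc cx oe _.
    by have [] := joins_step j'.
  have eV : vset K = component_of_vset c.
    apply/seteqP; split=> // z Kz; have [e [Ee nF] [w j']] := KV z Kz.
    have jU : joins GU e z w by [].
    split; first exact: joins_vset j'.
    by exists (iE e); [exact: reach jU Kz|have [] := joins_step j'].
  apply: graph_ext => //=; apply/funext => e; apply/funext => u; apply/funext => v.
  apply/propext; split=> [jK|]; last exact: cJ.
  have jU := KG _ _ _ jK; split; first by have /joins_GU[] := jU.
  exact: reach jU (joins_vset jK).
Qed.

Lemma component_of_eq c c' : outsideG U c -> outsideG U c' ->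
  component_of c = component_of c' <-> connG U c c'.
Proof.
move=> oc oc'; split=> [e|cc'].
  have [Ec ec] : eset G (dE c') /\ iE (dE c') = c' by apply: dEP; case/andP: oc'.
  have [x [y [j _ _]]] := endsP Ec.
  have : joins (component_of c') (dE c') x y by split => //; rewrite ec; apply: conn_refl.
  by rewrite -e => -[_]; rewrite ec.
have eqc f : connG U c f <-> connG U c' f.
  by split; apply: conn_trans; [apply: conn_sym|].
apply: graph_ext => /=.
  by apply/seteqP; split=> v [vv [f /eqc cf fv]]; split => //; exists f.
apply/funext => e; apply/funext => u; apply/funext => v; apply/propext.
by split=> -[j /eqc].
Qed.

Lemma infinite_component_of c : in_infinite_part Ed s d U c <->
  infinite_set (eset (component_of c)).
Proof.
have inj : forall e f, eset (component_of c) e -> eset (component_of c) f ->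
    iE e = iE f -> e = f.
  by move=> e f [u [v [/joins_eset he _]]] [u' [v' [/joins_eset hf _]]]; apply: injE.
split=> h; [move/(finite_codes inj)|move=> hl; apply: h; apply/(finite_codes inj)].
  case=> l hl; apply: h; exists (c :: l) => f cf; rewrite inE.
  have [//|fc /=] := eqVneq f c.
  have of_ : outsideG U f by case: cf fc => [|a b _ ob _]; rewrite ?eqxx.
  have [Ef ef] : eset G (dE f) /\ iE (dE f) = f by apply: dEP; case/andP: of_.
  rewrite -ef; apply: hl; have [u [v [j _ _]]] := endsP Ef.
  by exists u, v; split => //; rewrite ef.
by case: hl => l hl; exists l => e [u [v [_ /hl]]].
Qed.

(** A component with infinitely many edges has an edge, and is the component of
    any of its edges by maximality. *)
Lemma component_of_exists H : connected_component H GU -> infinite_set (eset H) ->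
  exists c, [/\ outsideG U c, in_infinite_part Ed s d U c & H = component_of c].
Proof.
move=> [[HV HG] cH maxH] iH.
have [e [u [v j]]] : exists e, eset H e.
  apply: contrapT => no; apply: iH; suff -> : eset H = set0 by [].
  by apply/seteqP; split=> e he //; case: no; exists e.
have /joins_GU[jG oe] := HG _ _ _ j; exists (iE e).
have Hu := joins_vset j; have [eu _] := joins_step jG.
have reach f x y : joins H f x y -> connG U (iE e) (iE f).
  move=> jf; have /joins_GU[jf' of_] := HG _ _ _ jf.
  have lx : linkedG U (iV u) (iV x) by apply: path_linked cH Hu (joins_vset jf).
  apply: linked_conn_edges lx oe eu of_ _.
  by have [] := joins_step jf'.
have sub : subgraph H (component_of (iE e)).
  split=> [z Hz|f x y jf]; last first.
    by split; [have /joins_GU[] := HG _ _ _ jf|exact: reach jf].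
  have [f [Ef nF] [w jf]] := HV z Hz; have jU : joins GU f z w by [].
  have /joins_GU[_ of_] := jU.
  split; first exact: joins_vset jf.
  have fz : incG (iE f) (iV z) by have [] := joins_step jf.
  exists (iE f) => //; have lz : linkedG U (iV u) (iV z) by apply: path_linked cH Hu Hz.
  exact: linked_conn_edges lz oe eu of_ fz.
have [s1 c1 _] := component_ofP oe.
have eH := maxH _ s1 c1 sub; split => //.
by apply/infinite_component_of; rewrite eH.
Qed.

Lemma ends_at_most_of_components k : (infinite_components GU #<= `I_k)%card ->
  ends_at_most Ed s d U k.
Proof.
move=> hk q oq aq iq; rewrite -card_le_II; apply: card_le_trans hk.
have inj : {in `I_(size q) &, injective (fun i => component_of (nth 0 q i))}.
  move=> i j; rewrite !inE => /= hi hj /component_of_eq e.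
  have oi := allP oq _ (mem_nth 0 hi); have oj := allP oq _ (mem_nth 0 hj).
  have {e} cij := e oi oj.
  wlog lt : i j hi hj oi oj cij / i < j.
    move=> h; case: (ltngtP i j) => // lt; first exact: h.
    by apply/esym/h => //; apply: conn_sym.
  elim: q i j aq hi hj cij lt {oq iq oi oj} =>
    // a q IH [|i] [|j] //= [na aq] hi hj cij lt.
    by case: (na _ (mem_nth 0 hj)).
  by rewrite (IH i j).
have := inj_card_eq inj; rewrite card_eq_sym card_eq_le => /andP[h _].
apply: card_le_trans h _; apply: subset_card_le => H [i /= hi <-].
have iqi := mem_nth 0 hi; split; last exact/infinite_component_of/iq.
exact: component_ofP (allP oq _ iqi).
Qed.

Lemma two_infinite_components : ~ (infinite_components GU #<= `I_1)%card ->
  exists q, [/\ size q = 2, all (outsideG U) q, apart Ed s d U q &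
    forall e, e \in q -> in_infinite_part Ed s d U e].
Proof.
move=> h.
have [H1 [H2 [[c1 i1] [c2 i2] ne]]] : exists H1 H2,
    [/\ infinite_components GU H1, infinite_components GU H2 & H1 <> H2].
  apply: contrapT => no; apply: h.
  have [[H hH]|no'] := pselect (exists H, infinite_components GU H); last first.
    rewrite (_ : infinite_components GU = set0) ?card_le0x //.
    by apply/seteqP; split=> H hH //; case: no'; exists H.
  rewrite (_ : infinite_components GU = [set H]%classic).
    by rewrite (card_le_eql (eq_card1 H 0)) -II1 card_lexx.
  apply/seteqP; split=> [K hK|_ -> //] /=; apply: contrapT => ne; apply: no.
  by exists K, H.
have [a [oa ia ea]] := component_of_exists c1 i1.
have [b [ob ib eb]] := component_of_exists c2 i2.
exists [:: a; b]; split=> //=.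
- by rewrite oa ob.
- split => //; move=> f; rewrite inE => /eqP -> cab; apply: ne.
  by rewrite ea eb; apply/component_of_eq.
- by move=> e; rewrite !inE => /orP[]/eqP->.
Qed.

End Ends.

Lemma finite_coded_edges U : (coded_edges U `<=` eset G)%classic /\
  finite_set (coded_edges U).
Proof.
split=> [e []//|]; apply/(finite_codes (f := iE)); last by exists U => e [].
by move=> e f [he _] [hf _]; apply: injE.
Qed.

Lemma ends_bound k U : number_of_ends G k -> ends_at_most Ed s d U k.
Proof.
case=> h _; apply: ends_at_most_of_components.
by have [h1 h2] := finite_coded_edges U; apply: h.
Qed.

Lemma connected_linked x y : connected G -> vset G x -> vset G y ->
  linkedG [::] (iV x) (iV y).
Proof.
move=> cG vx vy; have [a [b [t [ft xt yt]]]] := cG x y vx vy.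
have [w e ul hl] := path_walk (fun _ _ _ h => h) ft.
set l := mkseq _ _ in w e ul hl; exists l.
  rewrite -xt trail_whole ul w andbT; apply/allP => f /hl[g [u [v [jg <-]]]].
  exact/coded_edge/(joins_eset jg).
have := e _ (leqnn _); rewrite take_oversize ?size_mkseq // xt => ->.
by have [ab _] := ft; rewrite -yt; congr (iV (pv t _)); lia.
Qed.

Lemma connected_conn c c' : connected G -> Ed c -> Ed c' -> connG [::] c c'.
Proof.
move=> cG Ec Ec'; have [Ee ee] := dEP Ec; have [Ef ef] := dEP Ec'.
have [x [x' [j _ _]]] := endsP Ee; have [y [y' [j' _ _]]] := endsP Ef.
have [ix _] := joins_step j; have [iy _] := joins_step j'; rewrite ee in ix;
    rewrite ef in iy.
have o0 f : Ed f -> outsideG [::] f by rewrite /outside => ->.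
apply: (linked_conn_edges (u := iV x) (v := iV y)); [|exact: o0|by []|exact: o0|by []].
exact: connected_linked cG (joins_vset j) (joins_vset j').
Qed.

Lemma connected_inc x c : connected G -> Ed c -> vset G x ->
  exists2 f, Ed f & incG f (iV x).
Proof.
move=> cG Ec vx; have [Ee ee] := dEP Ec; have [y [y' [j _ _]]] := endsP Ee.
have [[|f l] + e] := connected_linked cG vx (joins_vset j); last first.
  by case/and3P=> _ /= /andP[/andP[Ef _] _] /andP[fx _]; exists f.
by move=> _; exists c => //; rewrite -ee [iV x]e; have [] := joins_step j.
Qed.

Lemma infinite_codes : infinite_set (eset G) ->
  forall l : seq nat, exists2 c, Ed c & c \notin l.
Proof.
move=> h l; apply: contrapT => no; apply: h; apply/(finite_codes injE).
exists l => e Ee; apply: contrapT => /negP n; apply: no.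
by exists (iE e) => //; apply: coded_edge.
Qed.

(** For [k = 1] no edge has to be removed; for [k = 2], if no finite set of edges
    left two infinite components, then [1] would be a bound on the number of
    ends. *)
Lemma ends_witness k : connected G -> infinite_set (eset G) -> number_of_ends G k ->
  k = 1 \/ k = 2 -> exists S q, [/\ all Ed S, size q = k, all (outsideG S) q,
    apart Ed s d S q & forall e, e \in q -> in_infinite_part Ed s d S e].
Proof.
move=> cG iG nk [k1|k2].
  have [c Ec _] := infinite_codes iG [::].
  exists [::], [:: c]; split=> //=; first by rewrite /outside Ec.
  move=> e; rewrite inE => /eqP-> [l hl].
  have [f Ef /negP] := infinite_codes iG l; apply; apply: hl.
  exact: connected_conn.
have [F [sF fF hF]] : exists F : set E, [/\ (F `<=` eset G)%classic, finite_set F &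
    ~ (infinite_components (remove_edges G F) #<= `I_1)%card].
  apply: contrapT => no; case: nk => _ /(_ 1); rewrite k2.
  suff h : forall F : set E, (F `<=` eset G)%classic -> finite_set F ->
      (infinite_components (remove_edges G F) #<= `I_1)%card by move=> /(_ h).
  move=> F sF fF; apply: contrapT => hF; apply: no.
  by exists F.
have inj : forall e f, F e -> F f -> iE e = iE f -> e = f.
  by move=> e f /sF he /sF hf; apply: injE.
have [l hl] := (finite_codes inj).1 fF.
pose S := [seq c <- l | `[< exists2 e, F e & iE e = c >]].
have eF : F = coded_edges S.
  apply/seteqP; split=> [e Fe|e [Ee]].
    split; first exact: sF.
    by rewrite mem_filter hl // andbT; apply/asboolP; exists e.
  rewrite mem_filter => /andP[/asboolP[f Ff fe] _].
  by rewrite -(injE (sF _ Ff) Ee fe).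
rewrite eF in hF; have [q [szq oq aq iq]] := two_infinite_components hF.
exists S, q; split=> //; last by rewrite szq.
apply/allP => c; rewrite mem_filter => /andP[/asboolP[e Fe <-] _].
exact/coded_edge/sF.
Qed.

(** The last clause of [condition_E2] in the coded graph.  The degrees of
    [edge_induced] are those of the list [U], loops counting twice in both. *)
Lemma even_ends U :
  (forall F : set E, (F `<=` eset G)%classic -> finite_set F ->
    (forall v, vset (edge_induced G F) v -> even_degree (edge_induced G F) v) ->
    (infinite_components (remove_edges G F) #= `I_1)%card) ->
  uniq U -> all Ed U -> (forall v, ~~ odd (deg_inG U v)) -> ends_at_most Ed s d U 1.
Proof.
move=> h uU EU ev; apply: ends_at_most_of_components.
have [sU fU] := finite_coded_edges U; have := h _ sU fU; rewrite card_eq_le.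
suff hd : forall v, vset (edge_induced G (coded_edges U)) v ->
    even_degree (edge_induced G (coded_edges U)) v by move=> /(_ hd)/andP[].
move=> v [e [Ee eU] [w j]]; have vv := joins_vset j.
have hK : subgraph (edge_induced G (coded_edges U)) G.
  by split=> [x [f _ [y]]|f x y [_]] //; apply: joins_vset.
exists (deg_inG U (iV v)); last exact: ev.
rewrite -deg_in_filter; apply: (degree_seq hK vv); first exact: filter_uniq.
- move=> f; rewrite mem_filter; split.
    by move=> [y [[Ef fU'] jf]]; have [-> _] := joins_step jf.
  move=> [Ef /andP[iv fU']]; have [y jf] := (inc_incident Ef vv).1 iv.
  by exists y; split.
- move=> f; rewrite mem_filter; split.
    by move=> [[Ef fU'] jf]; have [-> _] := joins_step jf.
  by move=> [jf /andP[_ fU']]; split => //; split => //; apply: joins_eset jf.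
- by move=> c; rewrite mem_filter => /andP[_ /(allP EU)].
Qed.

(** * Parity of degrees *)

Lemma residual_parity_vertex v b : vset G v -> (forall n, degree G v = Some n ->
  odd n = b) ->
  residual_parityG [::] (iV v) b.
Proof.
move=> vv h l ul hl; apply: h; apply: degree_complete => // c.
by rewrite hl /outside andbT.
Qed.

Lemma vertex_parity v b n : vset G v -> residual_parityG [::] (iV v) b ->
  degree G v = Some n -> odd n = b.
Proof.
move=> vv h /(degree_some vv)[l [ul hl <-]]; apply: h => // c.
by rewrite hl /outside andbT.
Qed.

(** Numbers that code no vertex meet no edge. *)
Lemma residual_parity_no_vertex n : ~ (exists2 v, vset G v & iV v = n) ->
  residual_parityG [::] n false.
Proof.
move=> no l ul hl; rewrite deg_in_eq0 // => c; rewrite hl => /andP[/andP[Ec _] ic].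
by case: no; apply: inc_vset ic.
Qed.

(** * Infinite Eulerian paths as rays *)

Section Rays.
Local Open Scope ring_scope.

Definition edge_codes a b (t : pathmap V E) : seq nat :=
  mkseq (fun i => iE (pe t (a + i%:Z))) `|(b - a)%R|%N.

Lemma trail_of_path a b t : finite_path G a b t ->
  trailG [::] (iV (pv t a)) (edge_codes a b t) /\
  walk_endG (iV (pv t a)) (edge_codes a b t) = iV (pv t b).
Proof.
move=> ft; have [w e ul hl] := path_walk (fun _ _ _ h => h) ft.
split.
  rewrite trail_whole ul w andbT; apply/allP => f /hl[g [u [v [jg <-]]]].
  exact/coded_edge/(joins_eset jg).
have := e _ (leqnn _); rewrite take_oversize ?size_mkseq // => ->.
by have [ab _] := ft; congr (iV (pv t _)); lia.
Qed.

Lemma path_vset a b t : finite_path G a b t -> vset G (pv t a).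
Proof. by move=> [ab [[h _] _]]; apply: h; rewrite /= /int_interval /=; lia. Qed.

Lemma ray_joins x r n : vset G x -> (forall n, trailG [::] (iV x) (mkseq r n)) ->
  [/\ vset G (dV (walk_endG (iV x) (mkseq r n))), Ed (r n) &
  joins G (dE (r n)) (dV (walk_endG (iV x) (mkseq r n))) (dV (walk_endG (iV x) (mkseq r
    n.+1)))].
Proof.
move=> vx tr; have := tr n.+1; rewrite trail_whole => /and3P[_ El wl].
have Ern : Ed (r n) by apply: (allP El); rewrite mkseqS mem_rcons mem_head.
rewrite mkseqS in El wl *; have j := walk_joins vx El wl.
by split => //; apply: joins_vset j.
Qed.

Lemma extends_prefix a b t x r k : finite_path G a b t -> x = pv t a ->
  mkseq r (size (edge_codes a b t)) = edge_codes a b t -> (k <= `|(b - a)%R|)%N ->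
  dV (walk_endG (iV x) (mkseq r k)) = pv t (a + k%:Z) /\
  ((k < `|(b - a)%R|)%N -> dE (r k) = pe t (a + k%:Z)).
Proof.
move=> ft -> er lek; have [w e ul hl] := path_walk (fun _ _ _ h => h) ft.
have sz : size (edge_codes a b t) = `|(b - a)%R|%N by rewrite size_mkseq.
split.
  have := e _ lek; rewrite -[mkseq _ _ in X in X ->
      _]/(edge_codes a b t) -er take_mkseq ?sz //.
  move=> ->; rewrite dVK //; have [ab [[h _] _]] := ft.
  by apply: h; rewrite /= /int_interval /=; move: lek; lia.
move=> lt; have -> : r k = iE (pe t (a + k%:Z)).
  have : nth 0%N (mkseq r (size (edge_codes a b t))) k = nth 0%N (edge_codes a b t) k
      by rewrite er.
  by rewrite sz !nth_mkseq.
rewrite dEK //; have [ab ip] := ft.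
apply: joins_eset (hom_step ip _ _); rewrite /int_interval /=; move: lt; lia.
Qed.

Lemma extendable_one_wayP b t : finite_path G 0 b t ->
  extendable_one_way G 0 b t <->
  exists2 r, euler_ray Ed s d (iV (pv t 0)) r &
    mkseq r (size (edge_codes 0 b t)) = edge_codes 0 b t.
Proof.
move=> ft; have [ab ip] := ft; split.
  move=> [S [[iS cov] [sub ev ee]]].
  pose r i := iE (pe S (i%:Z)).
  have st i : joins G (pe S i%:Z) (pv S i%:Z) (pv S i.+1%:Z).
    have := hom_step (c := i%:Z) iS.
    rewrite (_ : i%:Z + 1 = i.+1%:Z); last by lia.
    by apply; rewrite /naturals /=; lia.
  have e0' : pv S 0 = pv t 0 by apply: ev; rewrite /int_interval /=; lia.
  exists r; last first.
    apply: (@eq_from_nth _ 0%N); rewrite !size_mkseq // => i lt.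
    rewrite !nth_mkseq // /r add0r ee //.
    exists i%:Z, (i%:Z + 1); split; last by left.
    by rewrite /int_interval /=; move: lt; lia.
  split=> [n|c Ec].
    have [w _] := @steps_walk (fun i => pv S i%:Z) (fun i => pe S i%:Z) n (fun i _ =>
        st i).
    rewrite trail_whole -e0' w andbT; apply/andP; split; last first.
      by apply/allP => c /mapP[i _ ->]; apply/coded_edge/(joins_eset (st i)).
    rewrite map_inj_in_uniq ?iota_uniq // => i j _ _ /injE h.
    have {h} := h (joins_eset (st i)) (joins_eset (st j)).
    case: iS => _ inj /inj h; suff: i%:Z = j%:Z by lia.
    have el k : eset (line naturals) k%:Z.
      by exists k%:Z, (k%:Z + 1); split; [rewrite /naturals /=; lia|left].
    by apply: h; apply: el.
  have [Ee ee'] := dEP Ec; have [n [[[x [y [[n0 _] _]]] pn] _]] := cov _ Ee.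
  exists `|n|%N; rewrite /r -ee' -pn; congr (iE (pe S _)).
  by move: n0; rewrite /naturals /=; lia.
move=> [r [tr cov] er]; set x := pv t 0 in tr er; have vx : vset G x := path_vset ft.
pose S := @Pathmap V E (fun c => dV (walk_endG (iV x) (mkseq r `|c|%N))) (fun c =>
    dE (r `|c|%N)).
have absS (c : int) : 0 <= c -> `|(c + 1)%R|%N = `|c|%N.+1 by lia.
have inj i j : dE (r i) = dE (r j) -> i = j.
  have [_ Ei _] := ray_joins i vx tr; have [_ Ej _] := ray_joins j vx tr.
  move=> /(congr1 iE); rewrite (dEP Ei).2 (dEP Ej).2 => e.
  have := tr (maxn i j).+1; rewrite trail_whole => /andP[u _].
  have hi : (i < (maxn i j).+1)%N by lia.
  have hj : (j < (maxn i j).+1)%N by lia.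
  apply/eqP; rewrite -(nth_uniq 0%N _ _ u) ?size_mkseq //.
  by rewrite !nth_mkseq // e.
exists S; split; [split|split].
- apply: is_path_intro => [c|c|c c']; rewrite /naturals /=.
  + by move=> _; have [] := ray_joins `|c|%N vx tr.
  + by move=> h _; rewrite absS //; have [] := ray_joins `|c|%N vx tr.
  + by move=> h1 _ h2 _ /inj; lia.
- move=> e Ee; have [i ri] := cov _ (coded_edge Ee).
  exists i%:Z; split=> [|c [[u [v [[c0 _] _]]] ec]].
    split; last by rewrite /= ri dEK.
    by exists i%:Z, (i%:Z + 1); split; [rewrite /naturals /=; lia|left].
  suff : i = `|c|%N by move: c0; rewrite /naturals /=; lia.
  by apply: inj; rewrite ri dEK // -ec.
- by move=> c; rewrite /int_interval /naturals /=; lia.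
- move=> c; rewrite /= /int_interval /= => h.
  have [|-> _] := @extends_prefix 0 b t x r `|c|%N ft erefl er; first by lia.
  by congr (pv t _); lia.
- move=> c [u [v [[]]]]; rewrite /int_interval /= => h1 h2 _.
  have [|_ ->] := @extends_prefix 0 b t x r `|c|%N ft erefl er; try lia.
  by congr (pe t _); lia.
Qed.

Lemma extendable_two_wayP a b t : finite_path G a b t ->
  extendable_two_way G a b t <->
  exists r1 r2, euler_line Ed s d (iV (pv t a)) r1 r2 /\
    mkseq r2 (size (edge_codes a b t)) = edge_codes a b t.
Proof.
move=> ft; have [ab ip] := ft; split.
  move=> [S [[iS cov] [sub ev ee]]].
  have st c : joins G (pe S c) (pv S c) (pv S (c + 1)) by apply: (hom_step iS).
  have inj c c' : pe S c = pe S c' -> c = c'.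
    case: iS => _; apply; [exists c, (c + 1)|exists c', (c' + 1)]; split; by [|left].
  have injc c c' : iE (pe S c) = iE (pe S c') -> c = c'.
    by move/injE => h; apply: inj; apply: h; apply: joins_eset (st _).
  have e0' : pv S a = pv t a by apply: ev; rewrite /= /int_interval /=; lia.
  pose r1 i := iE (pe S (a - i.+1%:Z)); pose r2 i := iE (pe S (a + i%:Z)).
  have st1 i : joins G (pe S (a - i.+1%:Z)) (pv S (a - i%:Z)) (pv S (a - i.+1%:Z)).
    apply: joins_sym; have := st (a - i.+1%:Z).
    by rewrite (_ : a - i.+1%:Z + 1 = a - i%:Z) //; lia.
  have st2 i : joins G (pe S (a + i%:Z)) (pv S (a + i%:Z)) (pv S (a + i.+1%:Z)).
    by have := st (a + i%:Z); rewrite (_ : a + i%:Z + 1 = a + i.+1%:Z) //; lia.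
  exists r1, r2; split; last first.
    apply: (@eq_from_nth _ 0%N); rewrite !size_mkseq // => i lt.
    rewrite !nth_mkseq // /r2 ee //.
    exists (a + i%:Z), (a + i%:Z + 1); split; last by left.
    by rewrite /int_interval /=; move: lt; lia.
  split=> [n|c Ec].
    have [w1 _] := @steps_walk (fun i => pv S (a - i%:Z)) (fun i =>
        pe S (a - i.+1%:Z)) n (fun i _ => st1 i).
    have [w2 _] := @steps_walk (fun i => pv S (a + i%:Z)) (fun i =>
        pe S (a + i%:Z)) n (fun i _ => st2 i).
    rewrite subr0 in w1; rewrite addr0 in w2.
    rewrite -e0' /double_trail w1 w2 !andbT; apply/andP; split.
      rewrite cat_uniq !map_inj_uniq ?iota_uniq //=; try by move=> i j /injc; lia.
      rewrite andbT; apply/hasPn => c /mapP[i _ ->]; apply/negP => /mapP[j _ /injc].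
      lia.
    apply/allP => c; rewrite mem_cat => /orP[]/mapP[i _ ->]; rewrite /outside andbT.
      exact: coded_edge (joins_eset (st1 i)).
    exact: coded_edge (joins_eset (st2 i)).
  have [Ee ee'] := dEP Ec; have [n [[_ pn] _]] := cov _ Ee.
  have [h|h] := lerP a n; [right; exists `|(n - a)%R|%N|left; exists `|(a - n)%R|%N.-1];
    rewrite /r1 /r2 -ee' -pn; congr (iE (pe S _)); move: h; lia.
move=> [r1 [r2 [[ex cov] er]]]; set x := pv t a in ex er;
    have vx : vset G x := path_vset ft.
have tr1 n : trailG [::] (iV x) (mkseq r1 n).
  have /and4P[u o w _] := ex n; rewrite /trail w andbT; apply/andP; split.
    by move: u; rewrite cat_uniq => /and3P[].
  by move: o; rewrite all_cat => /andP[].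
have tr2 n : trailG [::] (iV x) (mkseq r2 n).
  have /and4P[u o _ w] := ex n; rewrite /trail w andbT; apply/andP; split.
    by move: u; rewrite cat_uniq => /and3P[].
  by move: o; rewrite all_cat => /andP[].
(* position [a] is the common origin of the rays; the edge [c] of the line joins
   [c] to [c + 1], so [r1 n] is the edge numbered [a - n - 1] *)
pose S := @Pathmap V E
  (fun c => if a <= c then dV (walk_endG (iV x) (mkseq r2 `|(c - a)%R|%N))
            else dV (walk_endG (iV x) (mkseq r1 `|(a - c)%R|%N)))
  (fun c => if a <= c then dE (r2 `|(c - a)%R|%N) else dE (r1 `|(a - c)%R|%N.-1)).
pose R c := if a <= c then r2 `|(c - a)%R|%N else r1 `|(a - c)%R|%N.-1.
have SR c : pe S c = dE (R c) by rewrite /S /R /=; case: ifP.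
have ER c : Ed (R c).
  by rewrite /R; case: ifP => _; [have [] := ray_joins `|(c - a)%R|%N vx tr2
                                 |have [] := ray_joins `|(a - c)%R|%N.-1 vx tr1].
have stS c : joins G (pe S c) (pv S c) (pv S (c + 1)).
  rewrite /S /=; have [h|h] := lerP a c.
    have -> : a <= c + 1 by lia.
    have -> : `|(c + 1 - a)%R|%N = `|(c - a)%R|%N.+1 by lia.
    by have [] := ray_joins `|(c - a)%R|%N vx tr2.
  apply: joins_sym; have [_ _] := ray_joins `|(a - c)%R|%N.-1 vx tr1.
  rewrite prednK; last by lia.
  have [h'|h'] := lerP a (c + 1).
    have -> : `|(c + 1 - a)%R|%N = 0%N by lia.
    by have -> : `|(a - c)%R|%N = 1%N by lia.
  by have -> : `|(a - c)%R|%N.-1 = `|(a - (c + 1))%R|%N by lia.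
have inj c c' : R c = R c' -> c = c'.
  pose n := (`|(c - a)%R|%N + `|(c' - a)%R|%N).+1.
  have /and4P[+ _ _ _] := ex n; rewrite cat_uniq => /and3P[u1 /hasPn h u2].
  have i1 i : (i < n)%N -> nth 0%N (mkseq r1 n) i = r1 i by move=> lt; rewrite nth_mkseq.
  have i2 i : (i < n)%N -> nth 0%N (mkseq r2 n) i = r2 i by move=> lt; rewrite nth_mkseq.
  have m1 i : (i < n)%N -> r1 i \in mkseq r1 n by move=> lt;
      rewrite -i1 // mem_nth // size_mkseq.
  have m2 i : (i < n)%N -> r2 i \in mkseq r2 n by move=> lt;
      rewrite -i2 // mem_nth // size_mkseq.
  rewrite /R; have [h1|h1] := lerP a c; have [h2|h2] := lerP a c'.
  - have lt1 : (`|(c - a)%R| < n)%N by rewrite /n; lia.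
    have lt2 : (`|(c' - a)%R| < n)%N by rewrite /n; lia.
    rewrite -(i2 _ lt1) -(i2 _ lt2) => /eqP; rewrite nth_uniq ?size_mkseq // => /eqP.
    by move: h1 h2; lia.
  - have lt1 : (`|(c - a)%R| < n)%N by rewrite /n; lia.
    have lt2 : (`|(a - c')%R|.-1 < n)%N by rewrite /n; lia.
    by move=> e; have := h _ (m2 _ lt1); rewrite /= e m1.
  - have lt1 : (`|(a - c)%R|.-1 < n)%N by rewrite /n; lia.
    have lt2 : (`|(c' - a)%R| < n)%N by rewrite /n; lia.
    by move=> e; have := h _ (m2 _ lt2); rewrite /= -e m1.
  - have lt1 : (`|(a - c)%R|.-1 < n)%N by rewrite /n; lia.
    have lt2 : (`|(a - c')%R|.-1 < n)%N by rewrite /n; lia.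
    rewrite -(i1 _ lt1) -(i1 _ lt2) => /eqP; rewrite nth_uniq ?size_mkseq // => /eqP.
    by move: h1 h2; lia.
have injS c c' : pe S c = pe S c' -> c = c'.
  by rewrite !SR => /(congr1 iE); rewrite !(dEP (ER _)).2 => /inj.
exists S; split; [split|split].
- apply: is_path_intro => [c _|c _ _|c c' _ _ _ _]; [|exact: stS|exact: injS].
  exact: joins_vset (stS c).
- move=> e Ee; have [c Rc] : exists c, R c = iE e.
    have [[i ri]|[i ri]] := cov _ (coded_edge Ee).
      exists (a - i.+1%:Z); rewrite -ri /R (_ : (a <= a - i.+1%:Z) = false); last by lia.
      by congr r1; lia.
    exists (a + i%:Z); rewrite -ri /R (_ : (a <= a + i%:Z)); last by lia.
    by congr r2; lia.
  exists c; split=> [|c' [_ ec]].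
    split; last by rewrite SR Rc dEK.
    by exists c, (c + 1); split; [|left].
  by apply: injS; rewrite ec SR Rc dEK.
- by [].
- move=> c; rewrite /= /int_interval /= => h.
  have -> : a <= c by lia.
  have [|-> _] := @extends_prefix a b t x r2 `|(c - a)%R|%N ft erefl er; first by lia.
  by congr (pv t _); lia.
- move=> c [u [v [[]]]]; rewrite /int_interval /= => h1 h2 _.
  have -> : a <= c by lia.
  have [|_ ->] := @extends_prefix a b t x r2 `|(c - a)%R|%N ft erefl er; try lia.
  by congr (pe t _); lia.
Qed.

End Rays.

(** * The two decision procedures *)

Section Decision.
Variable degc : nat -> nat.
Hypothesis cEd : computable 1 (fun xs => Ed (nth 0 xs 0)).
Hypothesis cs : computable 1 (fun xs => s (nth 0 xs 0)).
Hypothesis cd : computable 1 (fun xs => d (nth 0 xs 0)).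
Hypothesis cdeg : computable 1 (fun xs => degc (nth 0 xs 0)).
Hypothesis degcP : forall x, vset G x -> degc (iV x) = code_degree (degree G x).

Definition path_vertices (c : nat) := nth 0 (decode c) 2.
Definition path_edges (c : nat) := nth 0 (decode c) 3.

Lemma path_edgesE a b t : decode (path_edges (code_path iV iE a b t)) = edge_codes a b t.
Proof. by rewrite /path_edges /code_path CodeSeq.codeK [nth 0 _ 3]/= CodeSeq.codeK. Qed.

Lemma path_verticesE a b t : decode (path_vertices (code_path iV iE a b t)) =
  [seq iV (pv t (a + Posz i)%R) | i <- iota 0 `|(b - a)%R|%N.+1].
Proof. rewrite /path_vertices /code_path CodeSeq.codeK; exact: CodeSeq.codeK. Qed.

Lemma path_startE a b t : nth 0 (decode (path_vertices (code_path iV iE a b t))) 0 = iV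
  (pv t a).
Proof. by rewrite path_verticesE /= addr0. Qed.

Lemma path_endE a b t : (a <= b)%R ->
  nth 0 (decode (path_vertices (code_path iV iE a b t)))
        (size (decode (path_edges (code_path iV iE a b t)))) = iV (pv t b).
Proof.
move=> ab; rewrite path_edgesE size_mkseq path_verticesE.
rewrite (nth_map 0) ?size_iota // nth_iota // add0n.
by congr (iV (pv t _)); lia.
Qed.

Lemma computable_path_edges : computable 1 (fun xs => path_edges (nth 0 xs 0)).
Proof. by apply: computable_nth_decode;
  [exact: computable_const|exact: computable_nth]. Qed.
Lemma computable_path_vertices : computable 1 (fun xs => path_vertices (nth 0 xs 0)).
Proof. by apply: computable_nth_decode;
  [exact: computable_const|exact: computable_nth]. Qed.

Lemma computable_path_start :
  computable 1 (fun xs => nth 0 (decode (path_vertices (nth 0 xs 0))) 0).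
Proof. by apply: computable_nth_decode;
  [exact: computable_const|exact: computable_path_vertices]. Qed.

Lemma computable_path_end : computable 1 (fun xs =>
  nth 0 (decode (path_vertices (nth 0 xs 0))) (size (decode (path_edges (nth 0 xs 0))))).
Proof.
apply: computable_nth_decode; last exact: computable_path_vertices.
by apply: computable_size; exact: computable_path_edges.
Qed.

(** Which test recognizes the possible starting vertices depends on [G]: equality
    with the odd vertex if there is one, infinite degree otherwise. *)
Lemma start_decidable : condition_E1 G ->
  exists2 T : nat -> bool, computable 1 (fun xs => T (nth 0 xs 0)) &
    forall u, vset G u -> T (iV u) <-> forall v, residual_parityG [::] v (iV u == v).
Proof.
move=> [_ _ degG _].
have otherG u v : vset G u -> (forall w, vset G w -> iV w <> v) ->
    residual_parityG [::] v (iV u == v).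
  move=> uG nv; rewrite (introF eqP (nv u uG)); apply: residual_parity_no_vertex.
  by case=> w wG /nv; apply.
case: degG => [[v1 [[v1G odd1] un]]|[_ nodd]].
  exists (fun u => u == iV v1).
    by apply: computable_eq; [exact: computable_nth|exact: computable_const].
  move=> u uG; split=> [/eqP e v|h].
    have [[w wG wv]|nw] := pselect (exists2 w, vset G w & iV w = v); last first.
      by apply: otherG => // w wG wv; apply: nw; exists w.
    rewrite -wv e; apply: (residual_parity_vertex wG) => n dn.
    apply/idP/eqP => [on|ew]; first by rewrite (un w) //; split => //; exists n.
    by case: odd1 => m dm om; move: dn; rewrite -(injV v1G wG ew) dm => -[<-].
  case: odd1 => m dm om; have := vertex_parity v1G (h (iV v1)) dm.
  by rewrite om => /esym.
exists (fun u => degc u == 0).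
  by apply: computable_eq; [exact: cdeg|exact: computable_const].
move=> u uG; rewrite degcP //; split=> [/eqP du v|h].
  have [[w wG wv]|nw] := pselect (exists2 w, vset G w & iV w = v); last first.
    by apply: otherG => // w wG wv; apply: nw; exists w.
  rewrite -wv; apply: (residual_parity_vertex wG) => n dn.
  apply/idP/eqP => [on|ew]; first by case: (nodd w wG); exists n.
  by move: du; rewrite (injV uG wG ew) dn.
case du: (degree G u) => [m|] //=.
have := vertex_parity uG (h (iV u)) du; rewrite eqxx => om.
by case: (nodd u uG); exists m.
Qed.

Lemma one_way_decidable : condition_E1 G ->
  algorithmically_decidable
       (fun x : int * pathmap V E => finite_path G 0%R x.1 x.2)
       (fun x => code_path iV iE 0%R x.1 x.2)
       (fun x => extendable_one_way G 0%R x.1 x.2).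
Proof.
move=> E1; have [[_ infG] cG degG ends1] := E1.
have [T cT hT] := start_decidable E1.
have infE := infinite_codes infG.
have endsk U := @ends_bound 1 U ends1.
have [S [q [ES szq oq aq iq]]] := ends_witness cG infG ends1 (or_introl erefl).
apply: (decidable_by_certificates cEd cs cd cdeg (saturatedP degcP)
   (fun c c' => @connected_conn c c' cG) infE endsk ES szq oq aq iq
   (pre := fun c => T (nth 0 (decode (path_vertices c)) 0)) _ computable_path_edges).
  exact: (computable1 cT computable_path_start).
move=> [b t] /= ft; rewrite path_edgesE path_startE.
have [tr _] := trail_of_path ft.
have := tr; rewrite trail_whole => /and3P[uU EU _]; split => //.
have enE c : Ed c -> exists n, id n = c by exists c.
by rewrite extendable_one_wayP // (one_way_criterion enE infE endsk tr) hT //;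
    exact: path_vset ft.
Qed.

Lemma two_way_decidable : condition_E2 G ->
  algorithmically_decidable
       (fun x : int * int * pathmap V E => finite_path G x.1.1 x.1.2 x.2)
       (fun x => code_path iV iE x.1.1 x.1.2 x.2)
       (fun x => extendable_two_way G x.1.1 x.1.2 x.2).
Proof.
move=> [[_ infG] cG degG ends12 evenG].
have infE := infinite_codes infG.
have [k k12 endsk'] : exists2 k, k = 1 \/ k = 2 & number_of_ends G k.
  by case: ends12 => h; [exists 1; [left|]|exists 2; [right|]].
have endsk U := @ends_bound k U endsk'.
have ends2 U : ends_at_most Ed s d U 2.
  by move=> q oq aq iq; have := endsk U q oq aq iq; case: k12 => -> // /leq_trans; apply.
have [S [q [ES szq oq aq iq]]] := ends_witness cG infG endsk' k12.
have even_par v : residual_parityG [::] v false.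
  have [[w wG <-]|nw] := pselect (exists2 w, vset G w & iV w = v); last first.
    exact: residual_parity_no_vertex nw.
  apply: (residual_parity_vertex wG) => n dn.
  by case: (degG w wG) => [|[m]]; rewrite /infinite_degree dn // => -[<-] /negbTE.
have unsatE U v : uniq U -> all Ed U -> vset G v ->
    unsaturated Ed s d U (iV v) <-> ~~ saturated s d degc U (iV v).
  move=> uU EU vG; have [c0 Ec0 _] := infE [::].
  have [c Ec cv] := connected_inc cG Ec0 vG.
  have satP := saturatedP degcP uU EU Ec cv.
  by split=> [un|/satP/contrapT//]; apply/negP => /satP.
apply: (decidable_by_certificates cEd cs cd cdeg (saturatedP degcP)
   (fun c c' => @connected_conn c c' cG) infE endsk ES szq oq aq iq
   (pre := fun c =>
     ~~ saturated s d degc (decode (path_edges c)) (nth 0 (decode (path_vertices c)) 0) &&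
     ~~ saturated s d degc (decode (path_edges c)) (nth 0 (decode (path_vertices c))
         (size (decode (path_edges c))))) _ computable_path_edges).
  apply: computable_and; apply: computable_neg; apply: computable_saturated => //;
    first [exact: computable_path_edges|exact: computable_path_start|exact:
      computable_path_end].
move=> [[a b] t] /= ft; have [ab [[hv _] _]] := ft.
rewrite path_endE // path_edgesE path_startE.
have [tr en] := trail_of_path ft.
have := tr; rewrite trail_whole => /and3P[uU EU _]; split => //.
have enE c : Ed c -> exists n, id n = c by exists c.
rewrite extendable_two_wayP // (two_way_criterion enE even_par ends2 (fun U =>
    @even_ends U evenG) tr) en.
have va : vset G (pv t a) := path_vset ft.
have vb : vset G (pv t b) by apply: hv; rewrite /= /int_interval /=; lia.
have [ua ub] := (unsatE _ _ uU EU va, unsatE _ _ uU EU vb).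
split=> [[/ua -> /ub ->]//|[/andP[/ua ? /ub ?] ?]]; by split.
Qed.

End Decision.

End Transport.

Theorem theorem2 (V E : Type) (G : graph V E) (iV : V -> nat) (iE : E -> nat) :
  moderately_computable_graph iV iE G ->
  (condition_E1 G ->
     algorithmically_decidable
       (fun x : int * pathmap V E => finite_path G 0%R x.1 x.2)
       (fun x => code_path iV iE 0%R x.1 x.2)
       (fun x => extendable_one_way G 0%R x.1 x.2)) /\
  (condition_E2 G ->
     algorithmically_decidable
       (fun x : int * int * pathmap V E => finite_path G x.1.1 x.1.2 x.2)
       (fun x => code_path iV iE x.1.1 x.1.2 x.2)
       (fun x => extendable_two_way G x.1.1 x.1.2 x.2)).
Proof.
move=> mG.
have injV u v : vset G u -> vset G v -> iV u = iV v -> u = v.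
  by case: mG => [[[h _] _ _ _ _] _] vu vv; apply: h; rewrite inE.
have injE e f : eset G e -> eset G f -> iE e = iE f -> e = f.
  by case: mG => [[[_ h] _ _ _ _] _] vu vv; apply: h; rewrite inE.
have nonempty : infinite_set (eset G) -> exists v e, vset G v /\ eset G e.
  move=> infG; apply: contrapT => no; apply: infG; suff -> : eset G = set0 by [].
  apply/seteqP; split=> e // [u [v j]]; case: no; exists u, e.
  by split; [exact: joins_vset j|exact: joins_eset j].
split=> hG; have /nonempty[v0 [e0 [v0G _]]] : infinite_set (eset G) by case: hG => -[].
- have [Ed [s [d [degc [[cE cs cd cdeg] [EdP endsP degP]]]]]] := computable_model mG v0G.
  exact: (one_way_decidable injV injE EdP endsP v0 e0 cE cs cd cdeg degP).
- have [Ed [s [d [degc [[cE cs cd cdeg] [EdP endsP degP]]]]]] := computable_model mG v0G.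
  exact: (two_way_decidable injV injE EdP endsP v0 e0 cE cs cd cdeg degP).
Qed.
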